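(* Let $D=\mathrm{Diag}(d_1,\dots,d_g)$ be any polarization type. Then there are a set $F\subseteq\mathcal{H}_g$, definable in $\mathbb{R}_{an,exp}$ and containing a representative of every $G_D$-orbit in $\mathcal{H}_g$, an integer $N$, and a family of maps $\{h_\tau: E^D_\tau\to\mathbb{P}^N(\mathbb{C})\colon\tau\in F\}$ definable in $\mathbb{R}_{an,exp}$ (i.e. $\{(z,\tau,h_\tau(z)):\tau\in F,\ z\in E^D_\tau\}$ is definable), such that each $h_\tau$ is an embedding of the abelian variety $\mathbb{C}^g/(\tau\mathbb{Z}^g+D\mathbb{Z}^g)$ (with underlying set identified with $E^D_\tau$) into $\mathbb{P}^N(\mathbb{C})$.
   Context: $\mathbb{R}_{an,exp}$ is the expansion of the real ordered field by the real exponential function and all restricted analytic functions (restrictions to compact boxes of functions real analytic on a neighbourhood of the box); subsets of $\mathbb{C}^k$ are definable if definable under $\mathbb{C}=\mathbb{R}^2$, and $\mathbb{P}^N(\mathbb{C})$ is regarded as a semialgebraic set via its standard affine charts. Fix $g\geq1$; $\mathcal{H}_g=\{\tau\in\mathrm{Sym}(g,\mathbb{C}):\mathrm{Im}\tau\text{ positive definite}\}$. A polarization type is an integer diagonal matrix $D=\mathrm{Diag}(d_1,\dots,d_g)$ with positive $d_1|\cdots|d_g$. $Sp(2g,\mathbb{Q})=\{M\in GL(2g,\mathbb{Q}):MJ\,{}^tM=J\}$, $J=\begin{pmatrix}0&I_g\\-I_g&0\end{pmatrix}$, acting on $\mathcal{H}_g$ by $\begin{pmatrix}\alpha&\beta\\\gamma&\delta\end{pmatrix}\cdot\tau=(\alpha\tau+\beta)(\gamma\tau+\delta)^{-1}$.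 $G_D=\{M\in Sp(2g,\mathbb{Q}): \begin{pmatrix}I_g&0\\0&D\end{pmatrix}^{-1}M\begin{pmatrix}I_g&0\\0&D\end{pmatrix}\in M_{2g}(\mathbb{Z})\}$. For $\tau\in\mathcal{H}_g$, $\Lambda^D_\tau=\tau\mathbb{Z}^g+D\mathbb{Z}^g$ and $E^D_\tau=\{\tau r+Dr':r,r'\in[0,1)^g\}$ is its fundamental parallelogram, containing exactly one point of each coset of $\Lambda^D_\tau$; the underlying set of the torus $\mathbb{C}^g/\Lambda^D_\tau$ is identified with $E^D_\tau$. An embedding means a holomorphic injective immersion of the complex torus into $\mathbb{P}^N(\mathbb{C})$. *)

(* Defs.v *)
From HB Require Import structures.
From mathcomp Require Import all_boot all_order all_algebra.
From mathcomp Require Import complex.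
From mathcomp Require Import all_classical all_reals all_analysis.
From mathcomp.analysis.showcase Require summability.

Set Implicit Arguments.
Unset Strict Implicit.
Unset Printing Implicit Defensive.

Import Order.TTheory GRing.Theory Num.Theory.
Import numFieldNormedType.Exports.

Local Open Scope classical_set_scope.
Local Open Scope ring_scope.

Section RanExp.
Variable R : realType.

(* The multivariate power series is summed unconditionally, i.e. along the
   directed set of finite sets of multi-indices. *)
Definition analytic_at n (f : 'rV[R]_n -> R) (x : 'rV[R]_n) : Prop :=
  exists c : {ffun 'I_n -> nat} -> R,
    nbhs x [set y : 'rV[R]_n |
      summability.partial_sum
        (fun a => c a * \prod_(i < n) (y 0 i - x 0 i) ^+ a i)
        @ summability.totally --> f y].

Definition box n (lo hi : 'rV[R]_n) : set 'rV[R]_n :=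
  [set x | forall i, lo 0 i <= x 0 i <= hi 0 i].

(* A restricted analytic function is made total by the value 0 off its box. *)
Definition restricted_analytic n (f : 'rV[R]_n -> R) : Prop :=
  exists (F : 'rV[R]_n -> R) (lo hi : 'rV[R]_n) (U : set 'rV[R]_n),
    [/\ open U /\ box lo hi `<=` U,
        forall x, U x -> analytic_at F x,
        forall x, box lo hi x -> f x = F x
      & forall x, ~ box lo hi x -> f x = 0].

Inductive term (n : nat) : Type :=
| TVar of 'I_n
| TConst of R
| TAdd of term n & term n
| TOpp of term n
| TMul of term n & term n
| TExp of term n
| TAn k (f : 'rV[R]_k -> R) of restricted_analytic f & ('I_k -> term n).

Fixpoint eval n (x : 'rV[R]_n) (t : term n) : R :=
  match t with
  | TVar i => x 0 i
  | TConst c => c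
  | TAdd t1 t2 => eval x t1 + eval x t2
  | TOpp t1 => - eval x t1
  | TMul t1 t2 => eval x t1 * eval x t2
  | TExp t1 => expR (eval x t1)
  | TAn k f _ ts => f (\row_(i < k) eval x (ts i))
  end.

(* [formula n] has its free variables among 'I_n; the variable bound by [FEx]
   is number 0 in the body. *)
Inductive formula : nat -> Type :=
| FEq n of term n & term n : formula n
| FLt n of term n & term n : formula n
| FNot n of formula n : formula n
| FAnd n of formula n & formula n : formula n
| FEx n of formula (1 + n) : formula n.

Fixpoint holds n (phi : formula n) : 'rV[R]_n -> Prop :=
  match phi in formula n return 'rV[R]_n -> Prop with
  | FEq _ t1 t2 => fun x => eval x t1 = eval x t2
  | FLt _ t1 t2 => fun x => eval x t1 < eval x t2
  | FNot _ p => fun x => ~ holds p x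
  | FAnd _ p q => fun x => holds p x /\ holds q x
  | FEx _ p => fun x => exists r : R, holds p (row_mx r%:M x)
  end.

Definition definable n (S : set 'rV[R]_n) : Prop :=
  exists phi : formula n, S = [set x | holds phi x].

End RanExp.

Section Projective.
Variable K : numFieldType.

Definition projspace (N : nat) : Type :=
  {L : {vspace 'rV[K]_N.+1} | (\dim L == 1)%N}.

Definition homog_coords N (p : projspace N) (v : 'rV[K]_N.+1) : Prop :=
  sval p = <[v]>%VS.

(* Homogeneous coordinates of the point with affine coordinates [u] in the
   i-th standard chart. *)
Definition chart N (i : 'I_N.+1) (u : 'rV[K]_N) : 'rV[K]_N.+1 :=
  \row_j (if unlift i j is Some k then u 0 k else 1).

Definition holomorphic_immersion g N (f : 'cV[K]_g -> projspace N) : Prop :=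
  forall z, exists (i : 'I_N.+1) (phi : 'cV[K]_g -> 'rV[K]_N),
    [/\ \forall w \near z, homog_coords (f w) (chart i (phi w)),
        \forall w \near z, differentiable phi w
      & injective ('d phi z)].

(* [E] is a set of representatives for K^g / Lam.  The complex structure of the
   torus is the one making K^g -> K^g / Lam a local biholomorphism, so a map on
   the torus is studied through its Lam-periodic lift [f]. *)
Definition torus_embedding g N (Lam E : set 'cV[K]_g)
    (h : 'cV[K]_g -> projspace N) : Prop :=
  exists f : 'cV[K]_g -> projspace N,
    [/\ forall z, E z -> f z = h z,
        forall z w, f z = f w <-> Lam (z - w)
      & holomorphic_immersion f].

End Projective.

Section ComplexDefinable.
Variable R : realType.
Local Notation C := R[i].

Definition realify n (z : 'rV[C]_n) : 'rV[R]_(n + n) :=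
  row_mx (map_mx (@complex.Re R) z) (map_mx (@complex.Im R) z).

Definition definableC n (S : set 'rV[C]_n) : Prop :=
  definable (@realify n @` S).

Definition definableM m n (S : set 'M[C]_(m, n)) : Prop :=
  definableC (mxvec @` S).

(* Definability in C^n x P^N(C), tested in each standard chart of P^N(C). *)
Definition definableCP n N (S : set ('rV[C]_n * projspace C N)) : Prop :=
  forall i : 'I_N.+1,
    definableC [set v | exists (x : 'rV[C]_n) (u : 'rV[C]_N) (p : projspace C N),
      [/\ S (x, p), homog_coords p (chart i u) & v = row_mx x u]].

End ComplexDefinable.

Section Siegel.
Variable R : realType.
Local Notation C := R[i].
Variable g : nat.

Definition siegel : set 'M[C]_g :=
  [set tau | tau^T = tau /\
    forall v : 'cV[R]_g, v != 0 ->
      0 < (v^T *m map_mx (@complex.Im R) tau *m v) 0 0].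

Definition polarization_type (D : 'M[int]_g) : Prop :=
  [/\ is_diag_mx D, forall i, 0 < D i i
    & forall i j : 'I_g, (i <= j)%N -> (D i i %| D j j)%Z].

Definition sympJ : 'M[rat]_(g + g) := block_mx 0 1%:M (- 1%:M) 0.

Definition Sp : set 'M[rat]_(g + g) :=
  [set M | M \in unitmx /\ M *m sympJ *m M^T = sympJ].

Definition GD (D : 'M[int]_g) : set 'M[rat]_(g + g) :=
  [set M | Sp M /\
    let P : 'M[rat]_(g + g) := block_mx 1%:M 0 0 (map_mx intr D) in
    invmx P *m M *m P \is a mxOver Num.int].

Definition sp_act (M : 'M[rat]_(g + g)) (tau : 'M[C]_g) : 'M[C]_g :=
  let Mc : 'M[C]_(g + g) := map_mx ratr M in
  (ulsubmx Mc *m tau + ursubmx Mc) *m invmx (dlsubmx Mc *m tau + drsubmx Mc).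

Definition lattice (D : 'M[int]_g) (tau : 'M[C]_g) : set 'cV[C]_g :=
  [set z | exists m n : 'cV[int]_g,
    z = tau *m map_mx intr m + map_mx intr D *m map_mx intr n].

Definition parallelogram (D : 'M[int]_g) (tau : 'M[C]_g) : set 'cV[C]_g :=
  [set z | exists r r' : 'cV[R]_g,
    (forall i, 0 <= r i 0 < 1 /\ 0 <= r' i 0 < 1) /\
    z = tau *m map_mx (real_complex R) r
        + map_mx intr D *m map_mx (real_complex R) r'].

End Siegel.

(* Main.v *)
From HB Require Import structures.
Require Import Defs.
From mathcomp Require Import all_boot all_order all_algebra.
From mathcomp Require Import complex finmap zify ring lra.
From mathcomp Require Import all_classical all_reals all_analysis.
From mathcomp.analysis.showcase Require summability.

Set Implicit Arguments.
Unset Strict Implicit.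
Unset Printing Implicit Defensive.

Import Order.TTheory GRing.Theory Num.Theory.
Import numFieldNormedType.Exports.

Local Open Scope classical_set_scope.
Local Open Scope ring_scope.

(** For [c] large and [eps] small, call [tau0] tame if its real part is bounded by [X], its
    diagonal imaginary parts are at least [c], and its off-diagonal imaginary parts are at most
    [eps] times the diagonal ones.  Siegel reduction gives [Im tau = V^T diag(d) V] with [V] unitriangular and
    bounded and [d] bounded below; a rational approximation of [V] followed by a dilation makes
    [tau] tame.  Only finitely many such rational matrices, and finitely many classes modulo the
    congruence subgroup of [G_D], are needed, so finitely many rational symplectic translates
    [r . tame] meet every orbit of [G_D].  [F] is their union.

    For [tau = r . tau0], multiplication by [K (gamma tau0 + delta)^T], with [K] clearing
    denominators, maps the lattice of [tau] onto the finite index sublattice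
    [(tau0, 1) W Z^(2g)] of [tau0 Z^g + Z^g].  The projective coordinates are the theta functions
    of order three on [tau0]: those with trivial character separate the points and the tangent
    vectors of [C^g / (tau0 Z^g + Z^g)], and those twisted by the characters of [Z^(2g)] given by the rows
    of [W^-1] separate the cosets of the sublattice, which is where these characters are trivial.

    As in Lefschetz's theorem, [theta (z - a) theta (z - b) theta (z + a + b)] is a combination of
    order three theta functions of [z].  Since [tau0] is tame, for suitable heights of [a] and [b]
    one term of each factor dominates the sum of all the others.  So if the order three functions
    do not separate [z1] and [z2], the ratio of [theta (z1 - a - x)] to [theta (z2 - a - x)] is,
    as a function of the real vector [x], multiplicative and close to a character, hence equal to
    one, and uniqueness of Fourier coefficients shows that [z1 - z2] is in the lattice.

    For definability, the imaginary part of a tame [tau0] is a combination, with coefficients at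
    least 1, of squares of the linear forms [w_i] and [w_i +- w_j].  After the largest exponential
    is factored out, a theta function is then a convergent power series in bounded quantities
    such as [exp (- lam)], hence a restricted analytic function composed with exponentials. *)

(** * Unconditional summation of complex families *)

(** The obstacle is uniformity: over [F] the imaginary part of [tau0] is unbounded, so a theta
    function is not itself restricted analytic, while the embedding property must hold at every
    single [tau]. Tameness serves both ends. A large, nearly diagonal [Im tau0] makes one theta term
    explicitly dominant, so that estimates replace the geometry of theta divisors; and it bounds the
    coefficients of the chosen squares from below, which confines the exponentials to a fixed box.
    Integral matrices alone do not make the imaginary part nearly diagonal, hence the rational ones.
    The analysis stays elementary: derivatives are taken term by term with a quadratic remainder,
    Fourier coefficients are isolated by averaging over translates instead of integrating, and
    suprema and infima are only approached within a fixed ratio, since the reduction bounds leave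
    room. The target has dimension [(2 g + 1) 3^g - 1]: the [3^g] functions of order three, once for
    each of the [2 g] characters and once for the trivial one. For each of the finitely many
    rational matrices the map is one formula, and taking the first suitable matrix makes it a
    function of [tau]. *)

Section Sums.
Variable R : realType.
Local Notation C := R[i].
Local Notation normc := (@Normc.normc R).

(** Summation along finite subsets is the convergence used in [analytic_at]. It is invariant under
    bijections of the index set, on which every shift of a theta series relies; [abs_bounded] is the
    quantitative form of summability. *)
Definition hsum (I : choiceType) (f : I -> C) (s : C) : Prop :=
  forall e : R, 0 < e -> exists A0 : {fset I}, forall A : {fset I},
    (A0 `<=` A)%fset -> normc (\sum_(i <- A) f i - s) < e.

Definition abs_bounded (I : choiceType) (f : I -> C) (B : R) : Prop :=
  forall A : {fset I}, \sum_(i <- A) normc (f i) <= B.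

Lemma normc_ge0 (z : C) : 0 <= normc z.
Proof. by case: z => a b /=; exact: sqrtr_ge0. Qed.

Lemma normc_real (a : R) : normc (real_complex R a) = `|a|.
Proof. by rewrite /= expr0n addr0 sqrtr_sqr. Qed.

Lemma normcB (x y : C) : normc (x - y) = normc (y - x).
Proof. by rewrite -normcN opprB. Qed.

Lemma normc_eq0 (z : C) : (normc z == 0) = (z == 0).
Proof.
by apply/eqP/eqP => [/Normc.eq0_normc //|->]; exact: Normc.normc0.
Qed.

Lemma normc_gt0 (z : C) : (0 < normc z) = (z != 0).
Proof. by rewrite lt_def normc_ge0 andbT normc_eq0. Qed.

Lemma normcX (z : C) n : normc (z ^+ n) = normc z ^+ n.
Proof.
by elim: n => [|n IH]; rewrite ?expr0 ?Normc.normc1 // !exprS Normc.normcM IH.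
Qed.

Lemma normc_sum (J : Type) (r : seq J) (P : pred J) (F : J -> C) :
  normc (\sum_(j <- r | P j) F j) <= \sum_(j <- r | P j) normc (F j).
Proof.
elim/big_rec2: _ => [|j y x _ h]; first by rewrite Normc.normc0.
by apply: (le_trans (le_normcD _ _)); rewrite lerD2l.
Qed.

Lemma normc_ReIm_le (z : C) :
  `|complex.Re z| <= normc z /\ `|complex.Im z| <= normc z.
Proof.
case: z => a b /=; split; rewrite -sqrtr_sqr ler_wsqrtr //.
  by rewrite lerDl sqr_ge0.
by rewrite lerDr sqr_ge0.
Qed.

Lemma hsum_uniq (I : choiceType) (f : I -> C) s t : hsum f s -> hsum f t -> s = t.
Proof.
move=> hs ht; apply/eqP; rewrite -subr_eq0 -normc_eq0; apply/negPn/negP => nz.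
have e0 : 0 < normc (s - t) / 2 by rewrite divr_gt0 // lt_def nz normc_ge0.
have [A hA] := hs _ e0; have [B hB] := ht _ e0.
have := hA (A `|` B)%fset (fsubsetUl _ _); have := hB (A `|` B)%fset (fsubsetUr _ _).
set S := \sum_(i <- _) _; rewrite (normcB S s) => h1 h2.
have := le_normcD (s - S) (S - t); rewrite addrA subrK; lra.
Qed.

Lemma hsum_ext (I : choiceType) (f h : I -> C) s :
  (forall i, f i = h i) -> hsum f s -> hsum h s.
Proof. by move=> /funext ->. Qed.

Lemma hsumD (I : choiceType) (f h : I -> C) s t :
  hsum f s -> hsum h t -> hsum (fun i => f i + h i) (s + t).
Proof.
move=> hs ht e e0; have e2 : 0 < e / 2 by rewrite divr_gt0.
have [A hA] := hs _ e2; have [B hB] := ht _ e2.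
exists (A `|` B)%fset => D; rewrite fsubUset => /andP[/hA h1 /hB h2].
rewrite big_split /= opprD addrACA.
have := le_normcD (\sum_(i <- D) f i - s) (\sum_(i <- D) h i - t); lra.
Qed.

Lemma hsumZ (I : choiceType) (f : I -> C) s c :
  hsum f s -> hsum (fun i => c * f i) (c * s).
Proof.
move=> hs e e0.
have c1 : 0 < normc c + 1 by rewrite ltr_wpDl // normc_ge0.
have [A hA] := hs _ (divr_gt0 e0 c1); exists A => D /hA.
rewrite -mulr_sumr -mulrBr Normc.normcM ltr_pdivlMr // mulrDr mulr1 => h.
apply: le_lt_trans h; rewrite mulrC lerDl; exact: normc_ge0.
Qed.

Lemma hsum0 (I : choiceType) : hsum (fun _ : I => 0) 0.
Proof.
by move=> e e0; exists fset0 => A _; rewrite big1 // subr0 Normc.normc0.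
Qed.

Lemma hsum_sum (I : choiceType) (K : Type) (r : seq K) (P : pred K)
    (f : K -> I -> C) s :
  (forall k, hsum (f k) (s k)) ->
  hsum (fun i => \sum_(k <- r | P k) f k i) (\sum_(k <- r | P k) s k).
Proof.
move=> h; elim: r => [|k r IH].
  rewrite big_nil; apply: (hsum_ext _ (hsum0 I)) => i; by rewrite big_nil.
rewrite big_cons; case: (boolP (P k)) => Pk.
  by apply: hsum_ext (hsumD (h k) IH) => i; rewrite big_cons Pk.
by apply: hsum_ext IH => i; rewrite big_cons (negbTE Pk).
Qed.

Lemma abs_bounded_ge0 (I : choiceType) (f : I -> C) B : abs_bounded f B -> 0 <= B.
Proof. by move=> /(_ fset0); rewrite big_seq_fset0. Qed.

Lemma hsum_le (I : choiceType) (f : I -> C) s B :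
  hsum f s -> abs_bounded f B -> normc s <= B.
Proof.
move=> hs hB; apply/ler_addgt0Pr => e e0.
have [A /(_ A (fsubset_refl _)) hA] := hs _ e0.
have := le_normcD (\sum_(i <- A) f i) (s - \sum_(i <- A) f i).
rewrite addrC subrK normcB => h; have := normc_sum (enum_fset A) xpredT f.
have := hB A; lra.
Qed.

Lemma sum_fset_le (I : choiceType) (F : I -> R) (A B : {fset I}) :
  (forall i, 0 <= F i) -> (A `<=` B)%fset ->
  \sum_(i <- A) F i <= \sum_(i <- B) F i.
Proof.
move=> F0 AB; rewrite (big_fsetID _ (mem A) B) /=.
have -> : [fset x in B | mem A x]%fset = A.
  by apply/fsetP => x; rewrite !inE /= andb_idl // => /(fsubsetP AB).
by rewrite lerDl sumr_ge0.
Qed.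

Lemma hsum_ge0_exists (I : choiceType) (F : I -> R) B :
  (forall i, 0 <= F i) -> (forall A : {fset I}, \sum_(i <- A) F i <= B) ->
  exists s, hsum (fun i => real_complex R (F i)) (real_complex R s).
Proof.
move=> F0 hB; pose E := [set x | exists A : {fset I}, x = \sum_(i <- A) F i].
have supE : has_sup E.
  by split; [exists (\sum_(i <- fset0) F i); exists fset0 | exists B => _ [A ->]].
exists (sup E) => e e0; have [_ [A ->] hA] := sup_adherent e0 supE.
exists A => D AD; rewrite -rmorph_sum -rmorphB normc_real.
have h1 := sum_fset_le F0 AD.
have h2 : \sum_(i <- D) F i <= sup E by apply: ub_le_sup => //; [case: supE | exists D].
rewrite ler0_norm; lra.
Qed.

Lemma hsum_real_exists (I : choiceType) (F : I -> R) B :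
  (forall A : {fset I}, \sum_(i <- A) `|F i| <= B) ->
  exists s, hsum (fun i => real_complex R (F i)) (real_complex R s).
Proof.
move=> hB.
have [s hs] : exists s, hsum (fun i => real_complex R `|F i|) (real_complex R s).
  exact: hsum_ge0_exists hB.
have [t ht] : exists t, hsum (fun i => real_complex R (F i + `|F i|)) (real_complex R t).
  apply: (@hsum_ge0_exists _ _ (B + B)) => [i|A].
    by rewrite addrC -lerBlDr sub0r lerNl lerNnormlW.
  rewrite big_split /= lerD // (le_trans _ (hB A)) //; apply: ler_sum => i _.
  exact: ler_norm.
exists (t - s); rewrite rmorphB -mulN1r.
apply: hsum_ext (hsumD ht (hsumZ (-1) hs)) => i.
by rewrite mulN1r -rmorphB addrK.
Qed.

Lemma hsum_exists (I : choiceType) (f : I -> C) B :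
  abs_bounded f B -> exists s, hsum f s.
Proof.
move=> hB.
have [s hs] : exists s, hsum (fun i => real_complex R (complex.Re (f i))) (real_complex R s).
  apply: (@hsum_real_exists _ _ B) => A; apply: le_trans (hB A).
  by apply: ler_sum => i _; case: (normc_ReIm_le (f i)).
have [t ht] : exists s, hsum (fun i => real_complex R (complex.Im (f i))) (real_complex R s).
  apply: (@hsum_real_exists _ _ B) => A; apply: le_trans (hB A).
  by apply: ler_sum => i _; case: (normc_ReIm_le (f i)).
exists (real_complex R s + 'i%C * real_complex R t).
by apply: hsum_ext (hsumD hs (hsumZ 'i%C ht)) => i; rewrite -complexE.
Qed.

Lemma hsum_reindex (I J : choiceType) (h : J -> I) (h' : I -> J) (f : I -> C) s :
  cancel h h' -> cancel h' h -> hsum f s -> hsum (f \o h) s.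
Proof.
move=> hK h'K hs e e0; have [A hA] := hs _ e0.
exists [fset h' x | x in A]%fset => D AD.
have := hA [fset h x | x in D]%fset; rewrite big_imfset /=; last first.
  by move=> x y _ _; exact: (can_inj hK).
apply; apply/fsubsetP => x xA; apply/imfsetP; exists (h' x); last by rewrite h'K.
by apply: (fsubsetP AD); apply/imfsetP; exists x.
Qed.

Lemma abs_bounded_comp (I J : choiceType) (h : J -> I) (f : I -> C) B :
  injective h -> abs_bounded f B -> abs_bounded (f \o h) B.
Proof.
move=> hi hB A; have := hB [fset h x | x in A]%fset.
by rewrite big_imfset //= => x y _ _; exact: hi.
Qed.

Lemma abs_bounded_le (I : choiceType) (f : I -> C) (b : I -> R) c B :
  abs_bounded (fun i => real_complex R (b i)) B -> 0 <= c ->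
  (forall i, normc (f i) <= c * b i) -> abs_bounded f (c * B).
Proof.
move=> hB c0 h A; apply: (@le_trans _ _ (\sum_(i <- A) (c * normc (real_complex R (b i))))).
  apply: ler_sum => i _; apply: (le_trans (h i)); rewrite ler_wpM2l // normc_real.
  exact: ler_norm.
by rewrite -mulr_sumr ler_wpM2l.
Qed.

Lemma fset_rect (I J : choiceType) (A : {fset I * J}) :
  exists (A1 : {fset I}) (A2 : {fset J}), forall p, p \in A -> (p.1 \in A1) && (p.2 \in A2).
Proof.
exists [fset p.1 | p in A]%fset, [fset p.2 | p in A]%fset => p pA.
by apply/andP; split; apply/imfsetP; exists p.
Qed.

Lemma fset_prodE (I J : choiceType) (A1 : {fset I}) (A2 : {fset J})
    (V : zmodType) (F : I * J -> V) :
  \sum_(p <- (A1 `*` A2)%fset) F p = \sum_(i <- A1) \sum_(j <- A2) F (i, j).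
Proof.
rewrite -big_allpairs_dep /=; apply: perm_big; apply: uniq_perm.
- exact: fset_uniq.
- by apply: allpairs_uniq => [||[? ?] [? ?] _ _ /= []-> ->].
move=> [i j]; rewrite in_fsetM /=; apply/andP/allpairsP => [[h1 h2]|[[a b] /= [? ? [-> ->]]] //].
by exists (i, j).
Qed.

Lemma abs_bounded_pair (I J : choiceType) (F : I * J -> C) (b : I -> R) B :
  (forall i, abs_bounded (fun j => F (i, j)) (b i)) ->
  abs_bounded (fun i => real_complex R (b i)) B -> abs_bounded F B.
Proof.
move=> h hB A; have [A1 [A2 hA]] := fset_rect A.
have AA : (A `<=` A1 `*` A2)%fset by apply/fsubsetP => p /hA; rewrite in_fsetM.
apply: (le_trans (sum_fset_le (fun i => normc_ge0 _) AA)); rewrite fset_prodE.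
apply: le_trans (hB A1); apply: ler_sum => i _; apply: (le_trans (h i A2)).
rewrite normc_real; exact: ler_norm.
Qed.

(** Fubini. For finite [D] the inner sums are attained up to [e / 2] on one finite set, which is
    enlarged until its rectangle with [D] contains the finite set that controls [F]. *)
Lemma hsum_sigma (I J : choiceType) (F : I * J -> C) s t :
  hsum F s -> (forall i, hsum (fun j => F (i, j)) (t i)) -> hsum t s.
Proof.
move=> hF ht e e0; have e2 : 0 < e / 2 by rewrite divr_gt0.
have [A hA] := hF _ e2; have [A1 [A2 hA12]] := fset_rect A.
exists A1 => D A1D.
have hfin : hsum (fun j => \sum_(i <- D) F (i, j)) (\sum_(i <- D) t i).
  by apply: hsum_sum => i.
have [E hE] := hfin _ e2; have := hE (E `|` A2)%fset (fsubsetUl _ _).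
rewrite exchange_big /= -fset_prodE => h1.
have := hA (D `*` (E `|` A2))%fset; set S := \sum_(p <- _) _ in h1 *.
move=> h2; have {}h2 : normc (S - s) < e / 2.
  apply: h2; apply/fsubsetP => p /hA12 /andP[p1 p2].
  by rewrite in_fsetM (fsubsetP A1D) //= in_fsetU p2 orbT.
have := le_normcD (\sum_(i <- D) t i - S) (S - s).
by rewrite addrA subrK (normcB _ S) => h3; lra.
Qed.

Lemma abs_bounded_mul (I J : choiceType) (f : I -> C) (h : J -> C) B B' :
  abs_bounded f B -> abs_bounded h B' ->
  abs_bounded (fun p : I * J => f p.1 * h p.2) (B * B').
Proof.
move=> hB hB'; have B0 := abs_bounded_ge0 hB'.
apply: (@abs_bounded_pair _ _ _ (fun i => normc (f i) * B')) => [i A|A].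
  rewrite /=; under eq_bigr do rewrite Normc.normcM.
  by rewrite -mulr_sumr ler_wpM2l ?normc_ge0.
under eq_bigr do rewrite normc_real ger0_norm ?mulr_ge0 ?normc_ge0 //.
by rewrite -mulr_suml ler_wpM2r.
Qed.

Lemma hsum_mul (I J : choiceType) (f : I -> C) (h : J -> C) B B' s t :
  abs_bounded f B -> abs_bounded h B' -> hsum f s -> hsum h t ->
  hsum (fun p : I * J => f p.1 * h p.2) (s * t).
Proof.
move=> hB hB' hs ht; have [u hu] := hsum_exists (abs_bounded_mul hB hB').
have h1 : hsum (fun i => f i * t) u.
  by apply: (hsum_sigma hu) => i; exact: (hsumZ (f i) ht).
have h2 : hsum (fun i => f i * t) (s * t).
  by rewrite mulrC; apply: hsum_ext (hsumZ t hs) => i; rewrite mulrC.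
by rewrite -(hsum_uniq h1 h2).
Qed.

(** Finiteness of the outer index replaces an absolute bound: the fibres are approximated
    separately, each within [e / M]. *)
Lemma hsum_fin (K : finType) (J : choiceType) (F : K * J -> C) (s : K -> C) :
  (forall k, hsum (fun j => F (k, j)) (s k)) -> hsum F (\sum_k s k).
Proof.
move=> h e e0.
pose M : R := #|K|%:R + 1; have M0 : 0 < M by rewrite ltr_wpDl // ler0n.
have hk k : exists A0 : {fset J}, forall A : {fset J}, (A0 `<=` A)%fset ->
  normc (\sum_(j <- A) F (k, j) - s k) < e / M by apply: h; rewrite divr_gt0.
have [A0 hA0] := choice hk.
exists (\bigcup_(k <- enum K) [fset (k, j) | j in A0 k])%fset => A hA.
have -> : \sum_(p <- A) F p = \sum_k \sum_(j <- [fset p.2 | p in A & p.1 == k]%fset) F (k, j).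
  rewrite (partition_big (fun p => p.1) xpredT) //=; apply: eq_bigr => k _.
  rewrite big_imfset /=; last first.
    move=> [a b] [c d] /andP[_ /= /eqP ->] /andP[_ /= /eqP ->].
    by move=> ->.
  rewrite big_filter /=.
  by apply: eq_bigr => -[a b] /= /eqP ->.
rewrite -sumrB; apply: (le_lt_trans (normc_sum _ _ _)).
apply: (@le_lt_trans _ _ (\sum_(k : K) e / M)).
  apply: ler_sum => k _; apply/ltW/hA0; apply/fsubsetP => j jA.
  apply/imfsetP; exists (k, j) => //=; rewrite !inE eqxx andbT.
  apply: (fsubsetP hA); apply/bigfcupP; exists k; first by rewrite mem_enum.
  by apply/imfsetP; exists j.
rewrite sumr_const -[_ *+ _]mulr_natr -mulrA gtr_pMr // mulrC ltr_pdivrMr // mul1r.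
by rewrite /M ltrDl.
Qed.

Lemma abs_bounded_tail (I : choiceType) (f : I -> C) B e :
  abs_bounded f B -> 0 < e -> exists A0 : {fset I}, forall A : {fset I},
    [disjoint A0 & A]%fset -> \sum_(i <- A) normc (f i) < e.
Proof.
move=> hB e0; have [s hs] := @hsum_ge0_exists _ _ _ (fun i => normc_ge0 (f i)) hB.
have e2 : 0 < e / 2 by rewrite divr_gt0.
have [A0 hA] := hs _ e2; exists A0 => A dA.
have h1 := hA _ (fsubset_refl _); have := hA _ (fsubsetUl A0 A).
rewrite -!rmorph_sum in h1 *; rewrite -!rmorphB !normc_real in h1 *.
rewrite (big_fsetID _ (mem A0) (A0 `|` A)%fset) /=.
have -> : [fset x in (A0 `|` A)%fset | mem A0 x]%fset = A0.
  by apply/fsetP => x; rewrite !inE /=; case: (boolP (x \in A0)) => //= _; rewrite andbF.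
have -> : [fset x in (A0 `|` A)%fset | ~~ mem A0 x]%fset = A.
  apply/fsetP => x; rewrite !inE /=; case: (boolP (x \in A0)) => xA0 //=.
  - by rewrite (negbTE (fdisjointP dA _ xA0)).
  - by rewrite andbT.
set u := \sum_(i <- A0) _ in h1 *; set v := \sum_(i <- A) _.
have v0 : 0 <= v by apply: sumr_ge0 => i _; exact: normc_ge0.
move: h1; rewrite !ltr_norml; lra.
Qed.

Local Existing Instance summability.totally_filter.

(** Bridge to the mode of convergence in [analytic_at]. *)
Lemma hsum_totally (I : choiceType) (f : I -> R) (s : R) :
  hsum (fun i => real_complex R (f i)) (real_complex R s) ->
  summability.partial_sum f @ summability.totally --> s.
Proof.
move=> hs; apply/cvgrPdist_lt => e e0; have [A0 hA] := hs _ e0.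
exists A0 => // A /= /hA.
by rewrite -rmorph_sum -rmorphB normc_real big_seq_fsetE /= distrC.
Qed.

End Sums.

(** * The complex exponential *)

Section ComplexExp.
Variable R : realType.
Local Notation C := R[i].
Local Notation normc := (@Normc.normc R).
Local Notation RC := (real_complex R).

Definition cexp (z : C) : C :=
  Complex (expR (complex.Re z) * cos (complex.Im z))
          (expR (complex.Re z) * sin (complex.Im z)).

Lemma cexpD z w : cexp (z + w) = cexp z * cexp w.
Proof.
case: z w => [a b] [c d]; apply/eqP; rewrite eq_complex /= expRD cosD sinD.
by apply/andP; split; apply/eqP; ring.
Qed.

Lemma cexp_real (a : R) : cexp (RC a) = RC (expR a).
Proof. by rewrite /cexp /= cos0 sin0 mulr1 mulr0. Qed.

Lemma cexp0 : cexp 0 = 1.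
Proof. by rewrite -(rmorph0 RC) cexp_real expR0. Qed.

Lemma normc_cexp z : normc (cexp z) = expR (complex.Re z).
Proof.
case: z => a b /=; rewrite !exprMn -mulrDr cos2Dsin2 mulr1 sqrtr_sqr.
by rewrite ger0_norm ?expR_ge0.
Qed.

Lemma cexp_neq0 z : cexp z != 0.
Proof. by rewrite -normc_gt0 normc_cexp expR_gt0. Qed.

Lemma cexpN z : cexp (- z) = (cexp z)^-1.
Proof.
by apply: (mulfI (cexp_neq0 z)); rewrite -cexpD subrr cexp0 mulfV ?cexp_neq0.
Qed.

Lemma cexp_sum (J : Type) (r : seq J) (P : pred J) (F : J -> C) :
  cexp (\sum_(j <- r | P j) F j) = \prod_(j <- r | P j) cexp (F j).
Proof. exact: (big_morph _ cexpD cexp0). Qed.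

Lemma sum_fset_iota (V : zmodType) (F : nat -> V) n :
  \sum_(i <- [fset i in iota 0 n]%fset) F i = \sum_(0 <= i < n) F i.
Proof.
rewrite /index_iota subn0; apply: perm_big; apply: uniq_perm; rewrite ?iota_uniq //.
by move=> i; rewrite !inE.
Qed.

Lemma fsubset_iota (A : {fset nat}) :
  (A `<=` [fset i in iota 0 (\max_(i <- A) i).+1])%fset.
Proof.
apply/fsubsetP => i iA; rewrite in_fset mem_iota leq0n add0n ltnS.
exact: leq_bigmax_seq.
Qed.

Lemma hsum_nat_S (f : nat -> C) s : hsum f s -> hsum (fun n => f n.+1) (s - f 0%N).
Proof.
move=> hs e e0; have [A hA] := hs _ e0.
exists [fset x.-1 | x in A]%fset => D AD.
have := hA (0%N |` [fset x.+1 | x in D])%fset.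
rewrite big_fsetU1 /=; last by apply/imfsetP => -[].
rewrite big_imfset /=; last by move=> x y _ _ [].
rewrite opprB addrA [f 0%N + _]addrC addrAC; apply; apply/fsubsetP => -[|x] xA; rewrite !inE //=.
apply/imfsetP; exists x => //; apply: (fsubsetP AD); apply/imfsetP.
by exists x.+1.
Qed.

Lemma hsum_series (f : nat -> R) s :
  hsum (fun n => RC (f n)) (RC s) -> series f @ \oo --> s.
Proof.
move=> hs; apply/cvgrPdist_lt => e e0; have [A0 hA] := hs _ e0.
exists (\max_(i <- A0) i).+1 => // n /= hn.
have := hA [fset i in iota 0 n]%fset.
rewrite -rmorph_sum -rmorphB normc_real distrC sum_fset_iota; apply.
apply/fsubsetP => i iA; rewrite !inE /= mem_iota add0n /=.
by apply: leq_trans hn; rewrite ltnS; apply: leq_bigmax_seq.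
Qed.

Lemma abs_bounded_exp (x : R) : abs_bounded (fun n => RC (x ^+ n / n`!%:R)) (expR `|x|).
Proof.
move=> A; under eq_bigr do
  rewrite normc_real normf_div normrX (@ger0_norm _ _%:R) ?ler0n //.
apply: (@le_trans _ _ (series (exp_coeff `|x|) (\max_(i <- A) i).+1)); last first.
  apply: nondecreasing_cvgn_le (is_cvg_series_exp_coeff _) _.
  by apply/nondecreasing_seqP => n; rewrite /series /= big_nat_recr //= lerDl exp_coeff_ge0.
rewrite /series /= -sum_fset_iota.
apply: sum_fset_le => [i|]; [exact: exp_coeff_ge0 | exact: fsubset_iota].
Qed.

Lemma hsum_expR (x : R) : hsum (fun n => RC (x ^+ n / n`!%:R)) (RC (expR x)).
Proof.
have [s hs] : exists s, hsum (fun n => RC (x ^+ n / n`!%:R)) (RC s).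
  apply: (@hsum_real_exists _ _ _ (expR `|x|)) => A.
  apply: le_trans (abs_bounded_exp x A).
  by apply: ler_sum => i _; rewrite normc_real.
have h := hsum_series hs; suff -> : expR x = s by [].
by rewrite /expR; apply: cvg_lim.
Qed.

(** Interleaves the cosine and sine series. Together with [hsum_expR] it gives the exponential
    series on the two axes, which suffices below: phases are expanded along the imaginary axis
    only. *)
Lemma hsum_cexp_imag (t : R) :
  hsum (fun n => ('i%C * RC t) ^+ n / n`!%:R) (cexp ('i%C * RC t)).
Proof.
pose S (f : nat -> R) := forall A : {fset nat}, \sum_(i <- A) `|f i| <= expR `|t|.
have bnd (f : nat -> R) : (forall n, `|f n| <= `|t ^+ n / n`!%:R|) -> S f.
  move=> h A; apply: le_trans (abs_bounded_exp t A).
  by apply: ler_sum => i _; rewrite normc_real.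
have sgn (n k : nat) (b : bool) :
  `|(b%:R * (-1) ^+ k * t ^+ n / n`!%:R : R)| <= `|t ^+ n / n`!%:R|.
  rewrite -mulrA normrM ler_piMl // normrM normrX normrN1 expr1n mulr1.
  by case: b; rewrite ?normr1 ?normr0.
have [c hc] := @hsum_real_exists _ _ _ _ (bnd (cos_coeff t) (fun n => sgn n _ _)).
have [s hs] := @hsum_real_exists _ _ _ _ (bnd (sin_coeff t) (fun n => sgn n _ _)).
have Ec : cos t = c by rewrite unlock; apply: cvg_lim => //; exact: hsum_series.
have Es : sin t = s by rewrite unlock; apply: cvg_lim => //; exact: hsum_series.
have -> : cexp ('i%C * RC t) = RC c + 'i%C * RC s.
  rewrite -Ec -Es; apply/eqP; rewrite eq_complex /cexp /=.
  have -> : 0 * t - 1 * 0 = 0 by ring.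
  have -> : 0 * 0 + 1 * t = t by ring.
  by rewrite expR0; apply/andP; split; apply/eqP; ring.
apply: hsum_ext (hsumD hc (hsumZ 'i%C hs)) => n.
have i2 k : ('i%C ^+ k.*2 : C) = (-1) ^+ k.
  by rewrite -mul2n exprM sqr_i.
rewrite exprMn -[n in LHS]odd_double_half -[n in 'i%C ^+ n]odd_double_half.
rewrite exprD i2 /cos_coeff /sin_coeff /= !odd_double_half.
have nat_RC k : RC k%:R = k%:R by rewrite rmorph_nat.
case: (boolP (odd n)) => on /=.
  rewrite !mul0r rmorph0 add0r mul1r expr1 !rmorphM /= fmorphV !rmorphXn /= rmorphN1 nat_RC.
  have -> : n.-1./2 = n./2 by rewrite -[n in n.-1]odd_double_half on /= doubleK.
  by rewrite !mulrA.
rewrite expr0 !mul0r rmorph0 mulr0 addr0 !mul1r !rmorphM /= fmorphV !rmorphXn /= rmorphN1 nat_RC.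
by [].
Qed.

Lemma exp_tail (z S : C) : hsum (fun n => z ^+ n / n`!%:R) S ->
  normc (S - 1 - z) <= normc z ^+ 2 * expR (normc z) /\
  normc (S - 1) <= normc z * expR (normc z).
Proof.
move=> h; have h1 := hsum_nat_S h; have h2 := hsum_nat_S h1.
rewrite !expr0 !expr1 !fact0 !invr1 !mulr1 in h1 h2.
have bz := abs_bounded_exp (normc z); rewrite (ger0_norm (normc_ge0 z)) in bz.
have nf n : normc (n%:R : C) = n%:R by rewrite -(rmorph_nat RC) normc_real ger0_norm.
have key k n : normc (z ^+ (n + k) / (n + k)`!%:R) <= normc z ^+ k * (normc z ^+ n / n`!%:R).
  rewrite Normc.normcM Normc.normcV normcX nf exprD -mulrA mulrCA ler_wpM2l ?exprn_ge0 ?normc_ge0 //.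
  rewrite ler_wpM2l ?exprn_ge0 ?normc_ge0 // lef_pV2 ?posrE ?ltr0n ?fact_gt0 // ler_nat.
  by apply: leq_fact; rewrite leq_addr.
split.
- apply: hsum_le h2 _; apply: (abs_bounded_le bz); first by rewrite exprn_ge0 ?normc_ge0.
  by move=> n; have := key 2%N n; rewrite addn2.
- apply: hsum_le h1 _; apply: (abs_bounded_le bz (normc_ge0 z)).
  by move=> n; have := key 1%N n; rewrite addn1 expr1.
Qed.

(** The second order remainder with which theta series are differentiated term by term. It is
    assembled from the remainders on the two axes by [cexpD]. *)
Lemma cexp_bound2 z : normc (cexp z - 1 - z) <= 4 * normc z ^+ 2 * expR (normc z *+ 2).
Proof.
case: z => a b; set z := Complex a b.
have zE : z = RC a + 'i%C * RC b by rewrite (complexE z).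
have ha : hsum (fun n => RC a ^+ n / n`!%:R) (cexp (RC a)).
  rewrite cexp_real; apply: hsum_ext (hsum_expR a) => n.
  by rewrite rmorphM /= fmorphV rmorphXn rmorph_nat.
have [a2 a1] := exp_tail ha; have [b2 _] := exp_tail (hsum_cexp_imag b).
have nb : normc ('i%C * RC b) = `|b|.
  by rewrite Normc.normcM normc_real /= expr0n add0r expr1n sqrtr1 mul1r.
rewrite normc_real in a1 a2; rewrite nb in b2.
have [la lb] := normc_ReIm_le z; rewrite /= -/z in la lb.
have nz := normc_ge0 z; set r := normc z in la lb nz *.
have E : cexp z - 1 - z = cexp (RC a) * (cexp ('i%C * RC b) - 1 - 'i%C * RC b)
   + ('i%C * RC b) * (cexp (RC a) - 1) + (cexp (RC a) - 1 - RC a).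
  by rewrite zE cexpD; ring.
have ea : expR `|a| <= expR r by rewrite ler_expR.
have eb : expR `|b| <= expR r by rewrite ler_expR.
have e1 : 1 <= expR r by rewrite -expR0 ler_expR.
have er : expR (r *+ 2) = expR r * expR r by rewrite mulr2n expRD.
have sq : forall u : R, `|u| <= r -> `|u| ^+ 2 <= r ^+ 2.
  by move=> u ur; rewrite lerXn2r ?nnegrE.
have t1 : normc (cexp (RC a) * (cexp ('i%C * RC b) - 1 - 'i%C * RC b)) <= expR r * (r ^+ 2 * expR r).
  rewrite Normc.normcM; apply: ler_pM; rewrite ?normc_ge0 //.
    rewrite normc_cexp /= ler_expR; exact: le_trans (ler_norm _) la.
  apply: (le_trans b2); apply: ler_pM; rewrite ?expR_ge0 ?sqr_ge0 ?sq //.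
have t2 : normc ('i%C * RC b * (cexp (RC a) - 1)) <= r * (r * expR r).
  rewrite Normc.normcM nb; apply: ler_pM; rewrite ?normc_ge0 //.
  by apply: (le_trans a1); apply: ler_pM; rewrite ?expR_ge0.
have t3 : normc (cexp (RC a) - 1 - RC a) <= r ^+ 2 * expR r.
  by apply: (le_trans a2); apply: ler_pM; rewrite ?expR_ge0 ?sqr_ge0 ?sq.
rewrite E er; apply: (le_trans (le_normcD _ _)).
have := le_normcD (cexp (RC a) * (cexp ('i%C * RC b) - 1 - 'i%C * RC b)) ('i%C * RC b * (cexp (RC a) - 1)).
have r2 : 0 <= r ^+ 2 by rewrite sqr_ge0.
have q1 : r ^+ 2 * expR r <= r ^+ 2 * (expR r * expR r).
  by rewrite ler_wpM2l // ler_peMl ?expR_ge0.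
have q2 : r * (r * expR r) = r ^+ 2 * expR r by rewrite expr2 mulrA.
have q3 : expR r * (r ^+ 2 * expR r) = r ^+ 2 * (expR r * expR r) by ring.
have q4 : 0 <= r ^+ 2 * (expR r * expR r) by rewrite !mulr_ge0 ?expR_ge0.
rewrite q2 in t2; rewrite q3 in t1; rewrite -[4 * _ * _]mulrA; lra.
Qed.

(** With 2 pi i absorbed, [ee] has exactly the integers as kernel ([ee_int], [ee_eq1]). *)
Definition tpi : C := Complex 0 (2 * pi).
Definition ee (z : C) : C := cexp (tpi * z).

Lemma eeD z w : ee (z + w) = ee z * ee w.
Proof. by rewrite /ee mulrDr cexpD. Qed.

Lemma ee0 : ee 0 = 1.
Proof. by rewrite /ee mulr0 cexp0. Qed.

Lemma eeN z : ee (- z) = (ee z)^-1.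
Proof. by rewrite /ee mulrN cexpN. Qed.

Lemma ee_neq0 z : ee z != 0.
Proof. exact: cexp_neq0. Qed.

Lemma normc_ee z : normc (ee z) = expR (- (2 * pi * complex.Im z)).
Proof. by rewrite normc_cexp; case: z => a b /=; rewrite mul0r sub0r. Qed.

Lemma normc_ee_real (a : R) : normc (ee (RC a)) = 1.
Proof. by rewrite normc_ee /= mulr0 oppr0 expR0. Qed.

Lemma ee_real (a : R) : ee (RC a) = Complex (cos (2 * pi * a)) (sin (2 * pi * a)).
Proof.
by rewrite /ee /cexp /= !mul0r mulr0 subr0 expR0 !mul1r add0r.
Qed.

Lemma ee_nat (n : nat) : ee n%:R = 1.
Proof.
elim: n => [|n IH]; first exact: ee0.
rewrite -addn1 natrD eeD IH mul1r -(rmorph1 RC) ee_real mulr1 mulr_natl.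
by rewrite cos2pi sin2pi.
Qed.

Lemma ee_int (n : int) : ee n%:~R = 1.
Proof.
case: n => n; first exact: ee_nat.
by rewrite NegzE rmorphN /= eeN ee_nat invr1.
Qed.

Lemma cos_eq1 (t : R) : 0 <= t < pi *+ 2 -> cos t = 1 -> t = 0.
Proof.
move=> /andP[t0 t2] ct.
have [tp|tp] := leP t pi.
  by apply: (@cos_inj R); rewrite ?in_itv /= ?t0 ?lexx ?pi_ge0 ?ct ?cos0.
have : pi *+ 2 - t = 0.
  apply: (@cos_inj R); rewrite ?in_itv /= ?lexx ?pi_ge0 //.
    by apply/andP; split; rewrite mulr2n in t2 *; lra.
  by rewrite cosB cos2pi sin2pi ct cos0 mul1r mul0r addr0.
by move=> h; exfalso; lra.
Qed.

Lemma ee_eq1 z : ee z = 1 -> exists n : int, z = n%:~R.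
Proof.
move=> h; have : normc (ee z) = 1 by rewrite h Normc.normc1.
rewrite normc_ee -expR0 => /expR_inj /eqP; rewrite oppr_eq0 mulf_eq0.
rewrite gt_eqF ?mulr_gt0 ?pi_gt0 //= => /eqP Iz.
case: z Iz h => a b /= -> h; pose n := Num.floor a; exists n.
have an : ee (RC (a - n%:~R)) = 1.
  by rewrite rmorphB eeD eeN h mul1r rmorph_int ee_int invr1.
have pi0 : 0 < pi :> R := pi_gt0 R.
have rng : 0 <= 2 * pi * (a - n%:~R) < pi *+ 2.
  have := floor_itv a; rewrite -/n => /andP[h1]; rewrite intrD => h2.
  rewrite mulr_ge0 ?subr_ge0 ?mulr_ge0 ?pi_ge0 //=.
  by rewrite -[pi *+ 2]mulr_natl -[X in _ < X]mulr1 ltr_pM2l ?mulr_gt0 // ltrBlDl.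
have := cos_eq1 rng; rewrite ee_real in an; case: an => -> _ /(_ erefl) /eqP.
rewrite mulf_eq0 gt_eqF ?mulr_gt0 //= subr_eq0 => /eqP {1}->.
by rewrite -(rmorph_int RC).
Qed.

End ComplexExp.

(** * Sums over finite products of index sets *)

Section ProductSums.
Variable R : realType.
Local Notation C := R[i].
Local Notation normc := (@Normc.normc R).
Local Notation RC := (real_complex R).

Definition ffun_uncons (J : Type) n (a : {ffun 'I_n.+1 -> J}) : J * {ffun 'I_n -> J} :=
  (a ord0, [ffun i => a (lift ord0 i)]).
Definition ffun_cons (J : Type) n (p : J * {ffun 'I_n -> J}) : {ffun 'I_n.+1 -> J} :=
  [ffun i => if unlift ord0 i is Some k then p.2 k else p.1].

Lemma ffun_unconsK J n : cancel (@ffun_uncons J n) (@ffun_cons J n).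
Proof.
move=> a; apply/ffunP => i; rewrite ffunE; case: unliftP => [k ->|->] //=.
by rewrite ffunE.
Qed.

Lemma ffun_consK J n : cancel (@ffun_cons J n) (@ffun_uncons J n).
Proof.
move=> [x a]; rewrite /ffun_uncons ffunE unlift_none; congr pair.
by apply/ffunP => i; rewrite !ffunE liftK.
Qed.

Lemma abs_bounded_ffun (J : choiceType) n (f : 'I_n -> J -> C) (B : 'I_n -> R) :
  (forall i, abs_bounded (f i) (B i)) ->
  abs_bounded (fun a : {ffun 'I_n -> J} => \prod_i f i (a i)) (\prod_i B i).
Proof.
elim: n f B => [|n IH] f B h.
  move=> A; rewrite big_ord0.
  have hA : forall a : {ffun 'I_0 -> J}, normc (\prod_i f i (a i)) = 1.
    by move=> a; rewrite big_ord0 Normc.normc1.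
  under eq_bigr do rewrite hA.
  rewrite big_tnth sumr_const card_ord.
  case: (enum_fset A) (fset_uniq A) => // x [|y s] //= /andP[].
  suff -> : x = y by rewrite inE eqxx.
  by apply/ffunP => -[].
rewrite big_ord_recl.
have := abs_bounded_mul (h ord0) (IH _ _ (fun i => h (lift ord0 i))).
move=> /(abs_bounded_comp (can_inj (@ffun_unconsK J n))) H A.
apply: le_trans (H A); rewrite le_eqVlt; apply/orP; left; apply/eqP.
apply: eq_bigr => a _; rewrite big_ord_recl /=; congr (normc (_ * _)).
by apply: eq_bigr => i _; rewrite ffunE.
Qed.

Lemma hsum_ffun (J : choiceType) n (f : 'I_n -> J -> C) (B : 'I_n -> R) (s : 'I_n -> C) :
  (forall i, abs_bounded (f i) (B i)) -> (forall i, hsum (f i) (s i)) ->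
  hsum (fun a : {ffun 'I_n -> J} => \prod_i f i (a i)) (\prod_i s i).
Proof.
elim: n f B s => [|n IH] f B s hB hs.
  have a0 : {ffun 'I_0 -> J} by apply: [ffun=> _]; case.
  move=> e e0; exists [fset a0]%fset => A hA.
  have -> : A = [fset a0]%fset.
    apply/fsetP => a; rewrite inE; have -> : a = a0 by apply/ffunP => -[].
    by rewrite eqxx; apply: (fsubsetP hA); rewrite inE.
  by rewrite big_seq_fset1 !big_ord0 subrr Normc.normc0.
rewrite big_ord_recl.
have := hsum_mul (hB ord0) (abs_bounded_ffun (fun i => hB (lift ord0 i)))
  (hs ord0) (IH _ _ _ (fun i => hB (lift ord0 i)) (fun i => hs (lift ord0 i))).
move=> /(hsum_reindex (@ffun_unconsK J n) (@ffun_consK J n)).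
apply: hsum_ext => a /=; rewrite big_ord_recl; congr (_ * _).
by apply: eq_bigr => i _; rewrite ffunE.
Qed.

Lemma abs_bounded_geom (q : R) : 0 <= q < 1 ->
  abs_bounded (fun n : nat => RC (q ^+ n)) (1 - q)^-1.
Proof.
move=> /andP[q0 q1] A; under eq_bigr do rewrite normc_real ger0_norm ?exprn_ge0 //.
pose N := (\max_(i <- A) i).+1.
apply: (@le_trans _ _ (\sum_(i <- [fset i in iota 0 N]%fset) q ^+ i)).
  apply: sum_fset_le => [i|]; first exact: exprn_ge0.
  exact: fsubset_iota.
rewrite sum_fset_iota big_mkord.
rewrite -[X in _ <= X]mul1r ler_pdivlMr ?subr_gt0 // mulrC -opprB mulNr -subrX1 opprB.
by rewrite gerBl exprn_ge0.
Qed.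

Definition l1 g (n : 'cV[int]_g) : R := \sum_i `|n i 0|%:~R.

(** The majorant against which the theta series are compared. An integer is encoded by its sign and
    absolute value, so each coordinate contributes two geometric series, and [abs_bounded_ffun]
    takes the product over the coordinates. *)
Lemma l1_bounded g : exists B, abs_bounded (fun n : 'cV[int]_g => RC (expR (- l1 n))) B.
Proof.
have q01 : 0 <= expR (- 1 : R) < 1 by rewrite expR_ge0 expR_lt1 ltrN10.
have hbool : abs_bounded (fun b : bool => RC 1) 2.
  move=> A; under eq_bigr do rewrite normc_real normr1.
  apply: (@le_trans _ _ (\sum_(i <- [fset true; false]%fset) (1 : R))).
    by apply: sum_fset_le => //; apply/fsubsetP => -[] _; rewrite !inE.
  by rewrite big_fsetU1 ?inE //= big_seq_fset1.
have := abs_bounded_mul hbool (abs_bounded_geom q01).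
pose h (m : int) := (m < 0, `|m|%N).
have hi : injective h by move=> a b []; lia.
move=> /(abs_bounded_comp hi) hZ.
have := @abs_bounded_ffun int g _ _ (fun i => hZ).
pose k (n : 'cV[int]_g) := [ffun i => n i 0].
have ki : injective k.
  by move=> a b /ffunP ab; apply/colP => i; have := ab i; rewrite !ffunE.
move=> /(abs_bounded_comp ki) H; eexists => A; apply: le_trans (H A).
apply: ler_sum => n _; rewrite le_eqVlt; apply/orP; left; apply/eqP; congr normc => /=.
rewrite /l1 -sumrN expR_sum rmorph_prod; apply: eq_bigr => i _ /=.
by rewrite ffunE mul1r -expRM_natl mulrN1; congr (RC (expR (- _))).
Qed.

End ProductSums.

(** * Reduction of positive definite real forms *)

Section Forms.
Variable R : realType.

Definition qf n (y : 'M[R]_n) (v : 'cV[R]_n) : R := (v^T *m y *m v) 0 0.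

Definition posdef n (y : 'M[R]_n) : Prop :=
  y^T = y /\ forall v, v != 0 -> 0 < qf y v.

Definition utri n (V : 'M[R]_n) : Prop :=
  (forall i j : 'I_n, (j < i)%N -> V i j = 0) /\ (forall i, V i i = 1).

Definition iv n (w : 'cV[int]_n) : 'cV[R]_n := map_mx intr w.

Lemma qf_congr n (y : 'M[R]_n) m (A : 'M[R]_(n, m)) v :
  qf (A^T *m y *m A) v = qf y (A *m v).
Proof. by rewrite /qf trmx_mul !mulmxA. Qed.

Lemma qf_scale n (y : 'M[R]_n) a v : qf y (a *: v) = a ^+ 2 * qf y v.
Proof.
by rewrite /qf -scalemxAr [(a *: v)^T]linearZ /= -!scalemxAl !mxE mulrA expr2.
Qed.

Lemma posdef_congr n (y A : 'M[R]_n) :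
  posdef y -> A \in unitmx -> posdef (A^T *m y *m A).
Proof.
move=> [ys yp] uA; split; first by rewrite !trmx_mul trmxK ys mulmxA.
move=> v v0; rewrite qf_congr; apply: yp; apply: contra v0 => /eqP Av.
by rewrite -[v](mulKmx uA) Av mulmx0.
Qed.

Lemma qf_block0 n (d : R) (y' : 'M[R]_n) (a : R) v :
  qf (block_mx d%:M 0 0 y') (col_mx a%:M v) = d * a ^+ 2 + qf y' v.
Proof.
rewrite /qf tr_col_mx mul_row_block mul_row_col !mulmx0 addr0 add0r mxE.
congr (_ + _); rewrite tr_scalar_mx -!scalar_mxM !mxE eqxx mulr1n.
by rewrite expr2 mulrCA mulrA.
Qed.

(** Completing one square; [form_int_min] and [hkz] iterate it. *)
Lemma schur n (y : 'M[R]_(1 + n)) : posdef y ->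
  exists (d : R) (u : 'rV[R]_n) (y' : 'M[R]_n), [/\ 0 < d, posdef y',
    y 0 0 = d &
    y = (block_mx 1%:M u 0 1%:M)^T *m block_mx d%:M 0 0 y' *m block_mx 1%:M u 0 1%:M].
Proof.
move=> yp; have [ys ypos] := yp; pose d := y 0 0.
have d0 : 0 < d.
  have := ypos (delta_mx 0 0); rewrite /qf trmx_delta -rowE -colE !mxE; apply.
  apply/eqP => /matrixP /(_ 0 0); rewrite !mxE /= => /eqP; rewrite oner_eq0 //.
pose u := d^-1 *: ursubmx y; pose y' := drsubmx y - d *: (u^T *m u).
exists d, u, y'.
have dn0 : d != 0 by rewrite gt_eqF.
have E : y = (block_mx 1%:M u 0 1%:M)^T *m block_mx d%:M 0 0 y' *m block_mx 1%:M u 0 1%:M.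
  rewrite tr_block_mx !trmx1 !trmx0 !mulmx_block !mul1mx !mul0mx !mulmx0 !mulmx1.
  rewrite !addr0 !add0r -[LHS]submxK; congr block_mx.
  - by apply/matrixP => i j; rewrite !ord1 !mxE !lshift0 eqxx mulr1n.
  - by rewrite mul_scalar_mx scalerA mulfV // scale1r.
  - rewrite mul_mx_scalar /u linearZ /= scalerA mulfV // scale1r.
    by rewrite trmx_ursub ys.
  - by rewrite mul_mx_scalar -scalemxAl addrC subrK.
split => //; split.
  rewrite /y' linearB /= linearZ /= trmx_mul trmxK; congr (_ - _).
  by rewrite -{2}ys trmx_drsub.
move=> v v0; have := ypos (col_mx (- (u *m v)) v).
rewrite E qf_congr mul_block_col !mul1mx mul0mx add0r addrC subrr.
rewrite (_ : 0 = 0%:M); last by apply/matrixP => i j; rewrite !mxE mul0rn.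
rewrite qf_block0 expr0n mulr0 add0r; apply.
apply: contra v0 => /eqP h; apply/eqP.
by rewrite -[v](col_mxKd (- (u *m v))) h linear0.
Qed.

Lemma utri_unit n (V : 'M[R]_n) : utri V -> \det V = 1.
Proof.
move=> [h1 h2]; rewrite -det_tr det_trig; last first.
  by apply/is_trig_mxP => i j ij; rewrite mxE h1.
by rewrite big1 // => i _; rewrite mxE h2.
Qed.

Lemma utri_block n (V : 'M[R]_n) (u : 'rV[R]_n) :
  utri V -> utri (block_mx 1%:M u 0 V : 'M[R]_(1 + n)).
Proof.
move=> [h1 h2]; split=> [i j|i].
  case: (@split_ordP 1 n i) => i' ->; case: (@split_ordP 1 n j) => j' ->.
  - by rewrite !ord1.
  - by rewrite !ord1.
  - by rewrite block_mxEdl mxE.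
  - by rewrite block_mxEdr /= !add1n ltnS => /h1.
by case: (@split_ordP 1 n i) => i' ->; rewrite ?block_mxEul ?block_mxEdr ?mxE ?h2 ?eqxx.
Qed.

(** After one Schur step either the tail of [w] is nonzero and induction applies, or the head is a
    nonzero integer, whose square is at least one. No compactness argument is involved. *)
Lemma form_int_min n (y : 'M[R]_n) : posdef y ->
  exists2 c : R, 0 < c & forall w : 'cV[int]_n, w != 0 -> c <= qf y (iv w).
Proof.
elim: n y => [|n IH] y yp.
  by exists 1 => // w; rewrite (flatmx0 w) eqxx.
have [d [u [y' [d0 yp' _ E]]]] := @schur n y yp; have [c c0 hc] := IH y' yp'.
have q0 w : 0 <= qf y' w.
  have [->|w0] := eqVneq w 0; first by rewrite /qf mulmx0 mxE.
  by apply: ltW; case: yp' => _; apply.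
exists (Num.min c d); first by rewrite lt_min c0.
suff main (w1 : 'cV[int]_(1 + n)) : w1 != 0 -> Num.min c d <= qf (y : 'M[R]_(1 + n)) (iv w1).
  exact: main.
move=> w0; rewrite E qf_congr -[w1 in iv w1]vsubmxK /iv map_col_mx.
rewrite mul_block_col !mul1mx mul0mx add0r.
set a := (X in col_mx X _); rewrite (_ : a = (a 0 0)%:M); last first.
  by apply/matrixP => i j; rewrite !ord1 [RHS]mxE eqxx mulr1n.
rewrite qf_block0; have [w'0|w'0] := eqVneq (dsubmx w1) 0; last first.
  apply: (@le_trans _ _ c); first by rewrite ge_min lexx.
  by apply: (le_trans (hc _ w'0)); rewrite lerDr mulr_ge0 ?sqr_ge0 // ltW.
apply: (@le_trans _ _ d); first by rewrite ge_min lexx orbT.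
apply: (@le_trans _ _ (d * a 0 0 ^+ 2)); last by rewrite lerDl.
rewrite ler_peMr ?(ltW d0) // /a w'0 map_mx0 mulmx0 addr0 !mxE -[1]/(1%:~R : R).
have a0 : w1 (lshift n 0) 0 != 0.
  apply: contra w0 => /eqP w00; apply/eqP; rewrite -[w1]vsubmxK w'0.
  have -> : usubmx w1 = 0 by apply/matrixP => i j; rewrite !ord1 !mxE w00.
  exact: col_mx0.
by rewrite -rmorphXn /= ler_int -gtz0_ge1 exprn_even_gt0.
Qed.

Lemma intr_unitmx (K : fieldType) n (U : 'M[int]_n) :
  U \in unitmx -> (map_mx intr U : 'M[K]_n) \in unitmx.
Proof. by rewrite !unitmxE det_map_mx; exact: rmorph_unit. Qed.

Lemma round_half (t : R) : exists k : int, `|t + k%:~R| <= 2^-1.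
Proof.
exists (- Num.floor (t + 2^-1)); have := floor_itv (t + 2^-1).
rewrite intrD => /andP[h1 h2]; rewrite rmorphN /= ler_norml; lra.
Qed.

(** Hermite-Korkine-Zolotarev reduction with slack. The last clause keeps the consequence that
    defines a Siegel set: the pivots drop by at most a factor two at each step. *)
Definition hkz_reduced n (y : 'M[R]_n) (U : 'M[int]_n) (V : 'M[R]_n) (d : 'rV[R]_n) :=
  [/\ U \in unitmx,
      (map_mx intr U)^T *m y *m map_mx intr U = V^T *m diag_mx d *m V,
      utri V /\ (forall i j : 'I_n, (i < j)%N -> `|V i j| <= 2^-1),
      forall i, 0 < d 0 i
    & forall i j : 'I_n, (i <= j)%N -> d 0 i <= 2 ^+ (j - i) * d 0 j].

(** The first basis vector nearly minimizes the form: its value is at most 11/10 of any other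
    nonzero integer value. The Schur complement is reduced by induction, and the row [u] is then
    rounded to entries of size at most one half. *)
Lemma hkz n (y : 'M[R]_n) : posdef y -> exists U V d, hkz_reduced y U V d.
Proof.
elim: n y => [|n IH] y yp.
  exists 1%:M, 1%:M, 0; split; rewrite ?unitmx1 //.
  - by apply/matrixP => -[].
  - by split=> [|[]//]; split=> -[].
  - by case.
  - by case.
suff [U [V [d H]]] : exists U V d, @hkz_reduced (1 + n) y U V d by exists U, V, d.
have [c c0 hc] := form_int_min yp.
pose E := [set x | exists2 w : 'cV[int]_(n.+1), w != 0 & x = qf y (iv w)].
have infE : has_inf E.
  split; last by exists c => _ [w w0 ->]; exact: hc.
  exists (qf y (iv (const_mx 1))), (const_mx 1) => //.
  by apply/eqP => /matrixP /(_ 0 0); rewrite !mxE.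
pose m := inf E.
have m_le w : w != 0 -> m <= qf y (iv w).
  by move=> w0; apply: ge_inf; [case: infE | exists w].
have m0 : 0 < m.
  by apply: (lt_le_trans c0); apply: lb_le_inf; [case: infE | move=> _ [w w0 ->]; exact: hc].
(* A value within [m / 10] of the infimum is enough, so no minimum has to be attained. *)
have [_ [b b0 ->] hb] := inf_adherent (divr_gt0 m0 (ltr0Sn R 9)) infE.
rewrite -/m in hb.
(* The Smith normal form of the single column [b] exhibits it as an integer multiple of the first
   column of a unimodular [L]: that column is primitive and already completed to a basis. *)
have [L uL [Q uQ [s _ bE]]] := int_Smith_normal_form b.
have {}bE : b = (s`_0 * Q 0 0) *: col 0 L.
  rewrite bE; apply/colP => i; rewrite mxE big_ord1 mxE (bigD1 0) //= big1 ?addr0.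
    by rewrite !mxE eqxx mulr1n [RHS]mulrC mulrA.
  move=> k k0; rewrite !mxE (_ : (_ == _) = false) ?mulr0n ?mulr0 //.
  by apply: contraNF k0 => /eqP k0; apply/eqP/val_inj.
pose iL : 'M[R]_(1 + n) := map_mx intr L.
have uiL : iL \in unitmx by apply: intr_unitmx.
have [d [u [y' [d0 yp' y1d E1]]]] := @schur n _ (posdef_congr yp uiL).
have [U' [V' [d' [uU' E2 [uV' V'half] d'0 d'ch]]]] := IH y' yp'.
pose t := u *m map_mx intr U'.
have [k hk] := choice (fun j => round_half (t 0 j)).
pose kr : 'rV[int]_n := \row_j k j.
pose w := t + map_mx intr kr.
have hw j : `|w 0 j| <= 2^-1 by have := hk j; rewrite [w]lock mxE -lock !mxE.
pose U2 : 'M[int]_(1 + n) := block_mx 1%:M kr 0 U'.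
exists (L *m U2), (block_mx 1%:M w 0 V'), (row_mx d%:M d').
have EU : (map_mx intr (L *m U2))^T *m y *m map_mx intr (L *m U2) =
    (block_mx 1%:M w 0 V')^T *m diag_mx (row_mx d%:M d') *m block_mx 1%:M w 0 V'.
  rewrite map_mxM trmx_mul -/iL.
  have -> : (map_mx intr U2)^T *m iL^T *m y *m (iL *m map_mx intr U2)
      = (map_mx intr U2)^T *m (iL^T *m y *m iL) *m map_mx intr U2 by rewrite !mulmxA.
  rewrite E1 map_block_mx map_mx1 map_mx0 diag_mx_row.
  have -> : diag_mx (d%:M : 'rV[R]_1) = d%:M.
    by apply/matrixP => i j; rewrite !ord1 !mxE.
  have blk (B : 'M[R]_(1 + n)) (P Q' : 'M[R]_(1 + n)) :
    Q'^T *m (P^T *m B *m P) *m Q' = (P *m Q')^T *m B *m (P *m Q').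
    by rewrite trmx_mul !mulmxA.
  have PQ : block_mx 1%:M u 0 1%:M *m block_mx 1%:M (map_mx intr kr) 0 (map_mx intr U')
      = block_mx 1%:M w 0 (map_mx intr U') :> 'M[R]_(1 + n).
    by rewrite mulmx_block !mul1mx !mul0mx !mulmx0 !addr0 !add0r addrC.
  rewrite blk PQ.
  have blk2 (Z : 'M[R]_n) (G : 'M[R]_n) : (block_mx (1%:M : 'M[R]_1) w 0 Z)^T *m block_mx d%:M 0 0 G *m block_mx 1%:M w 0 Z
     = block_mx d%:M (d *: w) (d *: w^T) (d *: (w^T *m w) + Z^T *m G *m Z).
    rewrite tr_block_mx !trmx1 !trmx0 !mulmx_block !mul1mx !mul0mx !mulmx0 !mulmx1 !addr0 !add0r.
    by rewrite mul0mx addr0 mul_scalar_mx mul_mx_scalar -scalemxAl.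
  by rewrite !blk2 E2.
have uU2 : U2 \in unitmx by rewrite unitmxE det_ublock det1 mul1r -unitmxE.
have q1 : qf y (iv (col 0 L)) = d.
  rewrite /iv map_col -/iL colE -qf_congr /qf trmx_delta -rowE -colE !mxE -y1d.
  by rewrite !mxE.
have dm : d <= m * (11 / 10).
  have : qf y (iv b) = ((s`_0 * Q 0 0)%:~R) ^+ 2 * d.
    by rewrite bE /iv map_mxZ qf_scale -/(iv _) q1.
  have sn0 : s`_0 * Q 0 0 != 0.
    by apply: contra b0 => /eqP h; rewrite bE h scale0r.
  have s1 : 1 <= ((s`_0 * Q 0 0)%:~R : R) ^+ 2.
    by rewrite -rmorphXn /= -[1]/(1%:~R : R) ler_int -gtz0_ge1 exprn_even_gt0.
  have : d <= ((s`_0 * Q 0 0)%:~R) ^+ 2 * d by rewrite ler_peMl // ltW.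
  by move=> h1 h2; rewrite -h2 in h1; lra.
(* The second basis vector has value [d w^2 + d'] with [w] at most 1/2 in absolute value, and this
   value is at least [m]. Hence [d'] is at least [(10/11 - 1/4) d], which exceeds [d / 2]. *)
have dd' (j : 'I_n) : (j = 0 :> nat) -> d <= 2 * d' 0 j.
  move=> j0; have := m_le (L *m col (rshift 1 j) U2).
  have -> : iv (L *m col (rshift 1 j) U2) = map_mx intr (L *m U2) *m delta_mx (rshift 1 j) 0.
    by rewrite /iv colE mulmxA map_mxM map_delta_mx.
  rewrite -qf_congr EU qf_congr -colE.
  have -> : col (rshift 1 j) (block_mx 1%:M w 0 V') = col_mx (w 0 j)%:M (col j V').
    apply/colP => i; case: (@split_ordP 1 n i) => i' ->; rewrite mxE.
      by rewrite block_mxEur col_mxEu ord1 [RHS]mxE eqxx mulr1n.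
    by rewrite block_mxEdr col_mxEd [RHS]mxE.
  rewrite diag_mx_row (_ : diag_mx (d%:M : 'rV[R]_1) = d%:M); last first.
    by apply/matrixP => i i'; rewrite !ord1 !mxE.
  rewrite qf_block0.
  have -> : qf (diag_mx d') (col j V') = d' 0 j.
    rewrite /qf mul_mx_diag !mxE (bigD1 j) //= big1 ?addr0 => [|i ij].
      by rewrite !mxE (uV'.2 j) mul1r mulr1.
    have ji : (j < i)%N.
      by rewrite j0 lt0n; apply: contra ij => /eqP i0; apply/eqP/val_inj; rewrite /= i0 j0.
    by rewrite !mxE (uV'.1 i j ji) mulr0.
  have -> : (L *m col (rshift 1 j) U2 != 0) = true.
    apply/eqP => h0; have : col (rshift 1 j) U2 = 0 by rewrite -[LHS](mulKmx uL) h0 mulmx0.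
    rewrite colE => h1; have : (delta_mx (rshift 1 j) 0 : 'cV[int]_(1 + n)) = 0.
      by rewrite -[LHS](mulKmx uU2) h1 mulmx0.
    by move=> /matrixP /(_ (rshift 1 j) 0); rewrite !mxE !eqxx.
  move=> /(_ isT) h; have : w 0 j ^+ 2 <= 2^-1 ^+ 2.
    by rewrite -real_normK ?num_real // lerXn2r ?nnegrE // ?invr_ge0 ?hw.
  rewrite -(ler_pM2l d0) => h2; have : d * 2^-1 ^+ 2 = d / 4 by field.
  move=> h3; lra.
split.
- by rewrite unitmx_mul uL.
- exact: EU.
- split; first exact: utri_block.
  move=> i j; case: (@split_ordP 1 n i) => i' ->; case: (@split_ordP 1 n j) => j' ->.
  + by rewrite !ord1 ltnn.
  + by rewrite block_mxEur ord1 hw.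
  + by rewrite /= ord1.
  + by rewrite block_mxEdr /= !add1n ltnS; exact: V'half.
- move=> i; case: (@split_ordP 1 n i) => i' ->; rewrite ?row_mxEl ?row_mxEr //.
  by rewrite ord1 mxE eqxx mulr1n.
- move=> i j; case: (@split_ordP 1 n i) => i' ->; case: (@split_ordP 1 n j) => j' ->.
  + by rewrite !ord1 subnn expr0 mul1r.
  + rewrite row_mxEl row_mxEr ord1 mxE eqxx mulr1n => _ /=; rewrite add1n subn0.
    have n0 : (0 < n)%N by apply: leq_ltn_trans (ltn_ord j').
    apply: (le_trans (dd' (Ordinal n0) erefl)); rewrite exprS -mulrA ler_pM2l //.
    by apply: (le_trans (d'ch (Ordinal n0) j' (leq0n _))); rewrite /= subn0.
  + by rewrite /= ord1.
  + by rewrite !row_mxEr /= !add1n ltnS subSS; exact: d'ch.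
Qed.

End Forms.

(** * The symplectic action *)

Section Symplectic.
Variables (R : realType) (g : nat).
Local Notation C := R[i].
Local Notation RC := (real_complex R).
Local Notation J := (sympJ g).

Definition cmx m n (M : 'M[rat]_(m, n)) : 'M[C]_(m, n) := map_mx ratr M.
Definition imx m n (tau : 'M[C]_(m, n)) : 'M[R]_(m, n) := map_mx (@complex.Im R) tau.
Definition rmx m n (tau : 'M[C]_(m, n)) : 'M[R]_(m, n) := map_mx (@complex.Re R) tau.
Definition cjmx m n (A : 'M[C]_(m, n)) : 'M[C]_(m, n) := map_mx (@conjc R) A.
Definition RCmx m n (A : 'M[R]_(m, n)) : 'M[C]_(m, n) := map_mx RC A.

Definition nnum (M : 'M[rat]_(g + g)) (tau : 'M[C]_g) : 'M[C]_g :=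
  ulsubmx (cmx M) *m tau + ursubmx (cmx M).
Definition jden (M : 'M[rat]_(g + g)) (tau : 'M[C]_g) : 'M[C]_g :=
  dlsubmx (cmx M) *m tau + drsubmx (cmx M).

Lemma sp_actE M tau : sp_act M tau = nnum M tau *m invmx (jden M tau).
Proof. by []. Qed.

#[local] Opaque sp_act.

Lemma cmx_col M tau : cmx M *m col_mx tau 1%:M = col_mx (nnum M tau) (jden M tau).
Proof. by rewrite -[cmx M in LHS]submxK mul_block_col !mulmx1. Qed.

Lemma siegelP (tau : 'M[C]_g) : siegel tau <-> tau^T = tau /\ posdef (imx tau).
Proof.
split=> [[ts tp]|[ts [_ tp]]]; split => //; split => //.
by rewrite /imx map_trmx ts.
Qed.

Lemma sympJJ : J *m (- J) = 1%:M.
Proof.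
rewrite mulmxN mulmx_block !mulmx0 !mul0mx !mulmx1 !mul1mx !addr0 !add0r opp_block_mx.
by rewrite !opprK oppr0 scalar_mx_block.
Qed.

Lemma Sp_tr M : Sp M -> M^T *m J *m M = J.
Proof.
move=> [_ h]; have : M *m (J *m M^T *m (- J)) = 1%:M by rewrite !mulmxA h sympJJ.
move=> /mulmx1C; rewrite mulmxN mulNmx => h2.
have : J *m (J *m M^T *m J *m M) = - J *m 1%:M.
  by rewrite mulNmx -mulmxN -h2 opprK.
rewrite mulmx1 !mulmxA; have -> : J *m J = - 1%:M by rewrite -[LHS]opprK -mulmxN sympJJ.
by rewrite !mulNmx mul1mx => /oppr_inj.
Qed.

Lemma Sp1 : Sp (1%:M : 'M[rat]_(g + g)).
Proof. by split; rewrite ?unitmx1 // trmx1 mulmx1 mul1mx. Qed.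

Lemma SpM M N : Sp M -> Sp N -> Sp (M *m N : 'M[rat]_(g + g)).
Proof.
move=> [uM hM] [uN hN]; split; first by rewrite unitmx_mul uM.
by rewrite trmx_mul -!mulmxA [N *m _]mulmxA [N *m J *m _]mulmxA hN mulmxA hM.
Qed.

Lemma SpV M : Sp M -> Sp (invmx M : 'M[rat]_(g + g)).
Proof.
move=> [uM hM]; split; first by rewrite unitmx_inv.
by rewrite -{1}hM trmx_inv !mulmxA mulVmx // mul1mx mulmxK // unitmx_tr.
Qed.

Lemma Sp_invE M : Sp M -> invmx M = - (J *m M^T *m J) :> 'M[rat]_(g + g).
Proof.
move=> [uM h]; have E : M *m (J *m M^T *m (- J)) = 1%:M by rewrite !mulmxA h sympJJ.
by rewrite -[LHS]mulmx1 -E mulKmx // mulmxN.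
Qed.

Lemma cmx_sympJ : cmx J = block_mx 0 1%:M (- 1%:M) 0.
Proof. by rewrite /cmx map_block_mx map_mxN map_mx1 map_mx0. Qed.

(** Invariance of the symplectic pairing between two blocks of [g] columns. For [(tau, 1)] against
    itself it yields the symmetry of [sp_act M tau]; against its conjugate, the Hermitian identity
    [act_herm]. *)
Lemma symp_form M (a b c d : 'M[C]_g) : Sp M ->
  forall a' b' c' d', cmx M *m col_mx a b = col_mx a' b' ->
  cmx M *m col_mx c d = col_mx c' d' ->
  a'^T *m d' - b'^T *m c' = a^T *m d - b^T *m c.
Proof.
move=> hM a' b' c' d' E1 E2.
have F (x y z w : 'M[C]_g) : (col_mx x y)^T *m cmx J *m col_mx z w = x^T *m w - y^T *m z.
  rewrite cmx_sympJ tr_col_mx mul_row_block mul_row_col !mulmx0 mulmx1 add0r addr0.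
  by rewrite mulmxN mulmx1 mulNmx addrC.
rewrite -!F -E1 -E2 trmx_mul.
have -> : (col_mx a b)^T *m (cmx M)^T *m cmx J *m (cmx M *m col_mx c d)
   = (col_mx a b)^T *m ((cmx M)^T *m cmx J *m cmx M) *m col_mx c d by rewrite !mulmxA.
by rewrite /cmx map_trmx -!map_mxM Sp_tr.
Qed.

Lemma cjmxM m n p (A : 'M[C]_(m, n)) (B : 'M[C]_(n, p)) :
  cjmx (A *m B) = cjmx A *m cjmx B.
Proof. exact: map_mxM. Qed.

Lemma cjmx_cmx m n (M : 'M[rat]_(m, n)) : cjmx (cmx M) = cmx M.
Proof. by apply/matrixP => i j; rewrite !mxE fmorph_rat. Qed.

Lemma cjmx_sub (tau : 'M[C]_g) :
  tau - cjmx tau = (2 * 'i%C) *: RCmx (imx tau).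
Proof.
by apply/matrixP => i j; rewrite !mxE subcJ mulrAC.
Qed.

Lemma hermitian_qf n (y : 'M[R]_n) (w : 'cV[C]_n) : y^T = y ->
  (cjmx w)^T *m RCmx y *m w = (RC (qf y (rmx w) + qf y (imx w)))%:M.
Proof.
move=> ys; set a := rmx w; set b := imx w.
have Ew : w = RCmx a + 'i%C *: RCmx b.
  by apply/matrixP => i j; rewrite !mxE -complexE.
have Ec : cjmx w = RCmx a - 'i%C *: RCmx b.
  apply/matrixP => i j; rewrite !mxE; case: (w i j) => u v.
  by apply/eqP; rewrite eq_complex /=; apply/andP; split; apply/eqP; ring.
have sc (u v : 'cV[R]_n) : (RCmx u)^T *m RCmx y *m RCmx v = (RC ((u^T *m y *m v) 0 0))%:M.
  rewrite /RCmx map_trmx -!map_mxM; apply/matrixP => i j.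
  by rewrite !ord1 [LHS]mxE [RHS]mxE eqxx mulr1n.
have sym : (b^T *m y *m a) 0 0 = (a^T *m y *m b) 0 0.
  rewrite -[LHS]/((b^T *m y *m a) 0 0) -[in LHS](trmxK (b^T *m y *m a)) mxE.
  by rewrite !trmx_mul trmxK ys mulmxA.
have Et : (RCmx a - 'i%C *: RCmx b)^T = (RCmx a)^T - 'i%C *: (RCmx b)^T.
  by apply/matrixP => i j; rewrite !mxE.
rewrite Ec {1}Ew Et !mulmxBl !mulmxDr -!scalemxAl -!scalemxAr !sc sym /qf.
move: ((a^T *m y *m a) 0 0) ((a^T *m y *m b) 0 0) ((b^T *m y *m b) 0 0) => p q r.
apply/matrixP => i j; rewrite !ord1 !mxE eqxx !mulr1n.
by apply/eqP; rewrite eq_complex /=; apply/andP; split; apply/eqP; ring.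
Qed.

Lemma posdef_hermitian n (y : 'M[R]_n) (w : 'cV[C]_n) : posdef y -> w != 0 ->
  0 < qf y (rmx w) + qf y (imx w).
Proof.
move=> [ys yp] w0.
have ge0 v : 0 <= qf y v.
  by have [->|/yp/ltW //] := eqVneq v 0; rewrite /qf mulmx0 mxE.
have [r0|/yp h] := eqVneq (rmx w) 0; last by rewrite ltr_pwDl.
have [i0|/yp h] := eqVneq (imx w) 0; last by rewrite ltr_wpDl.
case/eqP: w0; apply/matrixP => i j; apply/eqP; rewrite eq_complex.
by have /matrixP/(_ i j) := r0; have /matrixP/(_ i j) := i0; rewrite !mxE => -> ->; rewrite !eqxx.
Qed.

Lemma two_i_neq0 : (2 * 'i%C : C) != 0.
Proof. by rewrite mulf_neq0 ?pnatr_eq0 // eq_complex /= oner_eq0 andbF. Qed.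

Lemma act_herm M tau : Sp M -> siegel tau ->
  (cjmx (jden M tau))^T *m nnum M tau - (cjmx (nnum M tau))^T *m jden M tau
  = (2 * 'i%C) *: RCmx (imx tau).
Proof.
move=> hM /siegelP[ts _].
have Ec : cmx M *m col_mx (cjmx tau) 1%:M
    = col_mx (cjmx (nnum M tau)) (cjmx (jden M tau)).
  rewrite -(cjmx_cmx M) -[1%:M](map_mx1 (@conjc R)) /cjmx -map_col_mx -map_mxM.
  by rewrite -/(cmx M) cmx_col map_col_mx.
have := symp_form hM Ec (cmx_col M tau).
rewrite trmx1 mulmx1 mul1mx -cjmx_sub => /(congr1 -%R); rewrite !opprB => ->.
by rewrite /cjmx map_trmx ts.
Qed.

(** By [act_herm] a kernel vector would be isotropic for the Hermitian form of [imx tau], which is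
    definite. *)
Lemma jden_unit M tau : Sp M -> siegel tau -> jden M tau \in unitmx.
Proof.
move=> hM ht; have [_ yp] := (siegelP tau).1 ht; have E := act_herm hM ht.
rewrite -unitmx_tr unitmxE unitfE; apply/negP => /det0P[v v0 hv].
have jv : jden M tau *m v^T = 0 by rewrite -[LHS]trmxK trmx_mul trmxK hv trmx0.
have jvc : (cjmx v^T)^T *m (cjmx (jden M tau))^T = 0.
  by rewrite -trmx_mul -cjmxM jv /cjmx map_mx0 trmx0.
have := congr1 (fun A => (cjmx v^T)^T *m A *m v^T) E.
rewrite mulmxBr mulmxBl !mulmxA jvc !mul0mx sub0r -!mulmxA jv !mulmx0 oppr0.
rewrite -scalemxAl -scalemxAr mulmxA hermitian_qf; last by case: yp.
move=> /matrixP /(_ 0 0); rewrite !mxE eqxx mulr1n => /esym /eqP.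
rewrite mulf_eq0 (negbTE two_i_neq0) /= -(rmorph0 RC) (inj_eq (@complexI R)).
rewrite gt_eqF // posdef_hermitian //.
by apply: contra v0 => /eqP h; rewrite -[v]trmxK h trmx0.
Qed.

Lemma act_jden M tau : Sp M -> siegel tau -> sp_act M tau *m jden M tau = nnum M tau.
Proof. by move=> hM ht; rewrite sp_actE mulmxKV // jden_unit. Qed.

Lemma act_sym (M : 'M[rat]_(g + g)) (tau : 'M[C]_g) :
  Sp M -> siegel tau -> (sp_act M tau)^T = sp_act M tau.
Proof.
move=> hM ht; have uj := jden_unit hM ht; have aj := act_jden hM ht.
have [ts _] := (siegelP tau).1 ht.
move: (sp_act M tau) aj => t aj.
have := symp_form hM (cmx_col M tau) (cmx_col M tau).
rewrite trmx1 mulmx1 mul1mx ts subrr => /eqP; rewrite subr_eq0 => /eqP h.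
rewrite -aj trmx_mul -!mulmxA in h.
have {}h := congr1 (mulmx (invmx (jden M tau)^T)) h.
rewrite !mulKmx ?unitmx_tr // in h.
by have := congr1 (mulmxr (invmx (jden M tau))) h; rewrite /= !mulmxK.
Qed.

Lemma act_im M tau : Sp M -> siegel tau ->
  (cjmx (jden M tau))^T *m RCmx (imx (sp_act M tau)) *m jden M tau = RCmx (imx tau).
Proof.
move=> hM ht; apply: (scalerI two_i_neq0).
rewrite -(act_herm hM ht); have := act_jden hM ht; have := act_sym hM ht.
move: (sp_act M tau) => t ts <-; rewrite cjmxM trmx_mul.
have -> : (cjmx t)^T = cjmx t by rewrite /cjmx map_trmx ts.
move: (jden M tau) (cjmx (jden M tau))^T => j A.
transitivity (A *m (t - cjmx t) *m j); first by rewrite cjmx_sub -scalemxAr -scalemxAl.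
by rewrite mulmxBr mulmxBl mulmxA.
Qed.

Lemma act_siegel (M : 'M[rat]_(g + g)) (tau : 'M[C]_g) :
  Sp M -> siegel tau -> siegel (sp_act M tau).
Proof.
move=> hM ht; have uj := jden_unit hM ht; apply/siegelP.
have aim := act_im hM ht; have ts := act_sym hM ht.
move: (sp_act M tau) aim ts => t aim ts.
have ys : (imx t)^T = imx t by rewrite /imx map_trmx ts.
split => //; split=> // v v0; pose w := invmx (jden M tau) *m RCmx v.
have jw : jden M tau *m w = RCmx v by rewrite mulKVmx.
have [_ yp] := (siegelP tau).1 ht.
have w0 : w != 0.
  apply: contra v0 => /eqP w0; apply/eqP; move: jw; rewrite w0 mulmx0 => /matrixP h.
  by apply/matrixP => i j; have := h i j; rewrite !mxE => -[].
have := posdef_hermitian yp w0; suff -> : qf (imx tau) (rmx w) + qf (imx tau) (imx w)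
   = qf (imx t) v by [].
apply: (@complexI R).
have := hermitian_qf w yp.1; rewrite -aim.
have -> : (cjmx w)^T *m ((cjmx (jden M tau))^T *m RCmx (imx t) *m jden M tau) *m w
  = (cjmx (jden M tau *m w))^T *m RCmx (imx t) *m (jden M tau *m w).
  by rewrite cjmxM trmx_mul !mulmxA.
rewrite jw hermitian_qf // => /matrixP/(_ 0 0); rewrite !mxE eqxx !mulr1n => <-.
have -> : rmx (RCmx v) = v by apply/matrixP => i j; rewrite !mxE.
have -> : imx (RCmx v) = 0 by apply/matrixP => i j; rewrite !mxE.
by rewrite /qf mulmx0 [X in _ + X]mxE addr0.
Qed.

Lemma act_comp M N tau : Sp M -> Sp N -> siegel tau ->
  jden (M *m N) tau = jden M (sp_act N tau) *m jden N tau /\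
  sp_act (M *m N) tau = sp_act M (sp_act N tau).
Proof.
move=> hM hN ht; have uN := jden_unit hN ht.
have := cmx_col (M *m N) tau; rewrite /cmx map_mxM -/(cmx M) -/(cmx N) -mulmxA cmx_col.
have -> : col_mx (nnum N tau) (jden N tau) = col_mx (sp_act N tau) 1%:M *m jden N tau.
  by rewrite mul_col_mx mul1mx act_jden.
rewrite mulmxA cmx_col mul_col_mx => /eq_col_mx[En Ej]; split => //.
have E := act_jden (SpM hM hN) ht.
have {}E : sp_act (M *m N) tau *m jden (M *m N) tau = sp_act M (sp_act N tau) *m jden (M *m N) tau.
  by rewrite E -En -Ej mulmxA (act_jden hM (act_siegel hN ht)).
by rewrite -[LHS](mulmxK (jden_unit (SpM hM hN) ht)) E mulmxK ?jden_unit //; apply: SpM.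
Qed.

Lemma act_det M tau : Sp M -> siegel tau ->
  Normc.normc (\det (jden M tau)) ^+ 2 * \det (imx (sp_act M tau)) = \det (imx tau).
Proof.
move=> hM ht; apply: (@complexI R).
have dRC n (A : 'M[R]_n) : \det (RCmx A) = RC (\det A) by rewrite det_map_mx.
have := congr1 (@determinant _ _) (act_im hM ht).
rewrite !det_mulmx det_tr !dRC => <-; rewrite rmorphM mulrAC; congr (_ * _).
rewrite /cjmx det_map_mx; case: (\det _) => u v /=.
rewrite sqr_sqrtr ?addr_ge0 ?sqr_ge0 //.
by apply/eqP; rewrite eq_complex /=; apply/andP; split; apply/eqP; ring.
Qed.

Definition SpZ (M : 'M[rat]_(g + g)) : Prop :=
  Sp M /\ exists N : 'M[int]_(g + g), M = map_mx intr N.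

Lemma SpZ1 : SpZ 1%:M.
Proof. by split; [exact: Sp1 | exists 1%:M; rewrite map_mx1]. Qed.

Lemma SpZM M N : SpZ M -> SpZ N -> SpZ (M *m N).
Proof.
move=> [hM [M' EM]] [hN [N' EN]]; split; first exact: SpM.
by exists (M' *m N'); rewrite map_mxM -EM -EN.
Qed.

Lemma SpZV M : SpZ M -> SpZ (invmx M).
Proof.
move=> [hM [M' EM]]; split; first exact: SpV.
pose Jz : 'M[int]_(g + g) := block_mx 0 1%:M (- 1%:M) 0.
have EJ : J = map_mx intr Jz by rewrite map_block_mx map_mxN map_mx1 map_mx0.
by exists (- (Jz *m M'^T *m Jz)); rewrite Sp_invE // map_mxN !map_mxM -map_trmx -EM -EJ.
Qed.

(** Levi element of the Siegel parabolic subgroup, acting by congruence; [trn] gives the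
    translations. *)
Definition lev (A : 'M[rat]_g) : 'M[rat]_(g + g) := block_mx A^T 0 0 (invmx A).

Lemma Sp_lev A : A \in unitmx -> Sp (lev A).
Proof.
move=> uA; split.
  by rewrite unitmxE det_ublock unitrM -!unitmxE unitmx_tr unitmx_inv uA.
rewrite /lev tr_block_mx trmxK !trmx0 !mulmx_block !mulmx0 !mul0mx !mulmx1 !addr0 !add0r.
by rewrite trmx_inv mulmxV ?unitmx_tr // mulmxN mulNmx mulmx1 mulVmx // !mul0mx.
Qed.

Lemma act_lev A tau : A \in unitmx -> sp_act (lev A) tau = (cmx A)^T *m tau *m cmx A.
Proof.
move=> uA; rewrite sp_actE /nnum /jden /lev /cmx map_block_mx.
rewrite block_mxKul block_mxKur block_mxKdl block_mxKdr map_mx0 mul0mx add0r addr0.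
by rewrite map_invmx invmxK -map_trmx.
Qed.

Definition trn (B : 'M[rat]_g) : 'M[rat]_(g + g) := block_mx 1%:M B 0 1%:M.

Lemma Sp_trn B : B^T = B -> Sp (trn B).
Proof.
move=> Bs; split; first by rewrite unitmxE det_ublock !det1 mulr1 unitr1.
rewrite /trn tr_block_mx !trmx1 !trmx0 Bs !mulmx_block !mulmx0 !mul0mx !mulmx1 !mul1mx.
by rewrite !addr0 !add0r mulmxN mulmx1 !mul0mx mul1mx addNr addr0.
Qed.

Lemma act_trn B tau : sp_act (trn B) tau = tau + cmx B.
Proof.
rewrite sp_actE /nnum /jden /trn /cmx map_block_mx.
rewrite block_mxKul block_mxKur block_mxKdl block_mxKdr map_mx0 map_mx1 mul0mx add0r.
by rewrite mul1mx invmx1 mulmx1.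
Qed.

(** The inversion of the upper half plane placed in the i-th coordinate plane, and the identity in
    the others. *)
Definition inv1 (i : 'I_g) : 'M[rat]_(g + g) :=
  let E := delta_mx i i in block_mx (1%:M - E) (- E) E (1%:M - E).

Lemma SpZ_inv1 i : SpZ (inv1 i).
Proof.
have EE : delta_mx i i *m delta_mx i i = delta_mx i i :> 'M[rat]_g by rewrite mul_delta_mx.
set E := delta_mx i i in EE.
have F1 : (1%:M - E) *m (1%:M - E) = 1%:M - E.
  by rewrite mulmxBl mul1mx mulmxBr mulmx1 EE subrr subr0.
have F2 : (1%:M - E) *m E = 0 by rewrite mulmxBl mul1mx EE subrr.
have F3 : E *m (1%:M - E) = 0 by rewrite mulmxBr mulmx1 EE subrr.
have h : inv1 i *m J *m (inv1 i)^T = J.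
  have Et : E^T = E by rewrite trmx_delta.
  have Bt : (1%:M - E)^T = 1%:M - E by rewrite [LHS]linearB /= trmx1 Et.
  have Nt : (- E)^T = - E by rewrite [LHS]linearN /= Et.
  rewrite /inv1 -/E tr_block_mx Bt Nt Et.
  rewrite !mulmx_block !mulmx0 !mulmx1 !mulmxN !mulNmx !mulmx1 !opprK !addr0 !add0r.
  rewrite F1 F2 F3 EE; congr block_mx.
  - by rewrite oppr0 addr0.
  - by rewrite addrC subrK.
  - by rewrite mulNmx F1 opprB addrAC subrr sub0r.
  - by rewrite mulNmx F2 oppr0 addr0.
split; last first.
  exists (let E' := delta_mx i i in block_mx (1%:M - E') (- E') E' (1%:M - E')).
  by rewrite /= map_block_mx !map_mxB !map_mxN map_mx1 !map_delta_mx.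
split => //; have : inv1 i *m (J *m (inv1 i)^T *m (- J)) = 1%:M by rewrite !mulmxA h sympJJ.
by move=> /mulmx1_unit[].
Qed.

Lemma jden_inv1 (i : 'I_g) tau :
  (i = 0 :> nat) -> \det (jden (inv1 i) tau) = tau i i.
Proof.
move=> i0; have -> : jden (inv1 i) tau = delta_mx i i *m tau + (1%:M - delta_mx i i).
  by rewrite /jden /inv1 /cmx map_block_mx block_mxKdl block_mxKdr map_mxB map_mx1 map_delta_mx.
have E a b : (delta_mx i i *m tau + (1%:M - delta_mx i i)) a b
   = if a == i then tau i b else (a == b)%:R.
  rewrite !mxE (bigD1 i) //= big1 => [|k ki]; last by rewrite mxE [k == i](negbTE ki) andbF mul0r.
  rewrite mxE eqxx andbT addr0; case: (eqVneq a i) => [->|ai]; last by rewrite mul0r add0r subr0.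
  by rewrite mul1r eq_sym subrr addr0.
rewrite -det_tr det_trig; last first.
  apply/is_trig_mxP => a b ab; rewrite mxE E.
  case: (eqVneq b i) => [bi|_]; first by rewrite bi i0 in ab.
  by rewrite eq_sym -val_eqE /= ltn_eqF.
rewrite (bigD1 i) //= mxE E eqxx big1 ?mulr1 // => k ki.
by rewrite mxE E (negbTE ki) eqxx.
Qed.

End Symplectic.

(** * Siegel reduction under the integral symplectic group *)

Section SiegelReduction.
Variables (R : realType) (g : nat).
Local Notation C := R[i].
Local Notation RC := (real_complex R).

Lemma posdef_unit n (y : 'M[R]_n) : posdef y -> y \in unitmx.
Proof.
move=> [ys yp]; rewrite unitmxE unitfE; apply/negP => /det0P[v v0 hv].
have := yp v^T; rewrite /qf trmxK hv mul0mx mxE ltxx => h.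
suff: v^T != 0 by move/h.
by apply: contra v0 => /eqP e; rewrite -[v]trmxK e trmx0.
Qed.

Lemma posdef_inv n (y : 'M[R]_n) : posdef y -> posdef (invmx y).
Proof.
move=> yp; have uy := posdef_unit yp.
have -> : invmx y = (invmx y)^T *m y *m invmx y.
  by rewrite -mulmxA mulmxV // mulmx1 trmx_inv yp.1.
by apply: posdef_congr; rewrite ?unitmx_inv.
Qed.

Lemma unitz_sqr (z : int) : z \is a GRing.unit -> z ^+ 2 = 1.
Proof. by rewrite qualifE /= => /orP[] /eqP ->. Qed.

Lemma hkz_det n (y : 'M[R]_n) U V d : hkz_reduced y U V d -> \det y = \prod_i d 0 i.
Proof.
move=> [uU E [uV _] _ _]; have := congr1 (@determinant _ _) E.
rewrite !det_mulmx !det_tr det_diag (utri_unit uV) mul1r mulr1 => <-.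
by rewrite det_map_mx mulrC mulrA -expr2 -rmorphXn /= unitz_sqr ?mul1r.
Qed.

Lemma utri_corner n (V : 'M[R]_n) (d : 'rV[R]_n) (i : 'I_n) : utri V -> (i = 0 :> nat) ->
  (V^T *m diag_mx d *m V) i i = d 0 i.
Proof.
move=> [h1 h2] i0; rewrite mul_mx_diag mxE (bigD1 i) //= big1 ?addr0 => [|k ki].
  by rewrite !mxE h2 mul1r mulr1.
have ik : (i < k)%N.
  by rewrite i0 lt0n; apply: contra ki => /eqP k0; apply/eqP/val_inj; rewrite /= k0 i0.
by rewrite (h1 _ _ ik) mulr0.
Qed.

(** In a reduced basis the first pivot is a value of the form at a nonzero integer vector, so it is
    at least [c]; the chain condition bounds the other pivots below by [c / 2 ^+ n]. *)
Lemma form_det_lower n (y : 'M[R]_n) (c : R) : posdef y -> 0 < c ->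
  (forall w : 'cV[int]_n, w != 0 -> c <= qf y (iv R w)) ->
  (c / 2 ^+ n) ^+ n <= \det y.
Proof.
move=> yp c0 hc; have [U [V [d H]]] := hkz yp; rewrite (hkz_det H).
have [uU E [uV _] d0 dch] := H.
have -> : (c / 2 ^+ n) ^+ n = \prod_(i < n) (c / 2 ^+ n).
  by rewrite prodr_const card_ord.
apply: ler_prod => i _; rewrite divr_ge0 ?exprn_ge0 ?(ltW c0) //=.
have n0 : (0 < n)%N by apply: leq_ltn_trans (ltn_ord i).
pose i0 := Ordinal n0.
have c_d0 : c <= d 0 i0.
  rewrite -(@utri_corner _ V d i0) // -E.
  have := hc (col i0 U); have -> : iv R (col i0 U) = map_mx intr U *m delta_mx i0 0.
    by rewrite /iv colE map_mxM map_delta_mx.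
  rewrite -qf_congr /qf trmx_delta -rowE -colE; set Z := _ *m _.
  rewrite [col _ _ 0 0]mxE [row _ _ 0 _]mxE; apply.
  apply/eqP => h; have := mulKmx uU (delta_mx i0 0 : 'cV_n).
  rewrite -colE h mulmx0 => /matrixP/(_ i0 0); rewrite !mxE !eqxx //.
rewrite ler_pdivrMr ?exprn_gt0 //; apply: (le_trans c_d0).
apply: (le_trans (dch i0 i (leq0n _))); rewrite mulrC ler_pM2l // subn0.
by apply: ler_weXn2l; rewrite ?ler1n // ltnW.
Qed.

(** The inverse of the transformed imaginary part is the inverse of [Im tau] conjugated by
    [jden M tau]. Its value at an integer vector splits as the value of [y] at [a] plus that of
    [invmx y] at [Re tau a + b], where the integer vectors [a] and [b], read off the lower blocks of
    [N], do not both vanish. This bounds the inverse form from below on integer vectors, and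
    [form_det_lower] converts the bound into one for the determinant. *)
Lemma siegel_det_bounded (tau : 'M[C]_g) : siegel tau ->
  exists B : R, forall M, SpZ M -> \det (imx (sp_act M tau)) <= B.
Proof.
move=> ht; have [ts yp] := (siegelP tau).1 ht; set y := imx tau in yp.
have uy := posdef_unit yp; have yip := posdef_inv yp.
have [c1 c10 hc1] := form_int_min yp; have [c2 c20 hc2] := form_int_min yip.
pose c := Num.min c1 c2; have c0 : 0 < c by rewrite lt_min c10.
have B0 : 0 < (c / 2 ^+ g) ^+ g by rewrite exprn_gt0 // divr_gt0 ?exprn_gt0.
exists ((c / 2 ^+ g) ^+ g)^-1 => M [hM [N EM]].
have aim := act_im hM ht; have [_ Yp] := (siegelP _).1 (act_siegel hM ht).
have uj := jden_unit hM ht; move: (imx (sp_act M tau)) aim Yp => Y aim Yp.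
have uY := posdef_unit Yp; set j := jden M tau in aim uj.
have dY : 0 < \det Y.
  have [U [V [d H]]] := hkz Yp; rewrite (hkz_det H); apply: prodr_gt0 => i _.
  by have [_ _ _ d0 _] := H.
have -> : \det Y = (\det (invmx Y))^-1 by rewrite det_inv invrK.
rewrite lef_pV2 ?posrE // ?det_inv ?invr_gt0 // -det_inv.
apply: form_det_lower => // [|u u0]; first exact: posdef_inv.
have ucj : (cjmx j)^T \in unitmx by rewrite unitmx_tr /cjmx map_unitmx.
have Yi : RCmx (invmx Y) = j *m RCmx (invmx y) *m (cjmx j)^T.
  have h : RCmx Y *m (j *m RCmx (invmx y) *m (cjmx j)^T) = 1%:M.
    have e : (cjmx j)^T *m (RCmx Y *m (j *m RCmx (invmx y) *m (cjmx j)^T)) = (cjmx j)^T.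
      transitivity ((cjmx j)^T *m RCmx Y *m j *m RCmx (invmx y) *m (cjmx j)^T).
        by rewrite !mulmxA.
      by rewrite aim /RCmx -map_mxM mulmxV // map_mx1 mul1mx.
    by rewrite -[LHS](mulKmx ucj) e mulVmx.
  by rewrite -[LHS]mulmx1 -h mulmxA /RCmx -map_mxM mulVmx // map_mx1 mul1mx.
pose a := (dlsubmx N)^T *m u; pose b := (drsubmx N)^T *m u.
have inC m n (A : 'M[int]_(m, n)) : cmx R (map_mx intr A) = RCmx (map_mx intr A).
  by apply/matrixP => p q; rewrite !mxE ratr_int rmorph_int.
pose w := (cjmx j)^T *m RCmx (iv R u).
have wE : w = (cjmx tau) *m RCmx (iv R a) + RCmx (iv R b).
  rewrite /w /j /jden EM inC; set G := dlsubmx _; set H := drsubmx _.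
  have -> : G = RCmx (map_mx intr (dlsubmx N)) by rewrite /G /RCmx map_dlsubmx map_dlsubmx.
  have -> : H = RCmx (map_mx intr (drsubmx N)) by rewrite /H /RCmx map_drsubmx map_drsubmx.
  have cR m n (A : 'M[R]_(m, n)) : cjmx (RCmx A) = RCmx A.
    by apply/matrixP => p q; rewrite !mxE conjc_real.
  have cD (A B : 'M[C]_g) : cjmx (A + B) = cjmx A + cjmx B by rewrite /cjmx map_mxD.
  rewrite cD cjmxM !cR linearD /= trmx_mul mulmxDl.
  have -> : (cjmx tau)^T = cjmx tau by rewrite /cjmx map_trmx ts.
  by rewrite /iv /a /b !map_mxM /RCmx !map_mxM !map_trmx mulmxA.
have qE : qf (invmx Y) (iv R u) = qf (invmx y) (rmx w) + qf (invmx y) (imx w).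
  apply: (@complexI R); have := hermitian_qf w yip.1.
  have cw : (cjmx w)^T = (RCmx (iv R u))^T *m j.
    rewrite /w cjmxM trmx_mul; congr (_^T *m _).
      by apply/matrixP => p q; rewrite !mxE conjc_real.
    by apply/matrixP => p q; rewrite !mxE conjcK.
  rewrite cw {1}/w !mulmxA -(mulmxA _ j) -(mulmxA _ _ ((cjmx j)^T)) -Yi.
  rewrite /RCmx map_trmx -!map_mxM => /matrixP/(_ 0 0).
  by rewrite [LHS]mxE [X in _ = X -> _]mxE eqxx mulr1n.
have rw : rmx w = rmx tau *m iv R a + iv R b.
  rewrite wE; apply/matrixP => p q; rewrite !mxE raddfD /= raddf_sum /=; congr (_ + _).
  apply: eq_bigr => k _; rewrite !mxE; case: (tau p k) => s t /=.
  by rewrite mulr0 subr0.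
have iw : imx w = - (y *m iv R a).
  rewrite wE; apply/matrixP => p q; rewrite !mxE raddfD /= raddf_sum /= addr0 -sumrN.
  apply: eq_bigr => k _; rewrite !mxE; case: (tau p k) => s t /=.
  by rewrite mulr0 add0r mulNr.
have qN n (z : 'M[R]_n) v : qf z (- v) = qf z v.
  by rewrite -scaleN1r qf_scale sqrrN expr1n mul1r.
have q0 n (z : 'M[R]_n) v : posdef z -> 0 <= qf z v.
  move=> [_ zp]; have [->|/zp/ltW //] := eqVneq v 0; by rewrite /qf mulmx0 mxE.
have qia : qf (invmx y) (imx w) = qf y (iv R a).
  by rewrite iw qN -qf_congr yp.1 mulmxV // mul1mx.
rewrite qE qia; have [a0|a0] := eqVneq a 0; last first.
  apply: (@le_trans _ _ c1); first by rewrite ge_min lexx.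
  by apply: (le_trans (hc1 _ a0)); rewrite lerDr q0.
have b0 : b != 0.
  apply/eqP => b0; have : N^T *m col_mx 0 u = 0.
    rewrite -[N]submxK tr_block_mx mul_block_col !mulmx0 !add0r -/a -/b a0 b0.
    exact: col_mx0.
  move=> h; have : M^T *m map_mx intr (col_mx 0 u) = 0.
    by rewrite EM map_trmx -map_mxM h map_mx0.
  move=> h2; have := mulKmx (_ : M^T \in unitmx) (map_mx intr (col_mx (0 : 'cV[int]_g) u)).
  rewrite unitmx_tr => /(_ hM.1); rewrite h2 mulmx0 map_col_mx => /esym/eqP.
  rewrite -col_mx0 => /eqP/eq_col_mx[_] /matrixP hu; case/eqP: u0; apply/matrixP => p q.
  by have := hu p q; rewrite !mxE => /eqP; rewrite intr_eq0 => /eqP.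
rewrite rw a0 /iv map_mx0 mulmx0 add0r.
apply: (@le_trans _ _ c2); first by rewrite ge_min lexx orbT.
by apply: (le_trans (hc2 _ b0)); rewrite lerDl q0.
Qed.

Definition siegel_reduced (tau : 'M[C]_g) (V : 'M[R]_g) (d : 'rV[R]_g) : Prop :=
  [/\ tau^T = tau, forall i j, `|complex.Re (tau i j)| <= 2^-1,
      imx tau = V^T *m diag_mx d *m V,
      utri V /\ (forall i j : 'I_g, (i < j)%N -> `|V i j| <= 2^-1)
    & (forall i : 'I_g, (2 ^+ g.+1)^-1 <= d 0 i) /\
      forall i j : 'I_g, (i <= j)%N -> d 0 i <= 2 ^+ (j - i) * d 0 j].

Lemma siegel_det_gt0 (t : 'M[C]_g) : siegel t -> 0 < \det (imx t).
Proof.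
move=> /siegelP[_ tp]; have [U [V [d H]]] := hkz tp; rewrite (hkz_det H).
by apply: prodr_gt0 => i _; have [_ _ _ d0 _] := H.
Qed.

(** Near maximality replaces a point of maximal height in the orbit, whose existence would ask for a
    finiteness argument. *)
Lemma siegel_near_max (tau : 'M[C]_g) : siegel tau ->
  exists2 M1, SpZ M1 & forall M, SpZ M ->
    9 / 10 * \det (imx (sp_act M (sp_act M1 tau))) <= \det (imx (sp_act M1 tau)).
Proof.
move=> ht; have [B hB] := siegel_det_bounded ht.
pose E := [set x | exists2 M, SpZ M & x = \det (imx (sp_act M tau))].
have supE : has_sup E.
  split; last by exists B => _ [M hM ->]; exact: hB.
  by exists (\det (imx (sp_act 1%:M tau))), 1%:M => //; exact: SpZ1.
have le_m M : SpZ M -> \det (imx (sp_act M tau)) <= sup E.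
  by move=> hM; apply: ub_le_sup; [case: supE | exists M].
have m0 : 0 < sup E.
  apply: lt_le_trans (le_m _ (SpZ1 g)); apply: siegel_det_gt0; apply: act_siegel => //.
  exact: Sp1.
have [_ [M1 hM1 ->] hm] := sup_adherent (divr_gt0 m0 (ltr0Sn R 9)) supE.
exists M1 => // M hM; have := le_m _ (SpZM hM hM1).
rewrite (act_comp hM.1 hM1.1 ht).2.
by move: (sup E) (\det _) (\det _) hm => a b c; clear; lra.
Qed.

Lemma imx_RCmul (P Q : 'M[R]_g) (t : 'M[C]_g) : imx (RCmx P *m t *m RCmx Q) = P *m imx t *m Q.
Proof.
apply/matrixP => i j; rewrite !mxE raddf_sum /=; apply: eq_bigr => k _.
rewrite !mxE; have -> (z : C) (r : R) : complex.Im (z * RC r) = complex.Im z * r.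
  by case: z => p q /=; rewrite mulr0 add0r.
rewrite raddf_sum /=; congr (_ * _); apply: eq_bigr => l _; rewrite !mxE.
by case: (t l k) => p q /=; rewrite mul0r addr0.
Qed.

Lemma siegel_lev_red (t1 : 'M[C]_g) : siegel t1 -> exists M V d,
  [/\ SpZ M, imx (sp_act M t1) = V^T *m diag_mx d *m V,
      \det (imx (sp_act M t1)) = \det (imx t1) &
      [/\ utri V, forall i j : 'I_g, (i < j)%N -> `|V i j| <= 2^-1, forall i, 0 < d 0 i
       & forall i j : 'I_g, (i <= j)%N -> d 0 i <= 2 ^+ (j - i) * d 0 j]].
Proof.
move=> st1; have [_ y1p] := (siegelP _).1 st1.
have [U [V [d H]]] := hkz y1p; have [uU EU [uV Vhalf] d0 dch] := H.
pose A : 'M[rat]_g := map_mx intr U.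
have uA : A \in unitmx by apply: intr_unitmx.
have cA : cmx R A = RCmx (map_mx intr U).
  by apply/matrixP => i j; rewrite !mxE ratr_int rmorph_int.
have y2 : imx (sp_act (lev A) t1) = V^T *m diag_mx d *m V.
  by rewrite act_lev // cA {1}/RCmx map_trmx imx_RCmul.
exists (lev A), V, d; split => //; last first.
  rewrite y2 -EU !det_mulmx det_tr mulrAC -expr2 det_map_mx -rmorphXn /=.
  by rewrite unitz_sqr ?mul1r // -unitmxE.
split; first exact: Sp_lev.
exists (block_mx U^T 0 0 (invmx U)); rewrite /lev map_block_mx !map_mx0 -map_trmx.
congr block_mx; rewrite -[LHS]mulmx1 -(map_mx1 (intr : int -> rat)) -(mulmxV uU) map_mxM.
by rewrite mulKmx.
Qed.

Lemma siegel_trn_red (t2 : 'M[C]_g) : siegel t2 -> exists M,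
  [/\ SpZ M, imx (sp_act M t2) = imx t2
    & forall i j, `|complex.Re (sp_act M t2 i j)| <= 2^-1].
Proof.
move=> st2; have [t2s _] := (siegelP _).1 st2.
have [k hk] := choice (fun p : 'I_g * 'I_g => round_half (complex.Re (t2 p.1 p.2))).
have tsym i j : t2 i j = t2 j i by rewrite -{1}t2s mxE.
pose Bz : 'M[int]_g := \matrix_(i, j) (if (i <= j)%N then k (i, j) else k (j, i)).
have Bzs : Bz^T = Bz.
  apply/matrixP => i j; rewrite !mxE; case: ltngtP => // ij.
  by have -> : i = j by apply: val_inj.
exists (trn (map_mx intr Bz)).
have t3E i j : sp_act (trn (map_mx intr Bz)) t2 i j = t2 i j + RC (Bz i j)%:~R.
  by rewrite act_trn 3!mxE ratr_int rmorph_int.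
split.
- split; first by apply: Sp_trn; rewrite map_trmx Bzs.
  by exists (block_mx 1%:M Bz 0 1%:M); rewrite map_block_mx map_mx1 map_mx0.
- by apply/matrixP => i j; rewrite [LHS]mxE t3E raddfD /= addr0 [RHS]mxE.
move=> i j; rewrite t3E raddfD /= mxE.
have [ij|ij] := boolP (i <= j)%N; first exact: (hk (i, j)).
by rewrite tsym; exact: (hk (j, i)).
Qed.

(** Near maximality is used against a single element, the inversion in the first coordinate. It
    bounds the first pivot below, and the chain condition carries the bound to the others. *)
Lemma siegel_reduction (tau : 'M[C]_g) : siegel tau ->
  exists M V d, SpZ M /\ siegel_reduced (sp_act M tau) V d.
Proof.
move=> ht; have [M1 hM1 near] := siegel_near_max ht.
have st1 := act_siegel hM1.1 ht.
have [M2 [V [d [hM2 y2 det2 [uV Vhalf d0 dch]]]]] := siegel_lev_red st1.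
have st2 := act_siegel hM2.1 st1.
have [M3 [hM3 y3 x3]] := siegel_trn_red st2; have st3 := act_siegel hM3.1 st2.
exists (M3 *m (M2 *m M1)), V, d; split; first exact: SpZM hM3 (SpZM hM2 hM1).
have -> : sp_act (M3 *m (M2 *m M1)) tau = sp_act M3 (sp_act M2 (sp_act M1 tau)).
  by rewrite (act_comp hM3.1 (SpM hM2.1 hM1.1) ht).2 (act_comp hM2.1 hM1.1 ht).2.
have near3 M : SpZ M ->
  9 / 10 * \det (imx (sp_act M (sp_act M3 (sp_act M2 (sp_act M1 tau))))) <= \det (imx (sp_act M1 tau)).
  move=> hM; have := near _ (SpZM (SpZM hM hM3) hM2).
  by rewrite (act_comp (SpM hM.1 hM3.1) hM2.1 st1).2 (act_comp hM.1 hM3.1 st2).2.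
rewrite -det2 -y3 in near3; rewrite -y3 in y2.
move: (sp_act M3 (sp_act M2 (sp_act M1 tau))) st3 near3 y2 x3 => t3 st3 near3 y3' x3.
clear y3 det2 st2 hM3 M3.
split => //; first exact: ((siegelP _).1 st3).1.
split => // i; have g0 : (0 < g)%N by apply: leq_ltn_trans (ltn_ord i).
pose i0 := Ordinal g0.
suff d0h : 2^-1 <= d 0 i0.
  have := dch i0 i (leq0n _); rewrite subn0 => h.
  have h2 : 2 ^+ i * d 0 i <= 2 ^+ g * d 0 i.
    by rewrite ler_pM2r //; apply: ler_weXn2l; rewrite ?ler1n // ltnW.
  rewrite exprS invfM ler_pdivrMr ?exprn_gt0 // [X in _ <= X]mulrC.
  exact: le_trans d0h (le_trans h h2).
have h1 := near3 _ (SpZ_inv1 i0).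
have := act_det (SpZ_inv1 i0).1 st3; rewrite jden_inv1 // => h2.
have Dp : 0 < \det (imx (sp_act (inv1 i0) t3)).
  by apply/siegel_det_gt0/act_siegel => //; exact: (SpZ_inv1 i0).1.
(* By [act_det] the two determinants differ by the factor [|tau_00|^2]. As the real part is at most
   1/2, the squared imaginary part is at least 9/10 - 1/4. *)
have n9 : 9 / 10 <= Normc.normc (t3 i0 i0) ^+ 2 by rewrite -(ler_pM2r Dp) h2.
have y00 : complex.Im (t3 i0 i0) = d 0 i0.
  by have /matrixP/(_ i0 i0) := y3'; rewrite utri_corner // mxE.
have x00 := x3 i0 i0.
move: n9 y00 x00; case: (t3 i0 i0) => p q /= n9 qd hp; rewrite qd in n9; move: n9.
rewrite sqr_sqrtr ?addr_ge0 ?sqr_ge0 //.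
have p2 : p ^+ 2 <= 4^-1.
  have -> : (4^-1 : R) = 2^-1 ^+ 2 by field.
  by rewrite -[p ^+ 2]real_normK ?num_real // lerXn2r ?nnegrE // invr_ge0.
move=> n9; have q2 : 2^-1 ^+ 2 <= d 0 i0 ^+ 2.
  have -> : 2^-1 ^+ 2 = 4^-1 :> R by field.
  by move: (d 0 i0 ^+ 2) (p ^+ 2) n9 p2 => a b; clear; lra.
by rewrite -(@ler_sqr R) ?nnegrE ?invr_ge0 // ltW.
Qed.

End SiegelReduction.

(** * Rational translates of tame points *)

Section RationalReduction.
Variables (R : realType) (g : nat).
Local Notation C := R[i].
Local Notation RC := (real_complex R).

(** One denominator [K] for all entries, so that bounded numerators leave finitely many matrices. *)
Definition ratmx (K : nat) n (m : 'M[int]_n) : 'M[rat]_n :=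
  \matrix_(i, j) ((m i j)%:~R / K%:R).

Lemma ratr_frac (F : numFieldType) (z : int) (K : nat) :
  ratr (z%:~R / K%:R) = z%:~R / K%:R :> F.
Proof. by rewrite rmorphM fmorphV rmorph_int rmorph_nat. Qed.

Lemma act1 (tau : 'M[C]_g) : sp_act 1%:M tau = tau.
Proof.
rewrite sp_actE /nnum /jden /cmx map_mx1 scalar_mx_block block_mxKul block_mxKur.
by rewrite block_mxKdl block_mxKdr mul1mx mul0mx addr0 add0r invmx1 mulmx1.
Qed.

Lemma utri_split n (V : 'M[R]_(1 + n)) : utri V ->
  V = block_mx 1%:M (ursubmx V) 0 (drsubmx V) /\ utri (drsubmx V).
Proof.
move=> [h1 h2]; split.
  rewrite -[LHS]submxK; congr block_mx; apply/matrixP => i j; rewrite !mxE.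
    by rewrite !ord1 h2.
  by apply: h1; rewrite ord1.
split=> [i j ij|i]; rewrite !mxE ?h2 //.
by apply: h1; rewrite /= !add1n ltnS.
Qed.

(** [ratmx K m] approximates the inverse of [V]. When a top row is added, the top row of the product
    is corrected by entries in (1/K) Z, and taking floors leaves an error of at most 1/K. The bound
    on [m] depends on [n] and [K], not on [V]. *)
Lemma rat_approx n (K : nat) : (0 < K)%N -> exists B : nat, forall V : 'M[R]_n,
  utri V -> (forall i j : 'I_n, (i < j)%N -> `|V i j| <= 2^-1) ->
  exists m : 'M[int]_n, [/\ forall i j, (`|m i j| <= B)%N,
    utri (map_mx ratr (ratmx K m) : 'M[R]_n),
    utri (V *m map_mx ratr (ratmx K m))
    & forall i j : 'I_n, (i < j)%N -> `|(V *m map_mx ratr (ratmx K m)) i j| <= K%:R^-1].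
Proof.
move=> K0; have K0r : 0 < K%:R :> R by rewrite ltr0n.
have ratE k (m : 'M[int]_k) : map_mx ratr (ratmx K m) = \matrix_(i, j) ((m i j)%:~R / K%:R) :> 'M[R]_k.
  by apply/matrixP => i j; rewrite 3!mxE ratr_frac.
elim: n => [|n [B IH]].
  exists 0%N => V _ _; exists 0; split; try by case.
  - by split; case.
  - by split; case.
exists (n * B + K + B + 1)%N.
suff main (V : 'M[R]_(1 + n)) : utri V -> (forall i j : 'I_(1 + n), (i < j)%N -> `|V i j| <= 2^-1) ->
  exists m : 'M[int]_(1 + n), [/\ forall i j, (`|m i j| <= n * B + K + B + 1)%N,
    utri (map_mx ratr (ratmx K m) : 'M[R]_(1 + n)),
    utri (V *m map_mx ratr (ratmx K m))
    & forall i j : 'I_(1 + n), (i < j)%N -> `|(V *m map_mx ratr (ratmx K m)) i j| <= K%:R^-1] by exact: main.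
move=> uV Vh; have [EV uV'] := utri_split uV.
set w := ursubmx V in EV; set V' := drsubmx V in EV uV'.
have V'h (i j : 'I_n) : (i < j)%N -> `|V' i j| <= 2^-1.
  by move=> ij; rewrite !mxE; apply: Vh; rewrite /= !add1n ltnS.
have wh j : `|w 0 j| <= 1.
  rewrite !mxE; apply: (@le_trans _ _ 2^-1); last by rewrite invf_le1 ?ler1n.
  exact: Vh.
have [m' [m'B um' uW' W'h]] := IH V' uV' V'h.
set T' := map_mx ratr (ratmx K m') in um' uW' W'h.
pose s := w *m T'.
pose t : 'rV[int]_n := \row_j (- Num.floor (K%:R * s 0 j)).
have tb j : `|(t 0 j)%:~R / K%:R + s 0 j| <= K%:R^-1.
  have -> : (t 0 j)%:~R / K%:R + s 0 j = (K%:R * s 0 j - (Num.floor (K%:R * s 0 j))%:~R) / K%:R.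
    by rewrite mxE rmorphN /=; field; rewrite gt_eqF.
  rewrite normrM [X in _ * X]ger0_norm ?invr_ge0 ?ler0n // ler_piMl ?invr_ge0 ?ler0n //.
  have := floor_itv (K%:R * s 0 j); rewrite intrD => /andP[h1 h2]; rewrite ler_norml; lra.
have sb j : `|K%:R * s 0 j| <= (n * B)%:R.
  rewrite mxE mulr_sumr; apply: (le_trans (ler_norm_sum _ _ _)).
  have -> : (n * B)%:R = \sum_(k < n) B%:R :> R.
    by rewrite sumr_const card_ord mulnC natrM mulr_natr.
  apply: ler_sum => k _.
  rewrite mulrCA normrM -[X in _ <= X]mul1r ler_pM //.
  rewrite /T' ratE mxE mulrC divfK ?gt_eqF // -intr_norm -[B%:R]/((Posz B)%:~R) ler_int.
  by have := m'B k j; rewrite -lez_nat abszE.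
pose m : 'M[int]_(1 + n) := block_mx (Posz K)%:M t 0 m'.
have Em : map_mx ratr (ratmx K m) = block_mx 1%:M (\row_j ((t 0 j)%:~R / K%:R)) 0 T' :> 'M[R]_(1 + n).
  rewrite ratE; apply/matrixP => i j; rewrite mxE.
  case: (split_ordP i) => i' ->; case: (split_ordP j) => j' ->.
  - by rewrite !block_mxEul !ord1 !mxE eqxx !mulr1n -[(Posz K)%:~R]/(K%:R) mulfV ?gt_eqF.
  - by rewrite !block_mxEur [RHS]mxE ord1.
  - by rewrite !block_mxEdl !mxE mul0r.
  - by rewrite !block_mxEdr /T' ratE !mxE.
have EW : V *m map_mx ratr (ratmx K m) =
    block_mx 1%:M (\row_j ((t 0 j)%:~R / K%:R) + s) 0 (V' *m T').
  by rewrite Em EV mulmx_block !mul1mx !mul0mx !mulmx0 !addr0 !add0r.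
exists m; rewrite EW Em; split.
- move=> i j; case: (split_ordP i) => i' ->; case: (split_ordP j) => j' ->.
  + rewrite block_mxEul !ord1 mxE eqxx mulr1n /=; lia.
  + rewrite block_mxEur ord1; have := tb j'; have := sb j'.
    rewrite !ler_norml => /andP[h1 h2] /andP[h3 h4].
    have h5 : `|(t 0 j')%:~R| <= (n * B + 1)%:R :> R.
      have e : (t 0 j')%:~R = K%:R * ((t 0 j')%:~R / K%:R + s 0 j') - K%:R * s 0 j' :> R.
        by field; rewrite gt_eqF.
      have k1 : K%:R * K%:R^-1 = 1 :> R by rewrite mulfV ?gt_eqF.
      have h3' : -1 <= K%:R * ((t 0 j')%:~R / K%:R + s 0 j').
        by move: h3; rewrite -(ler_pM2l K0r) mulrN k1.
      have h4' : K%:R * ((t 0 j')%:~R / K%:R + s 0 j') <= 1.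
        by move: h4; rewrite -(ler_pM2l K0r) k1.
      rewrite e natrD ler_norml; lra.
    move: h5; rewrite -intr_norm -[(_ + _)%:R]/((Posz _)%:~R) ler_int; lia.
  + by rewrite block_mxEdl mxE.
  + by rewrite block_mxEdr; have := m'B i' j'; lia.
- exact: utri_block.
- exact: utri_block.
- move=> i j; case: (split_ordP i) => i' ->; case: (split_ordP j) => j' ->.
  + by rewrite !ord1 ltnn.
  + by rewrite block_mxEur ord1 !mxE => _; have := tb j'; rewrite !mxE.
  + by rewrite /= ord1.
  + by rewrite block_mxEdr /= !add1n ltnS; exact: W'h.
Qed.

(* The part of the Siegel space where the theta series are tame: bounded real
   part, and imaginary part large and close to diagonal. *)
Definition tame (X c eps : R) : set 'M[C]_g :=
  [set tau | [/\ tau^T = tau, forall i j, `|complex.Re (tau i j)| <= X,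
     forall i, c <= complex.Im (tau i i)
   & forall i j, i != j -> `|complex.Im (tau i j)| <= eps * complex.Im (tau i i)]].

(** With [W = V T] unitriangular and within 1/K of the identity, an off-diagonal entry of
    [W^T diag(d) W] has at most [g] terms, each at most [2^g d_i / K] by the chain condition. The
    dilation by [P] multiplies the imaginary part by [P^2] and lifts the diagonal above [c]. *)
Lemma tame_reduction (c eps : R) : 0 < c -> 0 < eps ->
  exists (X : R) (L : seq 'M[rat]_(g + g)), (forall r, r \in L -> Sp r) /\
  forall tau : 'M[C]_g, siegel tau -> exists M r tau0,
    [/\ SpZ M, r \in L, tame X c eps tau0, siegel tau0 & sp_act M tau = sp_act r tau0].
Proof.
move=> c0 e0.
have [K0 hK] : exists K : nat, g%:R * 2 ^+ g / eps <= K%:R.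
  by exists (Num.trunc (g%:R * 2 ^+ g / eps)).+1; rewrite ltW // truncnS_gt.
pose K := K0.+1; have K0' : (0 < K)%N by [].
have Kr : 0 < K%:R :> R by rewrite ltr0n.
have {}hK : g%:R * 2 ^+ g / K%:R <= eps.
  rewrite ler_pdivrMr // -ler_pdivrMl // mulrC; apply: (le_trans hK).
  by rewrite ler_nat.
have [P0 hP] : exists P : nat, c * 2 ^+ g.+1 <= P%:R.
  by exists (Num.trunc (c * 2 ^+ g.+1)).+1; rewrite ltW // truncnS_gt.
pose P := P0.+1; have Pr : 0 < P%:R :> R by rewrite ltr0n.
have {}hP : c * 2 ^+ g.+1 <= P%:R ^+ 2 :> R.
  apply: (le_trans hP); apply: (@le_trans _ _ P%:R); first by rewrite ler_nat.
  by rewrite expr2 ler_peMr ?ler0n // ler1n.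
have [B hB] := @rat_approx g K K0'.
(* Numerators between [-B] and [B] are coded by ordinals below [2 B + 1], so that [L] is the image
   of a finite type. *)
pose dec (k : 'M['I_(B + B).+1]_g) : 'M[int]_g := \matrix_(i, j) (Posz (k i j) - Posz B).
pose lv k := lev ((P%:R : rat) *: ratmx K (dec k)).
pose L := [seq invmx (lv k) | k <- enum {: 'M['I_(B + B).+1]_g} & (ratmx K (dec k) \in unitmx)].
have uP (A : 'M[rat]_g) : A \in unitmx -> (P%:R *: A) \in unitmx.
  by move=> uA; rewrite unitmxZ // unitfE pnatr_eq0.
exists (P%:R ^+ 2 * (g%:R * (g%:R * (B%:R / K%:R * B%:R / K%:R)))), L; split.
  move=> r /mapP[k]; rewrite mem_filter => /andP[uk _] ->.
  by apply: SpV; apply: Sp_lev; apply: uP.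
move=> tau ht; have [M [V [d [hM hred]]]] := siegel_reduction ht.
have st1 := act_siegel hM.1 ht.
have [t1 Et1] : exists t, t = sp_act M tau by exists (sp_act M tau).
rewrite -Et1 in hred st1; case: hred => [t1s x1 y1 [uV Vh] [d0 dch]].
have [m [mB uT uW Wh]] := hB V uV Vh.
pose k : 'M['I_(B + B).+1]_g := \matrix_(i, j) inord (absz (m i j + Posz B)).
have dk : dec k = m.
  apply/matrixP => i j; rewrite !mxE inordK; have := mB i j; lia.
have uTr : ratmx K m \in unitmx.
  rewrite unitmxE unitfE; apply/eqP => h; have := utri_unit uT.
  rewrite det_map_mx h rmorph0 => /eqP; by rewrite eq_sym oner_eq0.
have hl : Sp (lv k) by apply: Sp_lev; apply: uP; rewrite dk.
set T := map_mx ratr (ratmx K m) in uT uW Wh.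
have cT : cmx R (P%:R *: ratmx K m) = RCmx (P%:R *: T).
  apply/matrixP => i j; rewrite 2!mxE [RHS]mxE [X in RC X]mxE [T i j]mxE mxE.
  have -> : P%:R * ((m i j)%:~R / K%:R) = (Posz P * m i j)%:~R / K%:R :> rat.
    by rewrite intrM mulrA.
  by rewrite !ratr_frac intrM mulrA rmorphM fmorphV rmorphM !rmorph_nat rmorph_int.
exists M, (invmx (lv k)), (sp_act (lv k) t1); split => //.
- by apply/mapP; exists k => //; rewrite mem_filter mem_enum dk uTr.
- have sc (a : R) : \sum_(l < g) a = g%:R * a by rewrite sumr_const card_ord mulr_natl.
  have E : sp_act (lv k) t1 = (RCmx (P%:R *: T))^T *m t1 *m RCmx (P%:R *: T).
    by rewrite /lv dk act_lev ?uP // cT.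
  have dp i : 0 < d 0 i by apply: lt_le_trans (d0 i); rewrite invr_gt0 exprn_gt0.
  have yE i j : complex.Im (sp_act (lv k) t1 i j)
      = P%:R ^+ 2 * \sum_k (V *m T) k i * d 0 k * (V *m T) k j.
    have -> : complex.Im (sp_act (lv k) t1 i j) = imx (sp_act (lv k) t1) i j by rewrite [RHS]mxE.
    rewrite E {1}/RCmx map_trmx imx_RCmul y1.
    have -> : (P%:R *: T)^T *m (V^T *m diag_mx d *m V) *m (P%:R *: T)
      = P%:R ^+ 2 *: ((V *m T)^T *m diag_mx d *m (V *m T)).
      rewrite [(_ *: _)^T]linearZ /= -scalemxAr -!scalemxAl scalerA -expr2 trmx_mul.
      by rewrite !mulmxA.
    rewrite [LHS]mxE mul_mx_diag [X in _ * X]mxE; congr (_ * _).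
    by apply: eq_bigr => l _; rewrite !mxE.
  have W1 i j : `|(V *m T) i j| <= 1.
    have [ij|ij|ij] := ltngtP i j.
    + by apply: (le_trans (Wh _ _ ij)); rewrite invf_le1 ?ler1n.
    + by rewrite uW.1 // normr0.
    + by rewrite (val_inj ij) uW.2 normr1.
  have yii i : P%:R ^+ 2 * d 0 i <= complex.Im (sp_act (lv k) t1 i i).
    rewrite yE ler_pM2l ?exprn_gt0 // (bigD1 i) //= uW.2 mul1r mulr1 lerDl.
    apply: sumr_ge0 => l _; rewrite mulrAC -expr2 mulr_ge0 ?sqr_ge0 // ltW //.
  split.
  + exact: ((siegelP _).1 (act_siegel hl st1)).1.
  + have Tb i j : `|T i j| <= B%:R / K%:R.
      rewrite /T 2!mxE ratr_frac normrM [X in _ * X]ger0_norm ?invr_ge0 ?ler0n //.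
      rewrite ler_pM2r ?invr_gt0 // -intr_norm -[B%:R]/((Posz B)%:~R) ler_int.
      by have := mB i j; lia.
    move=> i j; rewrite E.
    have -> : complex.Re (((RCmx (P%:R *: T))^T *m t1 *m RCmx (P%:R *: T)) i j)
       = P%:R ^+ 2 * \sum_b \sum_a (T a i * complex.Re (t1 a b) * T b j).
      rewrite mxE raddf_sum /= mulr_sumr; apply: eq_bigr => b _.
      rewrite mxE mulr_suml raddf_sum /= mulr_sumr; apply: eq_bigr => a _.
      rewrite !mxE; case: (t1 a b) => p q /=; ring.
    rewrite normrM ger0_norm ?exprn_ge0 ?ler0n // ler_pM2l ?exprn_gt0 //.
    apply: (le_trans (ler_norm_sum _ _ _)).
    rewrite -sc; apply: ler_sum => b _.
    apply: (le_trans (ler_norm_sum _ _ _)).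
    rewrite -sc; apply: ler_sum => a _.
    rewrite !normrM -[X in _ <= X]mulrA ler_pM ?mulr_ge0 //.
    rewrite -[X in _ <= X]mulr1 ler_pM //; apply: (le_trans (x1 a b)).
    by rewrite invf_le1 ?ler1n.
  + move=> i; apply: le_trans (yii i); apply: (@le_trans _ _ (P%:R ^+ 2 * (2 ^+ g.+1)^-1)).
      by rewrite ler_pdivlMr ?exprn_gt0.
    by rewrite ler_pM2l ?exprn_gt0.
  + move=> i j ij; apply: (@le_trans _ _ (eps * (P%:R ^+ 2 * d 0 i))); last by rewrite ler_pM2l.
    rewrite yE normrM ger0_norm ?exprn_ge0 ?ler0n // mulrCA ler_pM2l ?exprn_gt0 //.
    apply: (le_trans (ler_norm_sum _ _ _)).
    apply: (@le_trans _ _ (g%:R * 2 ^+ g / K%:R * d 0 i)); last by rewrite ler_pM2r.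
    have -> : g%:R * 2 ^+ g / K%:R * d 0 i = \sum_(l < g) (K%:R^-1 * (2 ^+ g * d 0 i)).
      by rewrite sc; ring.
    apply: ler_sum => l _; rewrite normrM normrM (@gtr0_norm _ (d 0 l)) //.
    have dl : (l <= i)%N -> d 0 l <= 2 ^+ g * d 0 i.
      move=> li; apply: (le_trans (dch _ _ li)); rewrite ler_pM2r //.
      by apply: ler_weXn2l; rewrite ?ler1n // (leq_trans (leq_subr _ _)) // ltnW.
    have [li|li|li] := ltngtP l i.
    * rewrite mulrAC ler_pM ?mulr_ge0 ?(ltW (dp l)) //; last by rewrite dl // ltnW.
      rewrite -[X in _ <= X]mulr1 ler_pM // ?Wh // W1.
    * by rewrite uW.1 // normr0 !mul0r !mulr_ge0 ?invr_ge0 ?ler0n ?exprn_ge0 // ltW.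
    * rewrite (val_inj li) uW.2 normr1 mul1r mulrC.
      have [jl|jl|jl] := ltngtP i j.
      - rewrite ler_pM ?Wh // ?dl //; first by rewrite ltW.
        by have := dl; rewrite (val_inj li) => ->.
      - by rewrite uW.1 // normr0 mul0r !mulr_ge0 ?invr_ge0 ?ler0n ?exprn_ge0 // ltW.
      - by rewrite (val_inj jl) eqxx in ij.
- exact: act_siegel.
rewrite -(act_comp (SpV hl) hl st1).2 mulVmx; last by case: hl.
by rewrite act1.
Qed.

Lemma Zp_int_eq0 (m : nat) (z : int) : (1 < m)%N -> (z%:~R = 0 :> 'Z_m) -> (m%:Z %| z)%Z.
Proof.
move=> m1; have nat0 n : n%:R = 0 :> 'Z_m -> (m %| n)%N.
  by rewrite Zp_nat => /(congr1 val) /=; rewrite Zp_cast // => /eqP.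
case: z => n; first by move=> /nat0; rewrite dvdzE.
rewrite NegzE rmorphN /= => /eqP; rewrite oppr_eq0 => /eqP /nat0.
by rewrite dvdzE abszN.
Qed.

(** Conjugation by [P] keeps [1 + m Q] integral because [m] clears the denominators of the inverse
    of [P]: [m] times that inverse is the integer matrix [Pe]. *)
Lemma congr1_GD (D : 'M[int]_g) (m : nat) (Q : 'M[int]_(g + g)) :
  polarization_type D -> (forall i, (D i i %| m%:Z)%Z) ->
  Sp (map_mx intr (1%:M + m%:Z *: Q) : 'M[rat]_(g + g)) ->
  GD D (map_mx intr (1%:M + m%:Z *: Q)).
Proof.
move=> [/is_diag_mxP Dd D0 _] hm hS; split => //=.
set P := block_mx _ _ _ _.
pose E : 'M[int]_g := diag_mx (\row_i (m%:Z %/ D i i)%Z).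
have ED : E *m D = (m%:Z)%:M.
  apply/matrixP => i j; rewrite mul_diag_mx !mxE; have [<-|ij] := eqVneq i j.
    by rewrite divzK.
  by rewrite (Dd _ _ ij) mulr0.
pose Pz : 'M[int]_(g + g) := block_mx 1%:M 0 0 D.
have PE : P = map_mx intr Pz by rewrite /P /Pz map_block_mx map_mx1 !map_mx0.
have uP : P \in unitmx.
  rewrite unitmxE unitfE /P det_ublock det1 mul1r det_map_mx intr_eq0.
  have -> : D = diag_mx (\row_i D i i).
    apply/matrixP => i j; rewrite !mxE; have [<-|ij] := eqVneq i j; first by rewrite mulr1n.
    by rewrite Dd ?mulr0n.
  rewrite det_diag; apply/prodf_neq0 => i _; rewrite mxE gt_eqF //.
pose Pe : 'M[int]_(g + g) := block_mx (m%:Z)%:M 0 0 E.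
have PeP : Pe *m Pz = (m%:Z)%:M.
  by rewrite mulmx_block !mulmx0 !mul0mx !addr0 !add0r mulmx1 ED -scalar_mx_block.
have -> : invmx P *m map_mx intr (1%:M + m%:Z *: Q) *m P = map_mx intr (1%:M + Pe *m Q *m Pz).
  have PeE : map_mx intr Pe = (m%:R : rat) *: invmx P.
    have : map_mx intr Pe *m P = (m%:R)%:M by rewrite PE -map_mxM PeP map_scalar_mx.
    move=> h; rewrite -[LHS](mulmxK uP) h mul_scalar_mx //.
  rewrite !map_mxD map_mx1 !map_mxM map_mxZ -PE PeE mulmxDr mulmx1 mulmxDl mulVmx //.
  by rewrite -!scalemxAr -!scalemxAl.
by apply/mxOverP => i j; rewrite mxE intr_int.
Qed.

(** [SpZ] is traded for [GD] modulo [m]. For each residue class an integral symplectic [N] inverse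
    to it is fixed, if there is one; then [N M1] is congruent to one and lies in [GD], and the
    finitely many [N] are absorbed into the list of translates. *)
Theorem GD_reduction (D : 'M[int]_g) (c eps : R) : polarization_type D -> 0 < c -> 0 < eps ->
  exists (X : R) (L : seq 'M[rat]_(g + g)), (forall r, r \in L -> Sp r) /\
  forall tau : 'M[C]_g, siegel tau -> exists M r tau0,
    [/\ GD D M, r \in L, tame X c eps tau0, siegel tau0 & sp_act M tau = sp_act r tau0].
Proof.
move=> hD c0 e0; have [X [L [hL hred]]] := tame_reduction c0 e0; exists X.
(* The factor 2 makes [m] greater than one, so that ['Z_m] is the ring of integers modulo [m]. *)
pose m := (2 * \prod_i `|D i i|)%N.
have D0 : (0 < \prod_i `|D i i|)%N.
  by apply: prodn_gt0 => i; rewrite absz_gt0 gt_eqF //; case: hD => _ /(_ i).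
have m1 : (1 < m)%N by rewrite /m; lia.
have dm i : (D i i %| m%:Z)%Z.
  by rewrite dvdzE /= /m (bigD1 i) //= mulnCA dvdn_mulr.
pose zm (N : 'M[int]_(g + g)) : 'M['Z_m]_(g + g) := map_mx intr N.
pose ok (rho : 'M['Z_m]_(g + g)) (N : 'M[int]_(g + g)) :=
  Sp (map_mx intr N : 'M[rat]_(g + g)) /\ zm N *m rho = 1%:M.
have hch rho : exists N, Sp (map_mx intr N : 'M[rat]_(g + g)) /\
    ((exists N', ok rho N') -> ok rho N).
  have [[N hN]|no] := pselect (exists N', ok rho N'); first by exists N; split; [case: hN | move=> _].
  by exists 1%:M; split; [rewrite map_mx1; exact: Sp1 | move=> /no].
have [s hs] := choice hch.
exists [seq map_mx intr (s rho) *m r | rho <- enum {: 'M['Z_m]_(g + g)}, r <- L]; split.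
  move=> r /allpairsP[[rho r'] /= [_ r'L ->]]; apply: SpM (hL _ r'L).
  exact: (hs rho).1.
move=> tau ht; have [M1 [r [t0 [hM1 rL tt0 st0 E]]]] := hred tau ht.
have [M1s [N1 EN1]] := hM1; have [M1v [N2 EN2]] := SpZV hM1.
have uM1 : M1 \in unitmx by case: M1s.
have N21 : N2 *m N1 = 1%:M.
  apply/matrixP => i j; apply: (@intr_inj rat).
  have : map_mx intr (N2 *m N1) = 1%:M :> 'M[rat]_(g + g) by rewrite map_mxM -EN1 -EN2 mulVmx.
  by move=> /matrixP/(_ i j); rewrite !mxE => ->; rewrite rmorph_nat.
have [_ hs2] := hs (zm N1).
have [s1 s2] : ok (zm N1) (s (zm N1)).
  apply: hs2; exists N2; split; first by rewrite -EN2.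
  by rewrite /zm -map_mxM N21 map_mx1.
set N := s (zm N1) in s1 s2.
have [Q EQ] : exists Q : 'M[int]_(g + g), N *m N1 = 1%:M + m%:Z *: Q.
  exists (\matrix_(i, j) ((N *m N1 - 1%:M) i j %/ m%:Z)%Z).
  apply/matrixP => i j; rewrite [RHS]mxE [X in _ + X]mxE [X in _ * X]mxE mulrC divzK.
    have -> : (N *m N1 - 1%:M) i j = (N *m N1) i j - (1%:M : 'M[int]_(g + g)) i j.
      by rewrite [LHS]mxE [X in _ + X]mxE.
    by rewrite addrC subrK.
  apply: (@Zp_int_eq0 m) => //; move: s2; rewrite /zm -map_mxM => /matrixP/(_ i j).
  have -> : (N *m N1 - 1%:M) i j = (N *m N1) i j - (1%:M : 'M[int]_(g + g)) i j.
    by rewrite [LHS]mxE [X in _ + X]mxE.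
  by rewrite [LHS]mxE rmorphB /= => ->; rewrite !mxE rmorph_nat subrr.
have EM : map_mx intr N *m M1 = map_mx intr (1%:M + m%:Z *: Q) by rewrite EN1 -map_mxM EQ.
exists (map_mx intr N *m M1), (map_mx intr N *m r), t0; split.
- by rewrite EM; apply: congr1_GD hD dm _; rewrite -EM; exact: SpM.
- by apply/allpairsP; exists (zm N1, r); split; rewrite ?mem_enum.
- exact: tt0.
- exact: st0.
- by rewrite (act_comp s1 M1s ht).2 E -(act_comp s1 (hL _ rL) st0).2.
Qed.

End RationalReduction.

(** * Theta series *)

Section Theta.
Variables (R : realType) (g : nat).
Local Notation C := R[i].
Local Notation normc := (@Normc.normc R).
Local Notation RC := (real_complex R).

(** The default is 0 for a family without a sum; otherwise [hsum_uniq] makes the value canonical. *)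
Definition tsum (I : choiceType) (f : I -> C) : C := xget 0 [set s | hsum f s].

Lemma tsumP (I : choiceType) (f : I -> C) B : abs_bounded f B -> hsum f (tsum f).
Proof. by move=> /hsum_exists[s hs]; rewrite /tsum; case: xgetP => [t _ //|/(_ s)]. Qed.

Lemma tsumE (I : choiceType) (f : I -> C) s : hsum f s -> tsum f = s.
Proof.
move=> hs; rewrite /tsum; case: xgetP => [t _ ht|/(_ s) //].
exact: hsum_uniq ht hs.
Qed.

Definition bl (tau : 'M[C]_g) (u v : 'cV[C]_g) : C := (u^T *m tau *m v) 0 0.
Definition dot (u v : 'cV[C]_g) : C := (u^T *m v) 0 0.
Definition nz (n : 'cV[int]_g) : 'cV[C]_g := map_mx intr n.
Definition rz (x : 'cV[R]_g) : 'cV[C]_g := map_mx RC x.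

Lemma blDl t u v w : bl t (u + v) w = bl t u w + bl t v w.
Proof. by rewrite /bl linearD /= !mulmxDl mxE. Qed.
Lemma blDr t u v w : bl t u (v + w) = bl t u v + bl t u w.
Proof. by rewrite /bl mulmxDr mxE. Qed.
Lemma blZl t c u v : bl t (c *: u) v = c * bl t u v.
Proof. by rewrite /bl [(_ *: _)^T]linearZ /= -!scalemxAl mxE. Qed.
Lemma blZr t c u v : bl t u (c *: v) = c * bl t u v.
Proof. by rewrite /bl -scalemxAr mxE. Qed.
Lemma blNl t u v : bl t (- u) v = - bl t u v.
Proof. by rewrite -scaleN1r blZl mulN1r. Qed.
Lemma blNr t u v : bl t u (- v) = - bl t u v.
Proof. by rewrite -scaleN1r blZr mulN1r. Qed.
Lemma bl_sym (t : 'M[C]_g) u v : t^T = t -> bl t u v = bl t v u.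
Proof.
move=> ts; rewrite /bl -[in LHS](trmxK (u^T *m t *m v)) mxE.
by rewrite !trmx_mul trmxK ts mulmxA.
Qed.
Lemma dotDl u v w : dot (u + v) w = dot u w + dot v w.
Proof. by rewrite /dot linearD /= mulmxDl mxE. Qed.
Lemma dotDr u v w : dot u (v + w) = dot u v + dot u w.
Proof. by rewrite /dot mulmxDr mxE. Qed.
Lemma dotZl c u v : dot (c *: u) v = c * dot u v.
Proof. by rewrite /dot [(_ *: _)^T]linearZ /= -scalemxAl mxE. Qed.
Lemma dotZr c u v : dot u (c *: v) = c * dot u v.
Proof. by rewrite /dot -scalemxAr mxE. Qed.
Lemma dotNl u v : dot (- u) v = - dot u v.
Proof. by rewrite -scaleN1r dotZl mulN1r. Qed.
Lemma dotNr u v : dot u (- v) = - dot u v.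
Proof. by rewrite -scaleN1r dotZr mulN1r. Qed.
Lemma dot_mul t u v : dot u (t *m v) = bl t u v.
Proof. by rewrite /dot /bl mulmxA. Qed.
Lemma dotE u v : dot u v = \sum_i u i 0 * v i 0.
Proof. by rewrite /dot mxE; apply: eq_bigr => i _; rewrite mxE. Qed.
Lemma nzD m n : nz (m + n) = nz m + nz n.
Proof. exact: map_mxD. Qed.
Lemma nzN n : nz (- n) = - nz n.
Proof. exact: map_mxN. Qed.
Lemma nz0 : nz 0 = 0.
Proof. exact: map_mx0. Qed.
Lemma nzE n : nz n = rz (iv R n).
Proof. by apply/matrixP => i j; rewrite !mxE rmorph_int. Qed.
Lemma rzD m n : rz (m + n) = rz m + rz n.
Proof. exact: map_mxD. Qed.
Lemma rz0 : rz 0 = 0.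
Proof. exact: map_mx0. Qed.

Lemma dot_nz m n : dot (nz m) (nz n) = ((m^T *m n) 0 0)%:~R.
Proof. by rewrite /dot /nz map_trmx -map_mxM mxE. Qed.

Lemma dot_rz u v : dot (rz u) (rz v) = RC ((u^T *m v) 0 0).
Proof. by rewrite /dot /rz map_trmx -map_mxM mxE. Qed.

Lemma Im_bl_rz t u v : complex.Im (bl t (rz u) (rz v)) = (u^T *m imx t *m v) 0 0.
Proof.
rewrite /bl mxE [RHS]mxE raddf_sum /=; apply: eq_bigr => j _.
rewrite [rz v j 0]mxE; have -> (z : C) (r : R) : complex.Im (z * RC r) = complex.Im z * r.
  by case: z => p q /=; rewrite mulr0 add0r.
congr (_ * _); rewrite mxE [RHS]mxE raddf_sum /=.
by apply: eq_bigr => k _; rewrite !mxE; case: (t k j) => p q /=; rewrite mul0r addr0.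
Qed.

Lemma Im_dot_rz u (z : 'cV[C]_g) : complex.Im (dot (rz u) z) = (u^T *m imx z) 0 0.
Proof.
rewrite /dot mxE [RHS]mxE raddf_sum /=; apply: eq_bigr => j _.
by rewrite !mxE; case: (z j 0) => p q /=; rewrite mul0r addr0.
Qed.

Definition sumsq (v : 'cV[R]_g) : R := \sum_i v i 0 ^+ 2.

(** What convergence asks of [tau]; for symmetric [tau] it implies membership in the Siegel space
    ([growth_siegel]). *)
Definition growth (tau : 'M[C]_g) : Prop :=
  exists2 k : R, 0 < k & forall v, k * sumsq v <= qf (imx tau) v.

(* The general term of the theta series of order [m] with characteristics [a], [mu]. *)
Definition tterm (m : R) (tau : 'M[C]_g) (a mu : 'cV[R]_g) (z : 'cV[C]_g)
    (n : 'cV[int]_g) : C :=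
  ee (RC (m / 2) * bl tau (nz n + rz a) (nz n + rz a) + RC m * dot (nz n + rz a) z
      - dot (nz n) (rz mu)).

Definition Theta m tau a mu z : C := tsum (tterm m tau a mu z).

Lemma normc_tterm m tau a mu z n :
  normc (tterm m tau a mu z n) =
  expR (- (pi * m * qf (imx tau) (iv R n + a)) - 2 * pi * m * ((iv R n + a)^T *m imx z) 0 0).
Proof.
rewrite /tterm normc_ee nzE -rzD; congr expR.
have ImR (r : R) (w : C) : complex.Im (RC r * w) = r * complex.Im w.
  by case: w => p q /=; rewrite mul0r addr0.
have ImD (u w : C) : complex.Im (u + w) = complex.Im u + complex.Im w.
  by case: u; case: w.
have ImN (w : C) : complex.Im (- w) = - complex.Im w by case: w.
rewrite !ImD ImN !ImR Im_bl_rz Im_dot_rz dot_rz /= subr0 -/(qf _ _).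
by field.
Qed.

Lemma quad_bound (c b t : R) : 0 < c -> - (c * t ^+ 2) + b * t <= b ^+ 2 / c.
Proof.
move=> c0; rewrite ler_pdivlMr //.
have -> : (- (c * t ^+ 2) + b * t) * c = b ^+ 2 - (c * t - b / 2) ^+ 2 - 3 / 4 * b ^+ 2 by field.
have := sqr_ge0 (c * t - b / 2); have := sqr_ge0 b; lra.
Qed.

(** Coordinate by coordinate, Gaussian decay absorbs any exponential linear in [n] and still leaves
    the majorant [expR (- l1 n)]. *)
Lemma gauss_bound (c b : R) (a : 'cV[R]_g) : 0 < c -> 0 <= b ->
  exists2 K, 0 <= K & forall n : 'cV[int]_g,
    expR (- (c * sumsq (iv R n + a)) + b * l1 R n) <= K * expR (- l1 R n).
Proof.
move=> c0 b0; pose K := \sum_i ((b + 1) ^+ 2 / c + (b + 1) * `|a i 0|).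
exists (expR K); first exact: expR_ge0.
move=> n; rewrite -expRD ler_expR /K /l1 /sumsq !mulr_sumr -!sumrN -!big_split /=.
apply: ler_sum => i _; rewrite !mxE.
set t : R := (n i 0)%:~R + a i 0.
have nt : (`|n i 0|%:~R : R) <= `|t| + `|a i 0|.
  have -> : (`|n i 0|%:~R : R) = `|t - a i 0| by rewrite /t addrK intr_norm.
  exact: ler_normB.
have b1 : 0 <= b + 1 by rewrite addr_ge0.
have h := ler_wpM2l b1 nt.
have := quad_bound (b + 1) `|t| c0; rewrite real_normK ?num_real //.
move: (`|n i 0|%:~R : R) h => N h; nra.
Qed.

Lemma l1_ge0 (n : 'cV[int]_g) : 0 <= l1 R n.
Proof. by apply: sumr_ge0 => i _; rewrite ler0z. Qed.

Lemma l1_coord (n : 'cV[int]_g) i : `|(n i 0)%:~R : R| <= l1 R n.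
Proof.
rewrite /l1 (bigD1 i) //= -intr_norm lerDl; apply: sumr_ge0 => j _; by rewrite ler0z.
Qed.

(* The extra factor [expR (b * l1 n)] leaves room for derivatives. *)
Lemma tterm_bound m tau a mu z (b : R) : 0 < m -> growth tau -> 0 <= b ->
  exists2 K, 0 <= K & forall n,
    normc (tterm m tau a mu z n) * expR (b * l1 R n) <= K * expR (- l1 R n).
Proof.
move=> m0 [k k0 hk] b0.
pose Y := \sum_i `|complex.Im (z i 0)|.
have pi0 : 0 < pi :> R := pi_gt0 R.
have Y0 : 0 <= Y by apply: sumr_ge0.
pose e := 2 * pi * m.
have e0 : 0 < e by rewrite !mulr_gt0.
have cpos : 0 < pi * m * k by rewrite !mulr_gt0.
have bpos : 0 <= e * Y + b by rewrite addr_ge0 // mulr_ge0 // ltW.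
have [K K0 hK] := gauss_bound a cpos bpos.
pose E := expR (e * \sum_i `|a i 0| * Y).
exists (E * K); first by rewrite mulr_ge0 ?expR_ge0.
move=> n; apply: (@le_trans _ _ (E * expR (- (pi * m * k * sumsq (iv R n + a)) + (e * Y + b) * l1 R n))).
  rewrite normc_tterm -!expRD ler_expR -/e.
  have q := hk (iv R n + a).
  have q' : pi * m * k * sumsq (iv R n + a) <= pi * m * qf (imx tau) (iv R n + a).
    by rewrite -mulrA ler_pM2l // mulr_gt0.
  have lin : - ((iv R n + a)^T *m imx z) 0 0 <= \sum_i `|a i 0| * Y + Y * l1 R n.
    apply: (le_trans (ler_norm _)); rewrite normrN mxE.
    apply: (le_trans (ler_norm_sum _ _ _)).
    rewrite /l1 mulr_sumr -big_split /=; apply: ler_sum => i _.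
    rewrite !mxE normrM; have yi : `|complex.Im (z i 0)| <= Y.
      by rewrite /Y (bigD1 i) //= lerDl sumr_ge0.
    apply: (@le_trans _ _ (`|(n i 0)%:~R + a i 0| * Y)); first by rewrite ler_wpM2l.
    rewrite [Y * _]mulrC -mulrDl ler_wpM2r // addrC.
    by rewrite intr_norm; exact: ler_normD.
  have := ler_wpM2l (ltW e0) lin; rewrite mulrDr.
  move: (qf _ _) (sumsq _) (l1 R n) (_ 0 0) q' => Q S L D q' h; nra.
by rewrite -[E * K * _]mulrA ler_wpM2l ?expR_ge0.
Qed.

Lemma Theta_bounded m tau a mu z : 0 < m -> growth tau ->
  exists B, abs_bounded (tterm m tau a mu z) B.
Proof.
move=> m0 gt; have [K K0 hK] := tterm_bound a mu z m0 gt (lexx 0).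
have [B hB] := l1_bounded R g; exists (K * B).
by apply: (abs_bounded_le hB K0) => n; have := hK n; rewrite mul0r expR0 mulr1.
Qed.

Lemma Theta_hsum m tau a mu z : 0 < m -> growth tau ->
  hsum (tterm m tau a mu z) (Theta m tau a mu z).
Proof. by move=> m0 gt; have [B hB] := Theta_bounded a mu z m0 gt; exact: tsumP hB. Qed.

Lemma Theta_shift_tau m tau a mu z (p : 'cV[int]_g) : 0 < m -> growth tau -> tau^T = tau ->
  Theta m tau a mu (z + tau *m nz p) =
  ee (- (RC (m / 2) * bl tau (nz p) (nz p)) - RC m * dot (nz p) z + dot (nz p) (rz mu))
  * Theta m tau a mu z.
Proof.
move=> m0 gt ts; apply: tsumE.
have h := Theta_hsum a mu z m0 gt.
have := hsum_reindex (addrK p) (subrK p) h.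
move=> /(hsumZ (ee (- (RC (m / 2) * bl tau (nz p) (nz p)) - RC m * dot (nz p) z + dot (nz p) (rz mu)))).
apply: hsum_ext => n /=; rewrite /tterm -eeD; congr ee.
rewrite nzD !dotDr !dotDl !blDl !blDr dot_mul dot_mul.
rewrite (bl_sym (nz p) (nz n) ts) (bl_sym (nz p) (rz a) ts) (bl_sym (rz a) (nz n) ts).
have -> : RC m = 2 * RC (m / 2) by rewrite -(rmorph_nat RC) -rmorphM; congr RC; field.
move: (bl tau (nz n) (nz n)) (bl tau (nz p) (nz p)) (bl tau (rz a) (rz a)) => x1 x2 x3.
move: (bl tau (nz n) (rz a)) (bl tau (rz a) (nz p)) (bl tau (nz n) (nz p)) => x4 x5 x6.
move: (dot (nz n) z) (dot (nz p) z) (dot (rz a) z) => y1 y2 y3.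
move: (dot (nz n) (rz mu)) (dot (nz p) (rz mu)) (RC (m / 2)) => y4 y5 k; ring.
Qed.

Lemma Theta_shift_int m tau a mu z (q : 'cV[C]_g) e : 0 < m -> growth tau ->
  (forall n, ee (RC m * dot (nz n + rz a) q) = e) ->
  Theta m tau a mu (z + q) = e * Theta m tau a mu z.
Proof.
move=> m0 gt hq; apply: tsumE; apply: hsum_ext (hsumZ e (Theta_hsum a mu z m0 gt)) => n.
rewrite /tterm -(hq n) -eeD; congr ee; rewrite dotDr mulrDr addrC -!addrA.
by congr (_ + (_ + _)); rewrite addrC.
Qed.

(** Twisting by a character amounts to translating the argument, up to a nowhere vanishing factor.
    Twisted series thus inherit nonvanishing from untwisted ones. *)
Lemma Theta_char m tau a mu nu z : 0 < m -> growth tau -> tau^T = tau ->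
  exists u : C, Theta m tau (a + m^-1 *: nu) mu z =
    ee u * Theta m tau a 0 (z + RC m^-1 *: (tau *m rz nu - rz mu)).
Proof.
move=> m0 gt ts.
exists (RC (2 * m)^-1 * bl tau (rz nu) (rz nu) + dot (rz nu) z + dot (rz a) (rz mu)).
apply: tsumE; apply: hsum_ext (hsumZ _ (Theta_hsum a 0 _ m0 gt)) => n.
rewrite /tterm -eeD; congr ee.
have -> : rz (a + m^-1 *: nu) = rz a + RC m^-1 *: rz nu by rewrite rzD /rz map_mxZ.
rewrite rz0 !addrA !dotDr !dotDl !blDl !blDr !dotZr !dotZl !blZl !blZr !dotDr !dotNr !dot_mul.
rewrite (bl_sym (rz nu) (nz n) ts) (bl_sym (rz nu) (rz a) ts) (bl_sym (rz a) (nz n) ts).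
have -> : dot (nz n) 0 = 0 by rewrite /dot mulmx0 mxE.
have m0' : RC m != 0 by rewrite -(rmorph0 RC) (inj_eq (@complexI R)) gt_eqF.
have -> : RC m^-1 = (RC m)^-1 by rewrite fmorphV.
have -> : RC (m / 2) = RC m / 2 by rewrite rmorphM fmorphV rmorph_nat.
have -> : RC (2 * m)^-1 = (2 * RC m)^-1 by rewrite fmorphV rmorphM rmorph_nat.
move: (bl tau (nz n) (nz n)) (bl tau (nz n) (rz a)) (bl tau (rz a) (rz a)) => x1 x2 x3.
move: (bl tau (nz n) (rz nu)) (bl tau (rz a) (rz nu)) (bl tau (rz nu) (rz nu)) => x4 x5 x6.
move: (dot (nz n) z) (dot (rz nu) z) (dot (rz a) z) => y1 y2 y3.
move: (dot (nz n) (rz mu)) (dot (rz a) (rz mu)) (RC m) m0' => y4 y5 h h0; field.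
exact: h0.
Qed.

End Theta.

(** * Products of three theta functions *)

Section TripleProduct.
Variables (R : realType) (g : nat).
Local Notation C := R[i].
Local Notation normc := (@Normc.normc R).
Local Notation RC := (real_complex R).
Local Notation ZV := 'cV[int]_g.
Local Notation K3 := {ffun 'I_g -> 'I_3}.

(* Up to the factor 2 pi i m, the derivative of [Theta m tau a mu] in the direction [v]. *)
Definition DTheta m (tau : 'M[C]_g) a mu z (v : 'cV[C]_g) : C :=
  tsum (fun n => dot (nz R n + rz a) v * tterm m tau a mu z n).

Lemma normc_dot_le (a : 'cV[R]_g) (v : 'cV[C]_g) (n : ZV) :
  normc (dot (nz R n + rz a) v) <=
  (\sum_i normc (v i 0)) * (l1 R n + \sum_i `|a i 0|).
Proof.
rewrite dotE; apply: (le_trans (normc_sum _ _ _)); rewrite mulr_suml.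
apply: ler_sum => i _; rewrite Normc.normcM mulrC ler_wpM2l ?normc_ge0 //.
rewrite !mxE; apply: (le_trans (le_normcD _ _)); apply: lerD.
  by rewrite -(rmorph_int RC) normc_real l1_coord.
by rewrite normc_real (bigD1 i) //= lerDl sumr_ge0.
Qed.

Lemma DTheta_bounded m (tau : 'M[C]_g) a mu z v : 0 < m -> growth tau ->
  exists B, abs_bounded (fun n => dot (nz R n + rz a) v * tterm m tau a mu z n) B.
Proof.
move=> m0 gt; have [K K0 hK] := tterm_bound a mu z m0 gt (@ler01 R).
have [B hB] := l1_bounded R g.
pose S := \sum_i normc (v i 0); have S0 : 0 <= S by apply: sumr_ge0 => i _; exact: normc_ge0.
pose A := \sum_i `|a i 0|; have A0 : 0 <= A by apply: sumr_ge0.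
exists (S * expR A * K * B); apply: (abs_bounded_le hB).
  by rewrite !mulr_ge0 ?expR_ge0.
move=> n; rewrite Normc.normcM.
have h1 : normc (dot (nz R n + rz a) v) <= S * (expR A * expR (1 * l1 R n)).
  apply: (le_trans (normc_dot_le _ _ _)); rewrite -/S -/A ler_wpM2l // mul1r -expRD.
  by have := expR_ge1Dx (A + l1 R n); lra.
apply: (le_trans (ler_wpM2r (normc_ge0 _) h1)).
have -> : S * (expR A * expR (1 * l1 R n)) * normc (tterm m tau a mu z n)
  = S * expR A * (normc (tterm m tau a mu z n) * expR (1 * l1 R n)) by ring.
by rewrite -!mulrA ler_wpM2l // ler_wpM2l ?expR_ge0 // -mulrA hK.
Qed.

Lemma DTheta_hsum m (tau : 'M[C]_g) a mu z v : 0 < m -> growth tau ->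
  hsum (fun n => dot (nz R n + rz a) v * tterm m tau a mu z n) (DTheta m tau a mu z v).
Proof. by move=> m0 gt; have [B hB] := DTheta_bounded a mu z v m0 gt; exact: tsumP hB. Qed.

(** The characteristics [k / 3] with [k] in {0, 1, 2}^g index the usual basis of theta functions of
    order three. *)
Definition kv (k : K3) : ZV := \col_i (Posz (k i)).
Definition ka (k : K3) : 'cV[R]_g := 3^-1 *: iv R (kv k).

(** Triples of integer vectors sorted by their sum, written [3 p + k] with [k] reduced modulo three.
    The remaining data are the deviations from [p], which add up to [k]. *)
Definition triple_map (q : K3 * (ZV * (ZV * ZV))) : ZV * (ZV * ZV) :=
  (q.2.1 + q.2.2.1, (q.2.1 + q.2.2.2, q.2.1 + (kv q.1 - q.2.2.1 - q.2.2.2))).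

Definition triple_inv (q : ZV * (ZV * ZV)) : K3 * (ZV * (ZV * ZV)) :=
  let s := q.1 + q.2.1 + q.2.2 in
  let p := \col_i (s i ord0 %/ 3)%Z in
  ([ffun i => inord `|(s i ord0 %% 3)%Z|], (p, (q.1 - p, q.2.1 - p))).

Lemma triple_mapK : cancel triple_map triple_inv.
Proof.
move=> [k [p [m1 m2]]]; rewrite /triple_map /triple_inv /=.
have E i : (p + m1 + (p + m2) + (p + (kv k - m1 - m2))) i ord0 = p i ord0 * 3 + Posz (k i).
  by rewrite !mxE; ring.
have k3 i : (Posz (k i) %/ 3)%Z = 0 by apply: divz_small; have := ltn_ord (k i); lia.
have -> : \col_i ((p + m1 + (p + m2) + (p + (kv k - m1 - m2))) i ord0 %/ 3)%Z = p.
  by apply/colP => i; rewrite mxE E divzMDl // k3 addr0.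
congr (_, (_, (_, _))); last 2 first.
- by rewrite addrC addKr.
- by rewrite addrC addKr.
apply/ffunP => i; rewrite ffunE; apply: val_inj; rewrite E modzMDl modz_small.
  by rewrite /= inordK.
by have := ltn_ord (k i); lia.
Qed.

Lemma triple_invK : cancel triple_inv triple_map.
Proof.
move=> [n1 [n2 n3]]; rewrite /triple_map /triple_inv /=; set p := \col_i _.
congr (_, (_, _)); [by rewrite addrC subrK | by rewrite addrC subrK |].
apply/colP => i; rewrite !mxE ffunE.
have -> : (n1 + n2 + n3) i ord0 = n1 i 0 + n2 i 0 + n3 i 0 by rewrite !mxE.
set s := n1 i 0 + n2 i 0 + n3 i 0; have s3 := divz_eq s 3.
have m0 : (0 <= (s %% 3)%Z) by apply: modz_ge0.
have m3 : ((s %% 3)%Z < 3) by apply: ltz_pmod.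
rewrite inordK; last by lia.
have -> : n3 i 0 = s - n1 i 0 - n2 i 0 by rewrite /s; ring.
rewrite gez0_abs //.
have -> (x u v q : int) : (s = q * 3 + x) -> q + (x - (u - q) - (v - q)) = s - u - v.
  by move=> ->; ring.
- by [].
exact: s3.
Qed.

Variable tau : 'M[C]_g.
Hypothesis gt : growth tau.
Hypothesis ts : tau^T = tau.

Definition theta (z : 'cV[C]_g) : C := Theta 1 tau 0 0 z.
Definition dtheta (z v : 'cV[C]_g) : C := DTheta 1 tau 0 0 z v.
Definition fth (k : K3) (z : 'cV[C]_g) : C := Theta 3 tau (ka k) 0 z.
Definition dfth (k : K3) (z v : 'cV[C]_g) : C := DTheta 3 tau (ka k) 0 z v.

Let t1 := tterm 1 tau 0 0.

Definition gterm (k : K3) (a b : 'cV[C]_g) (q : ZV * ZV) : C :=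
  ee (- (6^-1 * bl tau (nz R (kv k)) (nz R (kv k)))) *
  (t1 (- a) q.1 * t1 (- b) q.2 * t1 (a + b) (kv k - q.1 - q.2)).

Lemma t1E z n : t1 z n = ee (2^-1 * bl tau (nz R n) (nz R n) + dot (nz R n) z).
Proof.
rewrite /t1 /tterm rz0 addr0; congr ee; rewrite [RC 1]rmorph1 mul1r.
rewrite (_ : dot (nz R n) 0 = 0) ?subr0; last by rewrite /dot mulmx0 mxE.
by rewrite mul1r fmorphV rmorph_nat.
Qed.

Lemma gterm_bounded k a b : exists B, abs_bounded (gterm k a b) B.
Proof.
have [B1 h1] := Theta_bounded 0 0 (- a) (@ltr01 R) gt.
have [B2 h2] := Theta_bounded 0 0 (- b) (@ltr01 R) gt.
have [B3 h3] := Theta_bounded 0 0 (a + b) (@ltr01 R) gt.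
have h3' n : normc (t1 (a + b) n) <= B3 by have := h3 [fset n]%fset; rewrite big_seq_fset1.
set c := normc (ee (- (6^-1 * bl tau (nz R (kv k)) (nz R (kv k))))).
exists (c * B3 * (B1 * B2)) => A; apply: (@le_trans _ _
   (\sum_(q <- A) (c * B3 * normc (t1 (- a) q.1 * t1 (- b) q.2)))).
  apply: ler_sum => q _; rewrite /gterm Normc.normcM -/c.
  move: (t1 (- a) q.1 * t1 (- b) q.2) => w; rewrite Normc.normcM -mulrA.
  apply: ler_wpM2l; first exact: normc_ge0.
  by rewrite [X in _ <= X]mulrC; apply: (ler_wpM2l (normc_ge0 _) (h3' _)).
rewrite -mulr_sumr ler_wpM2l //; first by rewrite mulr_ge0 ?normc_ge0 // (abs_bounded_ge0 h3).
exact: (abs_bounded_mul h1 h2).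
Qed.

(** As the deviations add up to [k], the three squares combine to [3 (p + k / 3)^2] plus a part free
    of [p], whence the correction by [6^-1] in [gterm]. The shifts [-a], [-b] and [a + b] add up to
    zero, so they pair with the deviations only. *)
Lemma triple_term k a b z p m1 m2 :
  tterm 3 tau (ka k) 0 z p * gterm k a b (m1, m2) =
  t1 (z - a) (p + m1) * (t1 (z - b) (p + m2) * t1 (z + a + b) (p + (kv k - m1 - m2))).
Proof.
rewrite /gterm !t1E /tterm -4!eeD -2!eeD; congr ee.
have -> : rz (ka k) = 3^-1 *: nz R (kv k).
  by rewrite /ka nzE /rz map_mxZ fmorphV rmorph_nat.
have -> : dot (nz R p) (rz 0) = 0 :> C by rewrite rz0 /dot mulmx0 mxE.
rewrite !nzD !nzN /=; set P := nz R p; set K := nz R (kv k); set M1 := nz R m1; set M2 := nz R m2.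
rewrite !(blDl, blDr, blNl, blNr, blZl, blZr, dotDl, dotDr, dotNl, dotNr, dotZl, dotZr).
rewrite (bl_sym M1 P ts) (bl_sym M2 P ts) (bl_sym K P ts) (bl_sym M1 K ts) (bl_sym M2 K ts) (bl_sym M2 M1 ts).
have -> : RC (3 / 2) = 3 / 2 by rewrite rmorphM fmorphV !rmorph_nat.
have -> : RC 3 = 3 by rewrite rmorph_nat.
move: (bl tau P P) (bl tau P K) (bl tau K K) (bl tau P M1) (bl tau P M2) => x1 x2 x3 x4 x5.
move: (bl tau M1 M1) (bl tau M2 M2) (bl tau K M1) (bl tau K M2) (bl tau M1 M2) => x6 x7 x8 x9 x10.
move: (dot P z) (dot K z) (dot M1 z) (dot M2 z) (dot P a) (dot P b) => y1 y2 y3 y4 y5 y6.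
move: (dot M1 a) (dot M1 b) (dot M2 a) (dot M2 b) (dot K a) (dot K b) => y7 y8 y9 y10 y11 y12.
by field.
Qed.

(** The coefficients [G] do not depend on [z], so the same ones serve for the derivative. There the
    linear factors of the three terms add up to [3 (p + k / 3)], which is the origin of the factor
    3. *)
Theorem triple_product (a b : 'cV[C]_g) : exists G : K3 -> C, forall z,
  \sum_k fth k z * G k = theta (z - a) * (theta (z - b) * theta (z + a + b)) /\
  forall v, \sum_k (3 * dfth k z v) * G k =
    dtheta (z - a) v * (theta (z - b) * theta (z + a + b)) +
    (theta (z - a) * (dtheta (z - b) v * theta (z + a + b)) +
     theta (z - a) * (theta (z - b) * dtheta (z + a + b) v)).
Proof.
exists (fun k => tsum (gterm k a b)) => z.
have three : 0 < 3 :> R by rewrite ltr0n.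
have hG k : hsum (gterm k a b) (tsum (gterm k a b)).
  by have [B hB] := gterm_bounded k a b; exact: tsumP hB.
have bT w : exists B, abs_bounded (t1 w) B := Theta_bounded 0 0 w (@ltr01 R) gt.
have hT w : hsum (t1 w) (theta w) := Theta_hsum 0 0 w (@ltr01 R) gt.
have bD w v : exists B, abs_bounded (fun n => dot (nz R n + rz 0) v * t1 w n) B
  := DTheta_bounded 0 0 w v (@ltr01 R) gt.
have hD w v : hsum (fun n => dot (nz R n + rz 0) v * t1 w n) (dtheta w v)
  := DTheta_hsum 0 0 w v (@ltr01 R) gt.
have mul3 (f1 f2 f3 : ZV -> C) s1 s2 s3 : (exists B, abs_bounded f1 B) ->
    (exists B, abs_bounded f2 B) -> (exists B, abs_bounded f3 B) ->
    hsum f1 s1 -> hsum f2 s2 -> hsum f3 s3 ->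
    hsum ((fun q : ZV * (ZV * ZV) => f1 q.1 * (f2 q.2.1 * f3 q.2.2)) \o triple_map) (s1 * (s2 * s3)).
  move=> [B1 b1] [B2 b2] [B3 b3] h1 h2 h3.
  apply: (hsum_reindex triple_mapK triple_invK).
  exact: (hsum_mul b1 (abs_bounded_mul b2 b3) h1 (hsum_mul b2 b3 h2 h3)).
split=> [|v].
- apply: (@hsum_uniq _ _ (fun q : K3 * (ZV * (ZV * ZV)) =>
      tterm 3 tau (ka q.1) 0 z q.2.1 * gterm q.1 a b q.2.2)).
    apply: hsum_fin => k; have [B hB] := gterm_bounded k a b.
    have [B' hB'] := Theta_bounded (ka k) 0 z three gt.
    exact: (hsum_mul hB' hB (Theta_hsum (ka k) 0 z three gt) (hG k)).
  apply: hsum_ext (mul3 _ _ _ _ _ _ (bT (z - a)) (bT (z - b)) (bT (z + a + b)) (hT _) (hT _) (hT _)).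
  by move=> [k [p [m1 m2]]] /=; rewrite triple_term.
- apply: (@hsum_uniq _ _ (fun q : K3 * (ZV * (ZV * ZV)) =>
      (3 * (dot (nz R q.2.1 + rz (ka q.1)) v * tterm 3 tau (ka q.1) 0 z q.2.1)) * gterm q.1 a b q.2.2)).
    apply: hsum_fin => k; have [B hB] := gterm_bounded k a b.
    have [B' hB'] := DTheta_bounded (ka k) 0 z v three gt.
    have := hsum_mul hB' hB (DTheta_hsum (ka k) 0 z v three gt) (hG k).
    move=> /(hsumZ 3); rewrite mulrA; apply: hsum_ext => -[p q] /=.
    by rewrite mulrA.
  have H1 := mul3 _ _ _ _ _ _ (bD (z - a) v) (bT (z - b)) (bT (z + a + b)) (hD _ _) (hT _) (hT _).
  have H2 := mul3 _ _ _ _ _ _ (bT (z - a)) (bD (z - b) v) (bT (z + a + b)) (hT _) (hD _ _) (hT _).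
  have H3 := mul3 _ _ _ _ _ _ (bT (z - a)) (bT (z - b)) (bD (z + a + b) v) (hT _) (hT _) (hD _ _).
  apply: hsum_ext (hsumD H1 (hsumD H2 H3)) => -[k [p [m1 m2]]] /=.
  have := triple_term k a b z p m1 m2.
  move: (tterm 3 tau (ka k) 0 z p) (gterm k a b (m1, m2)) => w1 w2.
  move: (t1 (z - a) (p + m1)) (t1 (z - b) (p + m2)) => u1 u2.
  move: (t1 (z + a + b) (p + (kv k - m1 - m2))) => u3 E.
  have -> : 3 * (dot (nz R p + rz (ka k)) v * w1) * w2 =
      3 * dot (nz R p + rz (ka k)) v * (w1 * w2) by rewrite !mulrA.
  rewrite {}E; have -> : 3 * dot (nz R p + rz (ka k)) v = dot (nz R (p + m1) + rz 0) v
     + dot (nz R (p + m2) + rz 0) v + dot (nz R (p + (kv k - m1 - m2)) + rz 0) v.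
    rewrite rz0 !addr0 -!dotDl -dotZl; congr dot; rewrite -!nzD.
    have -> : p + m1 + (p + m2) + (p + (kv k - m1 - m2)) = p *+ 3 + kv k.
      by apply/colP => i; rewrite !mxE; ring.
    rewrite scalerDr nzD; congr (_ + _).
      have -> : p *+ 3 = p + (p + p) by [].
      by rewrite scaler_nat !nzD.
    by rewrite /ka /rz map_mxZ scalerA fmorphV rmorph_nat mulfV ?pnatr_eq0 // scale1r nzE.
  by move: (dot (nz R (p + m1) + rz 0) v) (dot (nz R (p + m2) + rz 0) v)
    (dot (nz R (p + (kv k - m1 - m2)) + rz 0) v) => d1 d2 d3; ring.
Qed.

End TripleProduct.

(** * Dominant terms *)

Section NearDiagonal.
Variables (R : realType) (g : nat).

Lemma sum_near_diag (T : 'I_g -> 'I_g -> R) (a : 'I_g -> R) (eps k : R) :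
  0 <= eps -> (forall i, 0 <= a i) -> (forall i, k * a i <= T i i) ->
  (forall i j, i != j -> - (eps * (a i + a j)) <= T i j) ->
  (k - 2 * eps * g%:R) * \sum_i a i <= \sum_i \sum_j T i j.
Proof.
move=> e0 a0 hd hT.
have -> : (k - 2 * eps * g%:R) * \sum_i a i =
    \sum_i (k * a i - \sum_j eps * (a i + a j)).
  rewrite sumrB -mulr_sumr mulrBl; congr (_ - _).
  under [RHS]eq_bigr => i _ do rewrite -mulr_sumr big_split /= sumr_const card_ord.
  rewrite -mulr_sumr big_split /= sumr_const card_ord sumrMnl.
  by rewrite -[X in _ = eps * (X + _)]mulr_natl -[X in _ = eps * (_ + X)]mulr_natl; ring.
apply: ler_sum => i _; rewrite (bigD1 i) //= [leRHS](bigD1 i) //= opprD addrA.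
apply: lerD.
  have h1 := hd i; have h2 : 0 <= eps * (a i + a i) by rewrite mulr_ge0 ?addr_ge0.
  by apply: le_trans h1; rewrite gerDl oppr_le0.
by rewrite -sumrN; apply: ler_sum => j ij; apply: hT; rewrite eq_sym.
Qed.

Lemma qfE (y : 'M[R]_g) v : qf y v = \sum_i \sum_j v i 0 * y i j * v j 0.
Proof.
rewrite /qf mxE exchange_big /=; apply: eq_bigr => j _.
by rewrite mxE mulr_suml; apply: eq_bigr => i _; rewrite mxE.
Qed.

Variables (y : 'M[R]_g) (eps : R).
Hypotheses (eps0 : 0 <= eps) (eps_g : eps * g%:R <= 20^-1).
Hypotheses (ys : forall i j, y i j = y j i) (yd : forall i, 0 <= y i i).
Hypothesis yo : forall i j, i != j -> `|y i j| <= eps * y i i.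

Let eps_g2 : 2 * eps * g%:R <= 10^-1.
Proof. by rewrite -mulrA; move: (eps * g%:R) eps_g => x; lra. Qed.

Lemma near_diag_term i j (u v : R) : i != j ->
  `|u * y i j * v| <= eps * (y i i * u ^+ 2 + y j j * v ^+ 2) / 2.
Proof.
move=> ij; have h1 := yo ij; have h2 : `|y i j| <= eps * y j j.
  by rewrite ys; apply: yo; rewrite eq_sym.
have h : `|u * v| <= (u ^+ 2 + v ^+ 2) / 2.
  have := sqr_ge0 (`|u| - `|v|); rewrite normrM sqrrB !real_normK ?num_real //; lra.
have -> : `|u * y i j * v| = `|y i j| * `|u * v| by rewrite !normrM; ring.
apply: (le_trans (ler_wpM2l (normr_ge0 _) h)).
have k1 := ler_wpM2r (sqr_ge0 u) h1; have k2 := ler_wpM2r (sqr_ge0 v) h2; lra.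
Qed.

Lemma near_diag_qf (v : 'cV[R]_g) : (\sum_i y i i * v i 0 ^+ 2) / 2 <= qf y v.
Proof.
rewrite qfE; have := @sum_near_diag (fun i j => v i 0 * y i j * v j 0)
  (fun i => y i i * v i 0 ^+ 2) eps 1 eps0.
have a0 i : 0 <= y i i * v i 0 ^+ 2 by rewrite mulr_ge0 ?sqr_ge0.
have S0 : 0 <= \sum_i y i i * v i 0 ^+ 2 by exact: sumr_ge0.
move=> /(_ a0) h; apply: le_trans (h _ _) => [|i|i j ij].
- have : (1 - 2 * eps * g%:R) * (\sum_i y i i * v i 0 ^+ 2) >= 2^-1 * (\sum_i y i i * v i 0 ^+ 2).
    by apply: ler_wpM2r => //; have := eps_g2; lra.
  by rewrite [X in X <= _ -> _]mulrC.
- by rewrite mul1r expr2; lra.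
- have := near_diag_term (v i 0) (v j 0) ij.
  have t0 : 0 <= eps * (y i i * v i 0 ^+ 2 + y j j * v j 0 ^+ 2).
    by rewrite mulr_ge0 ?addr_ge0.
  by rewrite ler_norml => /andP[]; lra.
Qed.

(** The bound 2/5 lies below 1/2: for an integer [M] and [r] at most 2/5, [M^2 + 2 M r] is at least
    [M^2 / 5]. The off-diagonal entries cost at most half of this gain. *)
Lemma near_diag_gap (m : 'cV[int]_g) (rho : 'cV[R]_g) :
  (forall i, `|rho i 0| <= 2 / 5) ->
  (\sum_i y i i * (m i 0)%:~R ^+ 2) / 10 <= qf y (iv R m + rho) - qf y rho.
Proof.
move=> hr; rewrite !qfE -sumrB.
under [leRHS]eq_bigr do rewrite -sumrB.
pose M i : R := (m i 0)%:~R; pose r i := rho i 0.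
have a0 i : 0 <= y i i * M i ^+ 2 by rewrite mulr_ge0 ?sqr_ge0.
have M1 i : `|M i| <= M i ^+ 2.
  rewrite /M -(@intr_norm R) -rmorphXn ler_int.
  have [->|n0] := eqVneq (m i 0) 0; first by rewrite normr0 expr0n.
  by rewrite -real_normK ?num_real // expr2 ler_peMl // -gtz0_ge1 normr_gt0.
have S0 : 0 <= \sum_i y i i * M i ^+ 2 by exact: sumr_ge0.
have Mr i k : `|M i * r k| <= 2 / 5 * M i ^+ 2.
  rewrite normrM; apply: (le_trans (ler_pM _ _ (M1 i) (hr k))) => //; lra.
apply: (@le_trans _ _ ((5^-1 - 2 * eps * g%:R) * \sum_i y i i * M i ^+ 2)).
  by rewrite mulrC; apply: (ler_wpM2r S0); have := eps_g2; lra.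
apply: sum_near_diag => // [i|i j ij]; rewrite [(iv R m + rho) i 0]mxE [iv R m i 0]mxE.
  rewrite -/(M i) -/(r i).
  have -> : (M i + r i) * y i i * (M i + r i) - r i * y i i * r i =
     y i i * (M i ^+ 2 + 2 * (M i * r i)) by ring.
  rewrite mulrCA; apply: ler_wpM2l => //.
  by have := Mr i i; rewrite ler_norml => /andP[]; lra.
rewrite [(iv R m + rho) j 0]mxE [iv R m j 0]mxE -/(M i) -/(r i) -/(M j) -/(r j).
have -> : (M i + r i) * y i j * (M j + r j) - r i * y i j * r j =
   M i * y i j * M j + (y i j * (M i * r j) + y i j * (M j * r i)) by ring.
have := near_diag_term (M i) (M j) ij; rewrite ler_norml => /andP[t1 _].
have t2 : `|y i j * (M i * r j)| <= eps * y i i * (2 / 5 * M i ^+ 2).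
  by rewrite normrM; apply: ler_pM => //; apply: yo.
have t3 : `|y i j * (M j * r i)| <= eps * y j j * (2 / 5 * M j ^+ 2).
  by rewrite normrM; apply: ler_pM => //; rewrite ys; apply: yo; rewrite eq_sym.
move: t2 t3; rewrite !ler_norml => /andP[t2 _] /andP[t3 _].
have s0 : 0 <= eps * (y i i * M i ^+ 2 + y j j * M j ^+ 2) by rewrite mulr_ge0 ?addr_ge0.
lra.
Qed.

End NearDiagonal.

(** * Dominance of one theta term on the tame set *)

Section Dominance.
Variables (R : realType) (g : nat).
Local Notation C := R[i].
Local Notation normc := (@Normc.normc R).
Local Notation RC := (real_complex R).
Local Notation ZV := 'cV[int]_g.

(** Makes [2 * eps * g] at most 1/10, half of the diagonal gain in [near_diag_gap]. *)
Definition eps_g : R := (20 * g.+1%:R)^-1.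

Lemma eps_g_gt0 : 0 < eps_g.
Proof. by rewrite invr_gt0 mulr_gt0 // ltr0n. Qed.

Lemma eps_g_le : eps_g * g%:R <= 20^-1.
Proof.
rewrite /eps_g invfM -mulrA; apply: ler_piMr; first by rewrite invr_ge0 ler0n.
by rewrite mulrC ler_pdivrMr ?ltr0n // mul1r ler_nat.
Qed.

Section Tame.
Variables (X c : R) (tau : 'M[C]_g).
Hypotheses (c0 : 0 < c) (tt : tame X c eps_g tau).

Let ys i j : imx tau i j = imx tau j i.
Proof. by have [ts _ _ _] := tt; rewrite !mxE -[in LHS]ts mxE. Qed.

Let yc i : c <= imx tau i i.
Proof. by have [_ _ h _] := tt; rewrite mxE. Qed.

Let yd i : 0 <= imx tau i i.
Proof. exact: le_trans (ltW c0) (yc i). Qed.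

Let yo i j : i != j -> `|imx tau i j| <= eps_g * imx tau i i.
Proof. by have [_ _ _ h] := tt; rewrite !mxE; exact: h. Qed.

Lemma tame_sym : tau^T = tau. Proof. by case: tt. Qed.

Lemma tame_growth : growth tau.
Proof.
exists (c / 2); first by rewrite divr_gt0.
move=> v; apply: le_trans (near_diag_qf (ltW eps_g_gt0) eps_g_le ys yd yo v).
rewrite mulrAC ler_pM2r ?invr_gt0 // /sumsq mulr_sumr.
by apply: ler_sum => i _; rewrite ler_wpM2r ?sqr_ge0.
Qed.

Lemma growth_siegel : tau^T = tau -> growth tau -> siegel tau.
Proof.
move=> ts [k k0 hk]; split => // v v0.
apply: lt_le_trans (hk v); rewrite mulr_gt0 // lt_def sumr_ge0 ?andbT; last first.
  by move=> i _; exact: sqr_ge0.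
apply: contra v0 => /eqP s0; apply/eqP/colP => i; rewrite mxE.
have := s0; rewrite /sumsq (bigD1 i) //= => /eqP.
rewrite paddr_eq0 ?sqr_ge0 ?sumr_ge0 // => [/andP[]|j _]; last exact: sqr_ge0.
by rewrite sqrf_eq0 => /eqP.
Qed.

(** [- n0] lies within 2/5 of the height [r] in every coordinate; for a point of height [r] the term
    at [n0] is then the largest, with a gap. *)
Definition good (r : 'cV[R]_g) (n0 : ZV) : Prop :=
  forall i, `|r i 0 + (n0 i 0)%:~R| <= 2 / 5.

(** Writing [Q] for the form of [imx tau], the term at [n] has modulus
    [exp (- pi (Q (n + r) - Q r))]; [near_diag_gap] is applied at [r + n0]. *)
Lemma good_term r n0 n z : good r n0 -> imx z = imx tau *m r ->
  normc (tterm 1 tau 0 0 z n) <=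
  normc (tterm 1 tau 0 0 z n0) * expR (- (pi * c / 10 * l1 R (n - n0))).
Proof.
move=> hg hz; rewrite !normc_tterm -expRD ler_expR !addr0 !mulr1 hz.
pose rho := r + iv R n0.
have E m : pi * qf (imx tau) (iv R m) + 2 * pi * ((iv R m)^T *m (imx tau *m r)) 0 0
    = pi * (qf (imx tau) (iv R (m - n0) + rho) - qf (imx tau) r).
  have -> : iv R (m - n0) + rho = iv R m + r.
    by apply/colP => i; rewrite !mxE rmorphB /=; ring.
  rewrite -[2 * pi]mulrC -mulrA -mulrDr; congr (_ * _).
  rewrite /qf [(iv R m + r)^T]linearD /= !mulmxDl !mulmxDr !mulmxA.
  have -> : r^T *m imx tau *m iv R m = (iv R m)^T *m imx tau *m r.
    apply/matrixP => i j; rewrite !ord1 -[in LHS](trmxK (_ *m iv R m)) mxE !trmx_mul trmxK.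
    have -> : (imx tau)^T = imx tau by apply/matrixP => k l; rewrite mxE ys.
    by rewrite mulmxA.
  rewrite !mxE; ring.
have hrho : forall i, `|rho i 0| <= 2 / 5 by move=> i; have := hg i; rewrite !mxE.
have q := near_diag_gap (ltW eps_g_gt0) eps_g_le ys yd yo (n - n0) hrho.
have l : c * l1 R (n - n0) <= \sum_i imx tau i i * ((n - n0) i 0)%:~R ^+ 2.
  rewrite /l1 mulr_sumr; apply: ler_sum => i _; apply: ler_pM => //; first exact: ltW.
  rewrite -rmorphXn ler_int.
  have [->|k0] := eqVneq ((n - n0) i 0) 0; first by rewrite normr0 expr0n.
  by rewrite -real_normK ?num_real // expr2 ler_peMl // -gtz0_ge1 normr_gt0.
have p0 := pi_gt0 R.
have E0 := E n0; rewrite subrr in E0; have z0 : iv R (0 : ZV) = 0 by exact: map_mx0.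
rewrite z0 add0r in E0.
have := E n; have -> : pi * c / 10 * l1 R (n - n0) = pi * (c * l1 R (n - n0) / 10) by ring.
have := ler_wpM2l (ltW p0) (le_trans (_ : c * l1 R (n - n0) / 10 <= _) q).
rewrite ler_pM2r ?invr_gt0 // => /(_ l).
lra.
Qed.

End Tame.

Theorem dominance : exists2 c : R, 0 < c & forall X tau, tame X c eps_g tau ->
  forall r n0 z (A : {fset ZV}), good r n0 -> imx z = imx tau *m r -> n0 \notin A ->
  \sum_(n <- A) normc (tterm 1 tau 0 0 z n) <= normc (tterm 1 tau 0 0 z n0) / 10.
Proof.
have [B hB] := l1_bounded R g; have B0 := abs_bounded_ge0 hB.
(* Since pi is at least 2, the decay rate [pi c / 10] is at least [1 + 10 B]. For [n] different from
   [n0] the part [10 B] yields a constant factor, and [B exp (- 10 B)] is at most 1/10. *)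
exists (5 + 50 * B); first lra.
move=> X tau tt r n0 z A hg hz nA; have c0 : 0 < 5 + 50 * B by lra.
set T := normc (tterm _ _ _ _ _ n0).
apply: (@le_trans _ _ (\sum_(n <- A) T * (expR (- (10 * B)) * expR (- l1 R (n - n0))))).
  rewrite ![X in X <= _]big_seq [leRHS]big_seq; apply: ler_sum => n hn.
  apply: (le_trans (good_term c0 tt n hg hz)); rewrite -/T.
  apply: ler_wpM2l; first exact: normc_ge0.
  rewrite -expRD ler_expR.
  have l1n : 1 <= l1 R (n - n0).
    have : n - n0 != 0 by apply: contra nA; rewrite subr_eq0 => /eqP <-.
    move=> /cV0Pn[i hi]; apply: le_trans (l1_coord R (n - n0) i).
    by rewrite -intr_norm -[1]/(1%:~R) ler_int -gtz0_ge1 normr_gt0.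
  have p2 := pi_ge2 R.
  have : (1 + 10 * B) * l1 R (n - n0) <= pi * (5 + 50 * B) / 10 * l1 R (n - n0).
    apply: ler_wpM2r; first lra.
    have : 2 * (5 + 50 * B) <= pi * (5 + 50 * B) by apply: ler_wpM2r => //; lra.
    lra.
  have : 10 * B * 1 <= 10 * B * l1 R (n - n0) by apply: ler_wpM2l => //; lra.
  lra.
rewrite -mulr_sumr; apply: ler_wpM2l; first exact: normc_ge0.
rewrite -mulr_sumr; apply: (@le_trans _ _ (expR (- (10 * B)) * B)).
  apply: ler_wpM2l; first exact: expR_ge0.
  have := abs_bounded_comp (subIr n0) hB A; apply: le_trans; rewrite /comp.
  by apply: ler_sum => n _; rewrite normc_real ger0_norm ?expR_ge0.
rewrite expRN mulrC ler_pdivrMr ?expR_gt0 //.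
by have := expR_ge1Dx (10 * B); lra.
Qed.

Definition good1 (t : R) : Prop := exists n : int, `|t + n%:~R| <= 2 / 5.

Lemma good1N t : good1 (- t) -> good1 t.
Proof.
by move=> [n hn]; exists (- n); rewrite -normrN opprD rmorphN /= opprK.
Qed.

Lemma bad1 t : ~ good1 t -> exists m : int, `|t - m%:~R - 2^-1| < 10^-1.
Proof.
move=> b; exists (Num.floor t); have /andP[f0 f1] := mem_rg1_floor t.
have h1 : ~ (`|t + (- Num.floor t)%:~R| <= 2 / 5) by move=> h; apply: b; exists (- Num.floor t).
have h2 : ~ (`|t + (- Num.floor t - 1)%:~R| <= 2 / 5).
  by move=> h; apply: b; exists (- Num.floor t - 1).
move: h1 h2 => /negP h1 /negP h2; move: h1 h2.
rewrite -!ltNge rmorphB /= rmorphN /= ger0_norm ?subr_ge0 // ler0_norm; last lra.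
by rewrite ltr_norml => *; apply/andP; split; lra.
Qed.

(* Each [x j] excludes at most one of the five fifths. *)
Lemma good_fifth (x : 'I_4 -> R) : exists a, forall j, good1 (x j - a).
Proof.
apply: contrapT => H.
have hk (k : 'I_5) : {j : 'I_4 | ~ good1 (x j - k%:R / 5)}.
  apply: cid; apply: contrapT => /forallNP h; apply: H; exists (k%:R / 5) => j.
  exact: contrapT (h j).
pose f k := sval (hk k).
suff /leq_card : injective f by rewrite !card_ord.
move=> k k' E.
have [m hm] := bad1 (svalP (hk k)); have [m' hm'] := bad1 (svalP (hk k')).
rewrite -/(f k) in hm; rewrite -/(f k') -E in hm'.
have : `|((k'%:Z - k%:Z) - 5 * (m - m'))%:~R : R| < 1%:~R.
  rewrite !(rmorphB, rmorphM) /=; move: hm hm'; rewrite !ltr_norml.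
  by move=> /andP[? ?] /andP[? ?]; apply/andP; split; lra.
rewrite -intr_norm ltr_int => hz.
apply: val_inj => /=; have := ltn_ord k; have := ltn_ord k'; move: hz; lia.
Qed.

(** [al] has two conditions to meet, and then [be] four, because the sums with [al] count as well.
    [good_fifth] meets four at once, and [good1N] adjusts the sign. *)
Lemma good_shift1 (r1 r2 : R) : exists al be : R,
  [/\ good1 (r1 - al) /\ good1 (r2 - al), good1 (r1 - be) /\ good1 (r2 - be)
    & good1 (r1 + al + be) /\ good1 (r2 + al + be)].
Proof.
have [al hal] := good_fifth (tnth [tuple r1; r2; r1; r2]).
have [be hbe] := good_fifth (tnth [tuple r1; r2; - (r1 + al); - (r2 + al)]).
exists al, be; split; split.
- exact: (hal 0).
- exact: (hal 1).
- exact: (hbe 0).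
- exact: (hbe 1).
- by apply: good1N; rewrite opprD; apply: (hbe (Ordinal (isT : 2 < 4)%N)).
- by apply: good1N; rewrite opprD; apply: (hbe (Ordinal (isT : 3 < 4)%N)).
Qed.

Lemma good_of_good1 (r : 'cV[R]_g) : (forall i, good1 (r i 0)) -> exists n0, good r n0.
Proof.
move=> h; have {}h i : {n : int | `|r i 0 + n%:~R| <= 2 / 5} by exact: cid (h i).
by exists (\col_i sval (h i)) => i; rewrite mxE; exact: svalP (h i).
Qed.

Lemma good_shift (r1 r2 : 'cV[R]_g) : exists al be : 'cV[R]_g,
  [/\ (exists n, good (r1 - al) n) /\ (exists n, good (r2 - al) n),
      (exists n, good (r1 - be) n) /\ (exists n, good (r2 - be) n)
    & (exists n, good (r1 + al + be) n) /\ (exists n, good (r2 + al + be) n)].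
Proof.
have h i : {p : R * R | [/\ good1 (r1 i 0 - p.1) /\ good1 (r2 i 0 - p.1),
   good1 (r1 i 0 - p.2) /\ good1 (r2 i 0 - p.2)
   & good1 (r1 i 0 + p.1 + p.2) /\ good1 (r2 i 0 + p.1 + p.2)]}.
  by apply: cid; have [al [be hab]] := good_shift1 (r1 i 0) (r2 i 0); exists (al, be).
exists (\col_i (sval (h i)).1), (\col_i (sval (h i)).2).
by split; split; apply: good_of_good1 => i; rewrite !mxE;
  case: (svalP (h i)) => -[? ?] [? ?] [? ?].
Qed.

End Dominance.

(** * Fourier uniqueness *)

Section Fourier.
Variables (R : realType) (g : nat).
Local Notation C := R[i].
Local Notation normc := (@Normc.normc R).
Local Notation RC := (real_complex R).
Local Notation ZV := 'cV[int]_g.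

(** The character by which a real translation of the argument acts on the theta term at [n]
    ([t1_frq]). *)
Definition frq (n : ZV) (x : 'cV[R]_g) : C := ee (- dot (nz R n) (rz x)).

Lemma frqD n x y : frq n (x + y) = frq n x * frq n y.
Proof. by rewrite /frq rzD dotDr opprD eeD. Qed.

Lemma frq0 n : frq n 0 = 1.
Proof. by rewrite /frq rz0 /dot mulmx0 mxE oppr0 ee0. Qed.

Lemma frqBl m n x : frq (m - n) x = frq m x * (frq n x)^-1.
Proof. by rewrite /frq nzD nzN dotDl dotNl opprD eeD [ee (- - _)]eeN. Qed.

Lemma normc_frq n x : normc (frq n x) = 1.
Proof. by rewrite /frq nzE dot_rz -rmorphN normc_ee_real. Qed.

Lemma frq_neq0 n x : frq n x != 0.
Proof. exact: ee_neq0. Qed.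

Let vanishing (c : ZV -> C) := forall x, hsum (fun n => c n * frq n x) 0.

Lemma frq_sep (n : ZV) : n != 0 -> exists x, frq n x = -1.
Proof.
move=> /cV0Pn[i ni]; have ni' : (n i 0)%:~R != 0 :> R by rewrite intr_eq0.
exists (- ((2 * (n i 0)%:~R)^-1 *: delta_mx i 0)).
rewrite /frq nzE dot_rz; set u := (X in RC X); have -> : u = - ((2 * (n i 0)%:~R)^-1 * (n i 0)%:~R).
  by rewrite /u mulmxN -scalemxAr -colE !mxE.
rewrite rmorphN opprK invfM -mulrA mulVf // mulr1 ee_real.
rewrite mulrAC mulfV ?pnatr_eq0 // mul1r cospi sinpi.
by apply/eqP; rewrite eq_complex /= oppr0 !eqxx.
Qed.

(* A shift by [x0] averages out the frequencies [n] with [frq (n - m) x0 = -1]. *)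
Lemma vanishing_avg c m x0 : vanishing c ->
  vanishing (fun n => (1 + frq (n - m) x0) / 2 * c n).
Proof.
move=> h x.
have h1 := hsumZ 2^-1 (h x); have h2 := hsumZ (2^-1 * (frq m x0)^-1) (h (x + x0)).
have := hsumD h1 h2; rewrite !mulr0 addr0; apply: hsum_ext => n.
rewrite frqBl frqD; move: (frq n x) (frq n x0) (frq m x0)^-1 (c n) => u v w t; by field.
Qed.

(** Averaging annihilates the finitely many frequencies other than [m] outside of which the absolute
    sum is small. It fixes [c m] and enlarges no coefficient, so only a tail below [e / 2] remains
    beside [c m]. *)
Lemma fourier_zero c B : abs_bounded c B -> vanishing c -> forall n, c n = 0.
Proof.
move=> hB hv m; apply/eqP; rewrite -normc_eq0; apply/eqP/le_anti; rewrite normc_ge0 andbT.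
apply/ler_addgt0Pr => e e0; rewrite add0r.
have e2 : 0 < e / 2 by rewrite divr_gt0.
have [A0 hA0] := abs_bounded_tail hB e2.
have [w [w1 wm w0 hw]] : exists w : ZV -> C, [/\ forall n, normc (w n) <= 1, w m = 1,
   forall n, n \in A0 -> n != m -> w n = 0 & vanishing (fun n => w n * c n)].
  have : exists w : ZV -> C, [/\ forall n, normc (w n) <= 1, w m = 1,
     forall n, n \in enum_fset A0 -> n != m -> w n = 0 & vanishing (fun n => w n * c n)].
    elim: (enum_fset A0) => [|a s [w [w1 wm w0 hw]]].
      exists (fun=> 1); split=> // [n|x]; first by rewrite Normc.normc1.
      by apply: hsum_ext (hv x) => n; rewrite mul1r.
    have [->|am] := eqVneq a m.
      exists w; split=> // n; rewrite inE => /orP[/eqP -> /eqP //|]; exact: w0.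
    have [x0 hx0] : exists x0, frq (a - m) x0 = -1 by apply: frq_sep; rewrite subr_eq0.
    exists (fun n => (1 + frq (n - m) x0) / 2 * w n); split=> [n||n|].
    - rewrite Normc.normcM; apply: mulr_ile1; rewrite ?normc_ge0 ?w1 //.
      rewrite Normc.normcM.
      have -> : normc 2^-1 = 2^-1.
        by rewrite -(rmorph_nat RC) -fmorphV normc_real ger0_norm // invr_ge0 ler0n.
      rewrite ler_pdivrMr // mul1r; apply: (le_trans (le_normcD _ _)).
      by rewrite Normc.normc1 normc_frq.
    - by rewrite subrr /frq nz0 /dot trmx0 mul0mx mxE oppr0 ee0 wm mulr1 mulfV ?pnatr_eq0.
    - rewrite inE => /orP[/eqP -> _|ns nm]; first by rewrite hx0 subrr mul0r mul0r.
      by rewrite w0 ?mulr0.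
    - move=> x; have := vanishing_avg m x0 hw x; apply: hsum_ext => n.
      by rewrite mulrA.
  by [].
have [A1 hA1] := hw 0 _ e2.
pose A := (m |` (A0 `|` A1))%fset.
have mA : m \in A by rewrite !inE eqxx.
have sA : (A1 `<=` A)%fset by apply/fsubsetP => x xA; rewrite !inE xA !orbT.
have := hA1 A sA; rewrite subr0 (big_fsetD1 m) //= wm mul1r frq0 mulr1.
pose A' := ((A `\ m) `\` A0)%fset.
have -> : \sum_(i <- (A `\ m)%fset) w i * c i * frq i 0 = \sum_(i <- A') w i * c i.
  rewrite (big_fsetID _ (mem A0)) /= big1_seq ?add0r; last first.
    by move=> n /=; rewrite !inE => /andP[/andP[nm _] nA]; rewrite w0 // !mul0r.
  have -> : [fset x in (A `\ m)%fset | ~~ mem A0 x]%fset = A'.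
    by apply/fsetP => x; rewrite !inE andbC.
  by apply: eq_bigr => i _; rewrite frq0 mulr1.
have d : [disjoint A0 & A']%fset.
  by apply/fdisjointP => x xA; rewrite !inE xA.
have h2 := hA0 _ d.
have h3 : normc (\sum_(i <- A') w i * c i) < e / 2.
  apply: le_lt_trans h2; apply: (le_trans (normc_sum _ _ _)); apply: ler_sum => i _.
  by rewrite Normc.normcM ler_piMl ?normc_ge0.
move: (\sum_(i <- A') w i * c i) h3 => s h3 h4.
have := le_normcD (c m + s) (- s); rewrite addrK normcN; lra.
Qed.

Lemma fourier_uniq c d B B' : abs_bounded c B -> abs_bounded d B' ->
  (forall x, exists s, hsum (fun n => c n * frq n x) s /\ hsum (fun n => d n * frq n x) s) ->
  forall n, c n = d n.
Proof.
move=> hB hB' h n; apply/eqP; rewrite -subr_eq0; apply/eqP.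
apply: (@fourier_zero (fun n => c n - d n) (B + B')) => [A|x].
  apply: le_trans (lerD (hB A) (hB' A)); rewrite -big_split /=.
  by apply: ler_sum => i _; apply: (le_trans (le_normcD _ _)); rewrite normcN.
have [s [h1 h2]] := h x; have := hsumD h1 (hsumZ (-1) h2).
by rewrite mulN1r subrr; apply: hsum_ext => k; rewrite mulN1r mulrBl.
Qed.

(** While [u] stays within 3/5 of 1, [u + 1] has modulus at least 7/5, so each squaring moves the
    power away from 1 by a fixed ratio. [hk] records a linear lower bound for this growth. *)
Lemma no_small_subgroup (w : C) : (forall n, normc (w ^+ n - 1) <= 3 / 5) -> w = 1.
Proof.
move=> h; apply/eqP; rewrite -subr_eq0 -normc_eq0; apply/negPn/negP => a0.
set a := normc (w - 1) in a0; have {}a0 : 0 < a by rewrite lt_def a0 normc_ge0.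
have hk k : (1 + k%:R * (2 / 5)) * a <= normc (w ^+ (2 ^ k) - 1).
  elim: k => [|k IH]; first by rewrite mul0r addr0 mul1r expr1.
  rewrite expnS mulnC exprM -[X in _ - X](expr1n C 2) subr_sqr Normc.normcM.
  have := h (2 ^ k)%N; move: IH; move: (w ^+ (2 ^ k)) => u IH hu.
  have u2 : 7 / 5 <= normc (u + 1).
    have := le_normcD (u + 1) (- (u - 1)); rewrite normcN.
    have -> : u + 1 - (u - 1) = RC 2 by rewrite rmorph_nat; ring.
    by rewrite normc_real ger0_norm //; lra.
  apply: (@le_trans _ _ (normc (u - 1) * (7 / 5))); last by rewrite ler_wpM2l ?normc_ge0.
  apply: (@le_trans _ _ ((1 + k%:R * (2 / 5)) * a * (7 / 5))); last by rewrite ler_wpM2r.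
  rewrite -natr1; have ka : 0 <= k%:R * a :> R by rewrite mulr_ge0 // ltW.
  lra.
have [k hka] : exists k : nat, 3 / 2 / a < k%:R.
  by exists (Num.Def.truncn (3 / 2 / a)).+1; exact: truncnS_gt.
have := hk k; have := h (2 ^ k)%N.
rewrite ltr_pdivrMr // in hka; lra.
Qed.

(* A quotient of translates which factors through addition is a character; if it stays
   close to a given character, it is that character. *)
Lemma char_close (V : zmodType) (P Q S e : V -> C) :
  (forall x, P x != 0) -> (forall x, Q x != 0) ->
  (forall x y, P x * Q y = S (x + y)) -> (forall x y, e (x + y) = e x * e y) -> e 0 = 1 ->
  (forall x, normc (P x / P 0 * e x - 1) <= 3 / 5) -> forall x, P x * e x = P 0.
Proof.
move=> P0 Q0 h eD e0 hb x; pose chi x := P x / P 0 * e x.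
have chiD u v : chi (u + v) = chi u * chi v.
  rewrite /chi eD; have h1 := h (u + v) 0; have h2 := h 0 v; have h3 := h u v.
  have h4 : P (u + v) * Q 0 * P 0 = P u * P v * Q 0.
    have h5 := h v 0; rewrite h1 addr0 -h3 -!mulrA; congr (_ * _).
    by rewrite [Q v * _]mulrC h2 h5 add0r addr0.
  have -> : P (u + v) = P u * P v / P 0.
    apply: (mulIf (Q0 0)); apply: (mulIf (P0 0)); rewrite h4.
    by rewrite [RHS]mulrAC divfK // mulrAC.
  by move: (P0 0); move: (P 0) (P u) (P v) (e u) (e v) => p q r s t p0; field.
have chi0 : chi 0 = 1 by rewrite /chi e0 mulr1 mulfV.
have chiX n : chi (x *+ n) = chi x ^+ n.
  by elim: n => [|n IH]; rewrite ?mulr0n ?chi0 // mulrS chiD IH exprS.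
have := @no_small_subgroup (chi x); rewrite /chi => /(_ _) E.
have : chi x = 1 by apply: no_small_subgroup => n; rewrite -chiX; exact: hb.
rewrite /chi => /(congr1 (fun t => t * P 0)); rewrite mul1r => <-.
by rewrite mulrAC divfK.
Qed.

(** Both products are within 21/100 of 1, so the quotient is within 42/79, below the 3/5 of
    [no_small_subgroup]. *)
Lemma quot_close (q1 q2 q3 q4 : C) :
  normc (q1 - 1) <= 10^-1 -> normc (q2 - 1) <= 10^-1 -> normc (q3 - 1) <= 10^-1 ->
  normc (q4 - 1) <= 10^-1 -> normc (q1 * q4 / (q2 * q3) - 1) <= 3 / 5.
Proof.
move=> h1 h2 h3 h4.
have pr (u v : C) : normc (u - 1) <= 10^-1 -> normc (v - 1) <= 10^-1 ->
    normc (u * v - 1) <= 21 / 100.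
  move=> hu hv; have -> : u * v - 1 = (u - 1) * (v - 1) + ((u - 1) + (v - 1)) by ring.
  apply: (le_trans (le_normcD _ _)); rewrite Normc.normcM.
  have := le_normcD (u - 1) (v - 1).
  have := ler_pM (normc_ge0 _) (normc_ge0 _) hu hv; lra.
have k1 := pr _ _ h1 h4; have k2 := pr _ _ h2 h3; move: (q1 * q4) (q2 * q3) k1 k2 => u v hu hv.
have v0 : 79 / 100 <= normc v.
  have := le_normcD v (- (v - 1)); rewrite normcN.
  by rewrite opprB addrC subrK Normc.normc1; lra.
have vn : v != 0 by rewrite -normc_gt0; lra.
have -> : u / v - 1 = (u - v) / v by rewrite mulrBl divff.
rewrite Normc.normcM Normc.normcV ler_pdivrMr; last lra.
have := le_normcD (u - 1) (- (v - 1)); rewrite normcN.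
have -> : u - 1 - (v - 1) = u - v by ring.
lra.
Qed.

End Fourier.

(** * The order three theta functions embed the torus *)

Section Embedding.
Variables (R : realType) (g : nat).
Local Notation C := R[i].
Local Notation normc := (@Normc.normc R).
Local Notation RC := (real_complex R).
Local Notation ZV := 'cV[int]_g.

Variable tau : 'M[C]_g.
Hypothesis gt : growth tau.
Hypothesis ts : tau^T = tau.
Hypothesis dom : forall r n0 z (A : {fset ZV}),
  good r n0 -> imx z = imx tau *m r -> n0 \notin A ->
  \sum_(n <- A) normc (tterm 1 tau 0 0 z n) <= normc (tterm 1 tau 0 0 z n0) / 10.

Local Notation t1 := (tterm 1 tau 0 0).

Lemma imxD m n (A B : 'M[C]_(m, n)) : imx (A + B) = imx A + imx B.
Proof. by apply/matrixP => i j; rewrite !mxE raddfD. Qed.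

Lemma imxN m n (A : 'M[C]_(m, n)) : imx (- A) = - imx A.
Proof. by apply/matrixP => i j; rewrite !mxE raddfN. Qed.

Lemma imx_rz (x : 'cV[R]_g) : imx (rz x) = 0.
Proof. by apply/matrixP => i j; rewrite !mxE. Qed.

Lemma imx_tau_rz (x : 'cV[R]_g) : imx (tau *m rz x) = imx tau *m x.
Proof.
apply/matrixP => i j; rewrite !mxE raddf_sum /=; apply: eq_bigr => k _.
by rewrite !mxE; case: (tau i k) => a b /=; rewrite mulr0 add0r.
Qed.

Lemma imx_tau_unit : imx tau \in unitmx.
Proof. by apply: posdef_unit; have /siegelP[] := growth_siegel ts gt. Qed.

Lemma height (z : 'cV[C]_g) : exists r, imx z = imx tau *m r.
Proof. by exists (invmx (imx tau) *m imx z); rewrite mulKVmx // imx_tau_unit. Qed.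

Lemma t1_frq z x n : t1 (z - rz x) n = t1 z n * frq n x.
Proof. by rewrite !t1E dotDr dotNr /frq addrA eeD. Qed.

Lemma t1_neq0 z n : t1 z n != 0.
Proof. exact: ee_neq0. Qed.

Lemma theta_dom r n0 z : good r n0 -> imx z = imx tau *m r ->
  normc (theta tau z / t1 z n0 - 1) <= 10^-1.
Proof.
move=> hg hz; have T0 := t1_neq0 z n0.
have -> : theta tau z / t1 z n0 - 1 = (theta tau z - t1 z n0) / t1 z n0.
  by rewrite mulrBl divff.
rewrite Normc.normcM Normc.normcV ler_pdivrMr ?normc_gt0 //.
apply/ler_addgt0Pr => e e0.
have [A0 /(_ (n0 |` A0)%fset (fsubsetUr _ _))] := Theta_hsum 0 0 z (@ltr01 R) gt e0.
rewrite (big_fsetD1 n0) ?fset1U1 // -/(theta tau z) => h.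
have nA : n0 \notin ((n0 |` A0) `\ n0)%fset by rewrite !inE eqxx.
have := dom hg hz nA; have := normc_sum (enum_fset ((n0 |` A0) `\ n0)%fset) xpredT (t1 z).
move: h; move: (\sum_(n <- _) normc _) (\sum_(n <- _) t1 z n) => S' S.
move: (theta tau z) (t1 z n0) => th t h h1 h2.
have := le_normcD (- (t + S - th)) S; rewrite normcN.
have -> : - (t + S - th) + S = th - t by ring.
lra.
Qed.

Lemma theta_neq0 r n0 z : good r n0 -> imx z = imx tau *m r -> theta tau z != 0.
Proof.
move=> hg hz; have := theta_dom hg hz; apply: contraTneq => ->.
by rewrite mul0r sub0r normcN Normc.normc1 -ltNge; lra.
Qed.

(** The shifts [al] and [be] are chosen once for both points. Real vectors do not change imaginary
    parts, so dominance holds with fixed indices along the whole real families used in [fth_inj] and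
    [dfth_inj]. *)
Lemma heights z1 z2 : exists al be : 'cV[R]_g, exists n1 n2 m1 m2 l1 l2 : ZV,
  exists r1 r2 r3 r4 r5 r6 : 'cV[R]_g,
  [/\ [/\ good r1 n1, good r2 n2, good r3 m1 & good r4 m2] /\ (good r5 l1 /\ good r6 l2),
   forall x, imx (z1 - (tau *m rz al + rz x)) = imx tau *m r1 /\
             imx (z2 - (tau *m rz al + rz x)) = imx tau *m r2,
   forall x, imx (z1 - (tau *m rz be + rz x)) = imx tau *m r3 /\
             imx (z2 - (tau *m rz be + rz x)) = imx tau *m r4
 & forall x x', imx (z1 + (tau *m rz al + rz x) + (tau *m rz be + rz x')) = imx tau *m r5 /\
             imx (z2 + (tau *m rz al + rz x) + (tau *m rz be + rz x')) = imx tau *m r6].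
Proof.
have [r1 h1] := height z1; have [r2 h2] := height z2.
have [al [be [[[n1 k1] [n2 k2]] [[m1 k3] [m2 k4]] [[l1 k5] [l2 k6]]]]] := good_shift r1 r2.
exists al, be, n1, n2, m1, m2, l1, l2; do 6!eexists; split; first by split; split; eassumption.
- by move=> x; rewrite !(imxD, imxN) imx_tau_rz imx_rz addr0 h1 h2 -!mulmxBr.
- by move=> x; rewrite !(imxD, imxN) imx_tau_rz imx_rz addr0 h1 h2 -!mulmxBr.
- by move=> x x'; rewrite !(imxD, imxN) !imx_tau_rz !imx_rz !addr0 h1 h2 -!mulmxDr.
Qed.

(** For suitable [a] and [b] the product of three theta values is nonzero by dominance, and it is a
    combination of the [fth tau k z]. *)
Lemma fth_neq0 z : exists k, fth tau k z != 0.
Proof.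
have [al [be [n1 [n2 [m1 [m2 [l1 [l2]]]]]]]] := heights z z.
move=> [r1 [r2 [r3 [r4 [r5 [r6 [[[g1 _ g3 _] [g5 _]] hA hB hC]]]]]]].
have [G /(_ z)[E _]] := triple_product gt ts (tau *m rz al + rz 0) (tau *m rz be + rz 0).
apply: contrapT => /forallNP H; have : \sum_k fth tau k z * G k = 0.
  by apply: big1 => k _; have /negP := H k; rewrite negbK => /eqP ->; rewrite mul0r.
rewrite E; apply/eqP; rewrite !mulf_neq0 //.
- exact: theta_neq0 g1 (hA 0).1.
- exact: theta_neq0 g3 (hB 0).1.
- exact: theta_neq0 g5 (hC 0 0).1.
Qed.

Theorem fth_inj z1 z2 rho : rho != 0 ->
  (forall k, fth tau k z1 = rho * fth tau k z2) ->
  exists p q : ZV, z1 - z2 = tau *m nz R p + nz R q.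
Proof.
move=> rho0 hf.
have [al [be [n1 [n2 [m1 [m2 [l1 [l2]]]]]]]] := heights z1 z2.
move=> [r1 [r2 [r3 [r4 [r5 [r6 [[[g1 g2 g3 g4] [g5 g6]] hA hB hC]]]]]]].
pose a x := tau *m rz al + rz x; pose b x := tau *m rz be + rz x.
pose P x := theta tau (z1 - a x) / theta tau (z2 - a x).
pose Q x := theta tau (z1 - b x) / theta tau (z2 - b x).
pose S x := rho * theta tau (z2 + a 0 + b x) / theta tau (z1 + a 0 + b x).
have A1 x : theta tau (z1 - a x) != 0 := theta_neq0 g1 (hA x).1.
have A2 x : theta tau (z2 - a x) != 0 := theta_neq0 g2 (hA x).2.
have B1 x : theta tau (z1 - b x) != 0 := theta_neq0 g3 (hB x).1.
have B2 x : theta tau (z2 - b x) != 0 := theta_neq0 g4 (hB x).2.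
have C1 x y : theta tau (z1 + a x + b y) != 0 := theta_neq0 g5 (hC x y).1.
have C2 x y : theta tau (z2 + a x + b y) != 0 := theta_neq0 g6 (hC x y).2.
(* The third factor depends on [a x + b y], hence on [x + y] alone; dividing the triple products at
   [z1] and [z2] gives a multiplicative Cauchy equation. *)
have PQ x y : P x * Q y = S (x + y).
  have [G HG] := triple_product gt ts (a x) (b y).
  have [E1 _] := HG z1; have [E2 _] := HG z2.
  have E : \sum_k fth tau k z1 * G k = rho * \sum_k fth tau k z2 * G k.
    by rewrite mulr_sumr; apply: eq_bigr => k _; rewrite hf mulrA.
  move: E; rewrite E1 E2 /S.
  have ab w : w + a 0 + b (x + y) = w + a x + b y.
    by rewrite /a /b rzD rz0 addr0 -!addrA; congr (_ + (_ + _)); rewrite addrCA.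
  rewrite !ab /P /Q; move: (A2 x) (B2 y) (C1 x y).
  move: (theta tau (z1 - a x)) (theta tau (z2 - a x)) (theta tau (z1 - b y)) => u1 u2 v1.
  move: (theta tau (z2 - b y)) (theta tau (z1 + a x + b y)) (theta tau (z2 + a x + b y)).
  move=> v2 w1 w2 u20 v20 w10 E.
  apply: (mulIf w10); apply: (mulIf u20); apply: (mulIf v20).
  have -> : u1 / u2 * (v1 / v2) * w1 * u2 * v2 = u1 * (v1 * w1) by field; rewrite u20 v20.
  by rewrite E; field.
(* The dominant terms vary with [x] by [frq n1] and [frq n2], so the ratio [P] stays close to a
   multiple of [frq k]. *)
pose k := n1 - n2.
pose e x := (frq k x)^-1 : C.
have hP : forall x, P x * e x = P 0.
  apply: (char_close (Q := Q) (S := S)) => //.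
  - by move=> x; rewrite mulf_neq0 ?invr_eq0.
  - by move=> x; rewrite mulf_neq0 ?invr_eq0.
  - by move=> x y; rewrite /e frqD invfM.
  - by rewrite /e frq0 invr1.
  move=> x.
  have -> : P x / P 0 * e x =
      (theta tau (z1 - a x) / t1 (z1 - a x) n1) * (theta tau (z2 - a 0) / t1 (z2 - a 0) n2)
      / ((theta tau (z2 - a x) / t1 (z2 - a x) n2) * (theta tau (z1 - a 0) / t1 (z1 - a 0) n1)).
    have aE w : w - a x = w - a 0 - rz x.
      by rewrite /a rz0 addr0 opprD addrA.
    have T1 : t1 (z1 - a x) n1 = t1 (z1 - a 0) n1 * frq n1 x by rewrite aE t1_frq.
    have T2 : t1 (z2 - a x) n2 = t1 (z2 - a 0) n2 * frq n2 x by rewrite aE t1_frq.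
    rewrite T1 T2 /P /e /k frqBl; move: (frq_neq0 n1 x) (frq_neq0 n2 x).
    move: (t1_neq0 (z1 - a 0) n1) (t1_neq0 (z2 - a 0) n2) (A1 x) (A2 x) (A1 0) (A2 0).
    move: (frq n1 x) (frq n2 x) (t1 (z1 - a 0) n1) (t1 (z2 - a 0) n2) => s1 s2 v1 v2.
    move: (theta tau (z1 - a x)) (theta tau (z2 - a x)) => u1 u2.
    move: (theta tau (z1 - a 0)) (theta tau (z2 - a 0)) => u3 u4.
    move=> h1 h2 h3 h4 h5 h6 h7 h8; field.
    by rewrite h1 h2 h4 h5 h6 h7 h8.
  apply: quot_close.
  - exact: theta_dom g1 (hA x).1.
  - exact: theta_dom g2 (hA x).2.
  - exact: theta_dom g1 (hA 0).1.
  - exact: theta_dom g2 (hA 0).2.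
have [Bd1 b1] := Theta_bounded 0 0 (z1 - a 0) (@ltr01 R) gt.
have [Bd2 b2] := Theta_bounded 0 0 (z2 - a 0) (@ltr01 R) gt.
have hT z : hsum (t1 z) (theta tau z) := Theta_hsum 0 0 z (@ltr01 R) gt.
have b3 : abs_bounded (fun n => P 0 * t1 (z2 - a 0) (n - k)) (normc (P 0) * Bd2).
  move: (P 0) => p A; have := abs_bounded_comp (subIr k) b2 A.
  rewrite /comp => /(ler_wpM2l (normc_ge0 p)); rewrite mulr_sumr.
  by under eq_bigr do rewrite -Normc.normcM.
have F := fourier_uniq b1 b3.
have {}F : forall n, t1 (z1 - a 0) n = P 0 * t1 (z2 - a 0) (n - k).
  apply: F => x; exists (theta tau (z1 - a 0 - rz x)); split.
    by apply: hsum_ext (hT (z1 - a 0 - rz x)) => n; rewrite t1_frq.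
  have aE w : w - a 0 - rz x = w - a x by rewrite /a rz0 addr0 opprD addrA.
  have -> : theta tau (z1 - a 0 - rz x) = P 0 * frq k x * theta tau (z2 - a 0 - rz x).
    rewrite -(hP x) /e mulfVK ?frq_neq0 // /P !aE divfK //.
  have := hsum_reindex (subrK k) (addrK k) (hT (z2 - a 0 - rz x)).
  move=> /(hsumZ (P 0 * frq k x)); apply: hsum_ext => n /=.
  have kE : frq (n - k) x = frq n x / frq k x by rewrite frqBl.
  rewrite t1_frq kE; move: (frq_neq0 k x).
  move: (frq k x) (frq n x) (P 0) (t1 (z2 - a 0) (n - k)) => u v p t u0; by field.
(* Comparing the coefficients at [n] and at 0 cancels the quadratic terms and leaves
   [ee (n . d) = 1] for every [n], so [d] is integral. *)
pose d := z1 - z2 + tau *m nz R k.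
have hd n : ee (dot (nz R n) d) = 1.
  have F0 := F 0; have Fn := F n; rewrite sub0r in F0.
  rewrite !t1E in F0 Fn; move: F0 Fn; move: (P 0) => p.
  rewrite nzD nzN nz0.
  have -> : bl tau 0 0 = 0 by rewrite /bl mulmx0 mxE.
  have -> w : dot 0 w = 0 by rewrite /dot trmx0 mul0mx mxE.
  rewrite mulr0 addr0 ee0 => F0.
  have p0 : p != 0 by apply: contra_eq_neq F0 => ->; rewrite mul0r oner_eq0.
  have -> : p = (ee (2^-1 * bl tau (- nz R k) (- nz R k) + dot (- nz R k) (z2 - a 0)))^-1.
    by apply: (mulIf (ee_neq0 (2^-1 * bl tau (- nz R k) (- nz R k) + dot (- nz R k) (z2 - a 0))));
      rewrite -F0 mulVf ?ee_neq0.
  rewrite -eeN -eeD => E.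
  have := congr1 (fun t => t * ee (- (2^-1 * bl tau (nz R n) (nz R n) + dot (nz R n) (z2 - a 0)) + bl tau (nz R n) (nz R k))) E.
  rewrite -!eeD => {}E; transitivity (ee (0 : C)); last exact: ee0.
  move: E; congr (ee _ = ee _); rewrite /d;
    rewrite !(blDl, blDr, blNl, blNr, dotDl, dotDr, dotNl, dotNr) ?dot_mul ?(bl_sym (nz R k) (nz R n) ts);
    move: (bl tau (nz R n) (nz R n)) (bl tau (nz R n) (nz R k)) (bl tau (nz R k) (nz R k)) => x1 x2 x3;
    move: (dot (nz R n) z1) (dot (nz R n) z2) (dot (nz R n) (a 0)) (dot (nz R k) z2) (dot (nz R k) (a 0)) => x4 x5 x6 x7 x8; by field.
have hq i : {q : int | d i 0 = q%:~R}.
  apply: cid; apply: ee_eq1; have := hd (delta_mx i 0); congr (ee _ = _).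
  by rewrite /nz map_delta_mx /dot trmx_delta -rowE mxE.
exists (- k), (\col_i sval (hq i)).
have -> : nz R (\col_i sval (hq i)) = d.
  by apply/colP => i; rewrite !mxE -(svalP (hq i)).
by rewrite nzN mulmxN /d addrCA addNr addr0.
Qed.

Lemma additive_bounded (V : zmodType) (p : V -> C) B :
  (forall x y, p (x + y) = p x + p y) -> (forall x, normc (p x) <= B) -> forall x, p x = 0.
Proof.
move=> pD hB x; apply/eqP; rewrite -normc_eq0; apply/negPn/negP => a0.
have {}a0 : 0 < normc (p x) by rewrite lt_def a0 normc_ge0.
have p0 : p 0 = 0 by have /(congr1 (fun t => t - p 0)) := pD 0 0; rewrite addr0 addrK subrr.
have pM n : p (x *+ n) = n%:R * p x.
  elim: n => [|n IH]; first by rewrite mulr0n p0 mul0r.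
  by rewrite mulrS pD IH -[n.+1%:R]natr1 mulrDl mul1r addrC.
have := hB (x *+ (Num.Def.truncn (B / normc (p x))).+1); rewrite pM Normc.normcM.
rewrite -(rmorph_nat RC) normc_real ger0_norm ?ler0n // leNgt -ltr_pdivrMr //.
by rewrite truncnS_gt.
Qed.

Lemma theta_ge r n0 z : good r n0 -> imx z = imx tau *m r ->
  9 / 10 * normc (t1 z n0) <= normc (theta tau z).
Proof.
move=> hg hz; have := theta_dom hg hz; have T0 := t1_neq0 z n0.
move=> h; apply: (@le_trans _ _ (normc (theta tau z / t1 z n0 * t1 z n0))); last by rewrite divfK.
rewrite Normc.normcM; apply: ler_wpM2r; first exact: normc_ge0.
move: (theta tau z / t1 z n0) h => q h.
by have := le_normcD q (- (q - 1)); rewrite normcN opprB addrC subrK Normc.normc1; lra.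
Qed.

(** The infinitesimal form of [fth_inj]. The logarithmic derivatives satisfy an additive Cauchy
    equation, and a bounded additive map vanishes, so [L] is constant. Its Fourier coefficients give
    [n . v] the same value for every [n], namely the value 0 at [n = 0]. *)
Theorem dfth_inj z v lam : (forall k, dfth tau k z v = lam * fth tau k z) -> v = 0.
Proof.
move=> hf.
have [al [be [n1 [n2 [m1 [m2 [l1 [l2]]]]]]]] := heights z z.
move=> [r1 [r2 [r3 [r4 [r5 [r6 [[[g1 _ g3 _] [g5 _]] hA hB hC]]]]]]].
pose a x := tau *m rz al + rz x; pose b x := tau *m rz be + rz x.
have A1 x : theta tau (z - a x) != 0 := theta_neq0 g1 (hA x).1.
have B1 x : theta tau (z - b x) != 0 := theta_neq0 g3 (hB x).1.
have C1 x y : theta tau (z + a x + b y) != 0 := theta_neq0 g5 (hC x y).1.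
pose L x := dtheta tau (z - a x) v / theta tau (z - a x).
pose M x := dtheta tau (z - b x) v / theta tau (z - b x).
pose N x := dtheta tau (z + a 0 + b x) v / theta tau (z + a 0 + b x).
have E x y : L x + M y + N (x + y) = 3 * lam.
  have [G /(_ z)[E1 /(_ v) E2]] := triple_product gt ts (a x) (b y).
  have E : \sum_k 3 * dfth tau k z v * G k = 3 * lam * \sum_k fth tau k z * G k.
    by rewrite mulr_sumr; apply: eq_bigr => k _; rewrite hf !mulrA.
  move: E; rewrite E1 E2 /L /M /N.
  have -> : z + a 0 + b (x + y) = z + a x + b y.
    by rewrite /a /b rzD rz0 addr0 -!addrA; congr (_ + (_ + _)); rewrite addrCA.
  move: (A1 x) (B1 y) (C1 x y).
  move: (theta tau (z - a x)) (theta tau (z - b y)) (theta tau (z + a x + b y)) => u1 u2 u3.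
  move: (dtheta tau _ v) (dtheta tau _ v) (dtheta tau _ v) => w1 w2 w3 u10 u20 u30 E.
  apply: (mulIf u10); apply: (mulIf u20); apply: (mulIf u30).
  have -> : 3 * lam * u1 * u2 * u3 = 3 * lam * (u1 * (u2 * u3)) by ring.
  by rewrite -E; field; rewrite u10 u20 u30.
have aE x : z - a x = z - a 0 - rz x by rewrite /a rz0 addr0 opprD addrA.
have hT w : hsum (t1 w) (theta tau w) := Theta_hsum 0 0 w (@ltr01 R) gt.
have hD w : hsum (fun n => dot (nz R n + rz 0) v * t1 w n) (dtheta tau w v)
  := DTheta_hsum 0 0 w v (@ltr01 R) gt.
have [Bd bD] := DTheta_bounded 0 0 (z - a 0) v (@ltr01 R) gt.
have [Bt bT] := Theta_bounded 0 0 (z - a 0) (@ltr01 R) gt.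
have Lb : exists B, forall x, normc (L x) <= B.
  exists (Bd / (9 / 10 * normc (t1 (z - a 0) n1))) => x.
  have h1 := theta_ge g1 (hA x).1; rewrite -/(a x) aE t1_frq Normc.normcM normc_frq mulr1 in h1.
  have h2 : normc (dtheta tau (z - a x) v) <= Bd.
    apply: hsum_le (hD _) _ => A; apply: le_trans (bD A).
    apply: ler_sum => n _; rewrite aE t1_frq !Normc.normcM normc_frq.
    by rewrite mulr1.
  rewrite /L Normc.normcM Normc.normcV -aE in h1 *.
  have h3 : 0 < normc (t1 (z - a 0) n1) by rewrite normc_gt0 t1_neq0.
  apply: ler_pM; rewrite ?normc_ge0 ?invr_ge0 ?normc_ge0 // lef_pV2 ?posrE //; lra.
have [BL hBL] := Lb.
have L0 x : L x = L 0.
  apply/eqP; rewrite -subr_eq0; apply/eqP.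
  apply: (@additive_bounded _ (fun x => L x - L 0) (BL + BL)) => [u w|u]; last first.
    by apply: (le_trans (le_normcD _ _)); rewrite normcN lerD.
  have e1 := E (u + w) 0; have e2 := E u w; have e3 := E 0 w; have e4 := E w 0.
  rewrite addr0 in e1; rewrite add0r in e3; rewrite addr0 in e4.
  move: e1 e2 e3 e4; move: (L (u + w)) (L u) (L w) (L 0) (M 0) (M w) (N (u + w)) (N w).
  move=> x1 x2 x3 x4 x5 x6 x7 x8 e1 e2 e3 e4.
  have -> : x1 = 3 * lam - x5 - x7 by rewrite -e1; ring.
  have -> : x7 = 3 * lam - x2 - x6 by rewrite -e2; ring.
  have -> : x6 = 3 * lam - x4 - x8 by rewrite -e3; ring.
  have -> : x3 = 3 * lam - x5 - x8 by rewrite -e4; ring.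
  ring.
have b3 : abs_bounded (fun n => L 0 * t1 (z - a 0) n) (normc (L 0) * Bt).
  move: (L 0) => p A; have := bT A.
  move=> /(ler_wpM2l (normc_ge0 p)); rewrite mulr_sumr.
  by under eq_bigr do rewrite -Normc.normcM.
have F : forall n, dot (nz R n + rz 0) v * t1 (z - a 0) n = L 0 * t1 (z - a 0) n.
  apply: (fourier_uniq bD b3) => x; exists (dtheta tau (z - a x) v); split.
    by apply: hsum_ext (hD (z - a x)) => n; rewrite aE t1_frq mulrA.
  have -> : dtheta tau (z - a x) v = L 0 * theta tau (z - a x) by rewrite -(L0 x) divfK.
  by apply: hsum_ext (hsumZ (L 0) (hT (z - a x))) => n; rewrite aE t1_frq mulrA.
have {}F n : dot (nz R n) v = L 0.
  by apply: (mulIf (t1_neq0 (z - a 0) n)); have := F n; rewrite rz0 addr0.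
have {}L0 : L 0 = 0 by rewrite -(F 0) nz0 /dot trmx0 mul0mx mxE.
apply/colP => i; have := F (delta_mx i 0); rewrite L0 /nz map_delta_mx /dot trmx_delta -rowE.
by rewrite !mxE.
Qed.

End Embedding.

(** * Holomorphy *)

Section Immersion.
Variables (K : numFieldType) (g : nat).
Local Notation V := 'cV[K]_g.

Lemma mx_entry_norm (h : V) i : `|h i 0| <= `|h|.
Proof.
have -> : `|h| = (\big[Num.max/0%:nng]_ij `|h ij.1 ij.2|%:nng)%:num by exact: mx_normE.
have -> : `|h i 0| = (`|h i 0|%:nng)%:num by [].
by rewrite num_le; apply/bigmax_geP; right => /=; exists (i, 0).
Qed.

Lemma quadratic_diff_at (U W : normedModType K) (f : U -> W) (df : {linear U -> W}) x (B : K) :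
  0 <= B -> continuous df ->
  (forall h : U, `|h| <= 1 -> `|f (h + x) - f x - df h| <= B * `|h| ^+ 2) ->
  differentiable f x /\ 'd f x = df :> (U -> W).
Proof.
move=> B0 dfc hB; have d0 : 0 < B + 1 by rewrite ltr_wpDl.
have E : f \o shift x = cst (f x) + df +o_ 0 id.
  apply/eqaddoP => _ /posnumP[e]; near=> h.
  rewrite !fctE /=; have -> : f (h + x) - (f x + df h) = f (h + x) - f x - df h.
    by rewrite opprD addrA.
  have h1 : `|h| <= 1 by near: h; apply: nbhs0_le.
  have h2 : `|h| <= e%:num / (B + 1) by near: h; apply: nbhs0_le; apply: divr_gt0.
  apply: le_trans (hB h h1) _; rewrite ler_pdivlMr // in h2.
  rewrite expr2 mulrA ler_wpM2r //; apply: le_trans h2; rewrite mulrC ler_wpM2l //.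
  by rewrite lerDl.
have dE : 'd f x = df :> (U -> W) by apply: diff_unique.
by split=> //; apply/diff_locallyP; rewrite dE; split.
Unshelve. all: by end_near. Qed.

Lemma quadratic_diff (f : V -> K) (c : V) (x : V) (B : K) : 0 <= B ->
  (forall h : V, (forall i, `|h i 0| <= 1) ->
     `|f (h + x) - f x - \sum_i c i 0 * h i 0| <= B * (\sum_i `|h i 0|) ^+ 2) ->
  differentiable f x /\ 'd f x = (fun v => \sum_i c i 0 * v i 0) :> (V -> K).
Proof.
move=> B0 hB; pose df (v : V) : K := \sum_i c i 0 * v i 0.
have dfl : linear df.
  move=> k u v; rewrite /df /= scaler_sumr -big_split /=; apply: eq_bigr => i _.
  by rewrite !mxE mulrDr mulrCA.
pose dfL : {linear V -> K} := HB.pack df (GRing.isLinear.Build _ _ _ _ _ dfl).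
have dfc : continuous dfL.
  move=> v; rewrite /dfL /=.
  have -> : df = \sum_i (c i 0 *: (fun u : V => u i 0 : K)).
    by apply/funext => u; rewrite fct_sumE.
  apply: differentiable_continuous; apply: differentiable_sum => i.
  by apply: differentiableZ; exact: differentiable_coord.
apply: (quadratic_diff_at (df := dfL) (B := B * g%:R ^+ 2)) => // [|h h1].
  by rewrite mulr_ge0 // exprn_ge0.
apply: le_trans (hB h _) _ => [i|]; first exact: le_trans (mx_entry_norm h i) h1.
rewrite -mulrA -exprMn ler_wpM2l // ler_pXn2r ?nnegrE ?sumr_ge0 ?mulr_ge0 ?ler0n //.
apply: (@le_trans _ _ (\sum_(i < g) `|h|)).
  by apply: ler_sum => i _; exact: mx_entry_norm.
by rewrite sumr_const card_ord mulr_natl.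
Qed.

Variables (N : nat) (F : 'I_N.+1 -> V -> K) (dF : 'I_N.+1 -> V -> V).
Variable f : V -> projspace K N.
Hypothesis Fq : forall j z, exists2 B, 0 <= B & forall h : V, (forall i, `|h i 0| <= 1) ->
  `|F j (h + z) - F j z - \sum_i dF j z i 0 * h i 0| <= B * (\sum_i `|h i 0|) ^+ 2.
Hypothesis F0 : forall z, exists i, F i z != 0.
Hypothesis Fi : forall z (v : V) lam,
  (forall j, \sum_i dF j z i 0 * v i 0 = lam * F j z) -> v = 0.
Hypothesis fF : forall z, homog_coords (f z) (\row_j F j z).

Let Fd j z : differentiable (F j) z.
Proof. by have [B B0 /(quadratic_diff B0)[]] := Fq j z. Qed.

Let Fd' j z v : 'd (F j) z v = \sum_i dF j z i 0 * v i 0.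
Proof. by have [B B0 /(quadratic_diff B0)[_ ->]] := Fq j z. Qed.

Lemma chart_vline (v : 'rV[K]_N.+1) i : v 0 i != 0 ->
  <[v]>%VS = <[chart i (\row_k (v 0%R (lift i k) / v 0%R i))]>%VS.
Proof.
move=> vi; have -> : chart i (\row_k (v 0 (lift i k) / v 0 i)) = (v 0 i)^-1 *: v.
  apply/rowP => j; rewrite !mxE; case: unliftP => [k ->|->]; last by rewrite mulVf.
  by rewrite mxE mulrC.
apply/vspaceP => w; apply/vlineP/vlineP => -[k ->].
  by exists (k * v 0 i); rewrite scalerA mulfK.
by exists (k / v 0 i); rewrite scalerA.
Qed.

(** A vector killed by the derivatives of all the quotients [F j / F i] satisfies
    [dF j v = lam * F j] with one [lam] for all [j], and [Fi] then makes it zero. *)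
Theorem coords_immersion : holomorphic_immersion f.
Proof.
move=> z; have [i Fiz] := F0 z.
pose psi k w := F (lift i k) w / F i w; pose phi w : 'rV[K]_N := \row_k psi k w.
have Fn : \forall w \near z, F i w != 0.
  have := @cvgr_neq0 _ _ _ (nbhs z) _ (F i) (F i z) (differentiable_continuous (Fd i z)) Fiz.
  by move=> /(_ (nbhs_filter z)).
have dpsi k w : F i w != 0 -> differentiable (psi k) w.
  by move=> h; apply: differentiableM => //; apply: differentiableV.
have dphi w : F i w != 0 -> differentiable phi w.
  move=> h; have -> : phi = \sum_(k < N) (fun w => psi k w *: delta_mx 0 k).
    apply/funext => u; apply/rowP => k; rewrite fct_sumE summxE mxE (bigD1 k) //=.
    rewrite big1 => [|l lk]; last by rewrite !mxE eqxx eq_sym (negPf lk) mulr0.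
    by rewrite !mxE !eqxx mulr1 addr0.
  by apply: differentiable_sum => k; apply: differentiableZl; exact: dpsi.
exists i, phi; split.
- near=> w; rewrite /homog_coords fF (chart_vline (i := i)); last first.
    by rewrite mxE; near: w.
  by congr (<[chart i _]>%VS); apply/rowP => k; rewrite !mxE.
- by near=> w; apply: dphi; near: w.
- suff ker v : 'd phi z v = 0 -> v = 0.
    move=> u v E; apply/eqP; rewrite -subr_eq0; apply/eqP/ker.
    by rewrite linearB /= E subrr.
  move=> hv; apply: (@Fi z v ('d (F i) z v / F i z)) => j; rewrite -Fd'.
  case: (unliftP i j) => [k ->|->]; last by rewrite divfK.
  have psiE : psi k = (fun M : 'rV[K]_N => M 0 k) \o phi.
    by apply/funext => w; rewrite /= mxE.
  have d0 : 'd (psi k) z v = 0.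
    rewrite psiE (diff_comp (dphi z Fiz) (differentiable_coord _ _ _)) /= hv.
    by rewrite linear0.
  have := d0; have -> : psi k = F (lift i k) * (fun w => (F i w)^-1) by [].
  rewrite diffM //; last exact: differentiableV.
  rewrite diffV // !fctE /=.
  rewrite -[X in X + _]/(F (lift i k) z * (- (F i z) ^- 2 * 'd (F i) z v)).
  rewrite -[X in _ + X]/((F i z)^-1 * 'd (F (lift i k)) z v) => /eqP.
  rewrite addrC addr_eq0 => /eqP E.
  apply: (mulfI (_ : (F i z)^-1 != 0)); first by rewrite invr_eq0.
  rewrite E; move: Fiz; move: (F (lift i k) z) (F i z) ('d (F i) z v) => a b c b0.
  by field.
Unshelve. all: by end_near. Qed.

End Immersion.

(** * Termwise differentiation of theta series *)

Section ThetaHolomorphic.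
Variables (R : realType) (g : nat).
Local Notation C := R[i].
Local Notation normc := (@Normc.normc R).
Local Notation RC := (real_complex R).

Lemma normcE (z : C) : `|z| = RC (normc z).
Proof. by case: z. Qed.

Lemma tterm_add m (tau : 'M[C]_g) a mu z h n :
  tterm m tau a mu (h + z) n = tterm m tau a mu z n * ee (RC m * dot (nz R n + rz a) h).
Proof.
rewrite /tterm -eeD; congr ee; rewrite dotDr.
by move: (RC _ * bl _ _ _) (dot _ h) (dot _ z) (dot _ (rz mu)) (RC m) => x1 x2 x3 x4 x5; ring.
Qed.

(** Term by term [cexp_bound2] costs the square of [l + A] and an exponential linear in [l]; the
    rate [b] given to [tterm_bound] absorbs both. *)
Lemma Theta_quad m (tau : 'M[C]_g) a mu z : 0 < m -> growth tau ->
  forall M, 0 <= M ->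
  exists2 B, 0 <= B & forall h : 'cV[C]_g, (forall i, normc (h i 0) <= M) ->
    normc (Theta m tau a mu (h + z) - Theta m tau a mu z
           - tpi R * RC m * DTheta m tau a mu z h) <= B * (\sum_i normc (h i 0)) ^+ 2.
Proof.
move=> m0 gt M M0; pose A := \sum_i `|a i 0|; have A0 : 0 <= A by apply: sumr_ge0.
have p0 := pi_gt0 R; pose q := 2 * pi * m; have q0 : 0 <= q by rewrite !mulr_ge0 // ltW.
pose G := M *+ g; have G0 : 0 <= G by rewrite mulrn_wge0.
pose b := 2 + 2 * (q * G); have b0 : 0 <= b.
  by rewrite addr_ge0 // mulr_ge0 // mulr_ge0.
have [K K0 hK] := tterm_bound a mu z m0 gt b0.
have [Bl hBl] := l1_bounded R g; have Bl0 := abs_bounded_ge0 hBl.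
pose E := 4 * q ^+ 2 * expR (b * A).
have E0 : 0 <= E by rewrite mulr_ge0 ?expR_ge0 // mulr_ge0 ?sqr_ge0.
exists (E * K * Bl); first by rewrite mulr_ge0 // mulr_ge0.
move=> h hh; pose H := \sum_i normc (h i 0).
have H0 : 0 <= H by apply: sumr_ge0 => i _; exact: normc_ge0.
have Hg : H <= G.
  by apply: (le_trans (ler_sum _ (fun i _ => hh i))); rewrite sumr_const card_ord.
have hs := hsumD (hsumD (Theta_hsum a mu (h + z) m0 gt) (hsumZ (-1) (Theta_hsum a mu z m0 gt)))
  (hsumZ (- (tpi R * RC m)) (DTheta_hsum a mu z h m0 gt)).
rewrite mulN1r mulNr in hs.
have -> : E * K * Bl * (\sum_i normc (h i 0)) ^+ 2 = (E * K * H ^+ 2) * Bl by rewrite /H; ring.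
apply: hsum_le hs _; apply: (abs_bounded_le hBl); first by rewrite mulr_ge0 ?sqr_ge0 // mulr_ge0.
move=> n; rewrite tterm_add /ee.
have := normc_dot_le a h n; rewrite -/H -/A; have := hK n.
set t := tterm _ _ _ _ _ _; set d := dot _ h; move: t d (l1_ge0 R n) => t d; move: (l1 R n) => l l0.
move=> ht hd.
have -> : t * cexp (tpi R * (RC m * d)) + -1 * t + - (tpi R * RC m) * (d * t) =
   t * (cexp (tpi R * (RC m * d)) - 1 - tpi R * (RC m * d)).
  by move: (cexp (tpi R * (RC m * d))) (tpi R) (RC m) => x1 x2 x3; ring.
pose u := tpi R * (RC m * d); rewrite -/u Normc.normcM.
have nu : normc u <= q * (H * (l + A)).
  rewrite /u !Normc.normcM normc_real (gtr0_norm m0) mulrA.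
  have -> : normc (tpi R) = 2 * pi.
    by rewrite /tpi /= expr0n add0r sqrtr_sqr ger0_norm // mulr_ge0 // ltW.
  by rewrite ler_wpM2l.
have lA : 0 <= l + A by rewrite addr_ge0.
have nug : normc u <= q * (G * (l + A)).
  by apply: (le_trans nu); rewrite ler_wpM2l // ler_wpM2r.
have h1 : normc (cexp u - 1 - u) <= E * H ^+ 2 * expR (b * l).
  apply: (le_trans (cexp_bound2 u)).
  apply: (@le_trans _ _ (4 * (q * (H * (l + A))) ^+ 2 * expR (2 * (q * (G * (l + A)))))).
    have k1 : normc u ^+ 2 <= (q * (H * (l + A))) ^+ 2.
      by apply: lerXn2r nu; rewrite nnegrE ?normc_ge0 //; do 2?[apply: mulr_ge0 => //].
    have k2 : expR (normc u *+ 2) <= expR (2 * (q * (G * (l + A)))).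
      by rewrite ler_expR -[normc u *+ 2]mulr_natl; apply: ler_wpM2l.
    apply: ler_pM k2; [by rewrite mulr_ge0 ?sqr_ge0|exact: expR_ge0|by rewrite ler_wpM2l].
  have lA2 : (l + A) ^+ 2 <= expR (2 * (l + A)).
    have -> : expR (2 * (l + A)) = expR (l + A) ^+ 2 by rewrite expr2 -expRD; congr expR; ring.
    by rewrite ler_pXn2r ?nnegrE ?expR_ge0 //; have := expR_ge1Dx (l + A); lra.
  have -> : 4 * (q * (H * (l + A))) ^+ 2 = 4 * q ^+ 2 * H ^+ 2 * (l + A) ^+ 2 by ring.
  have -> : E * H ^+ 2 * expR (b * l) =
     4 * q ^+ 2 * H ^+ 2 * (expR (2 * (l + A)) * expR (2 * (q * (G * (l + A))))).
    have -> : expR (2 * (l + A)) * expR (2 * (q * (G * (l + A)))) = expR (b * A) * expR (b * l).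
      by rewrite -!expRD; congr expR; rewrite /b; ring.
    by rewrite /E; ring.
  rewrite -[leLHS]mulrA; apply: ler_wpM2l; first by do 2?[apply: mulr_ge0; rewrite ?sqr_ge0 //].
  by apply: ler_wpM2r => //; exact: expR_ge0.
apply: (le_trans (ler_wpM2l (normc_ge0 t) h1)).
have -> : normc t * (E * H ^+ 2 * expR (b * l)) = E * H ^+ 2 * (normc t * expR (b * l)) by ring.
have -> : E * K * H ^+ 2 * expR (- l) = E * H ^+ 2 * (K * expR (- l)) by ring.
by rewrite ler_wpM2l // mulr_ge0 ?sqr_ge0.
Qed.

Lemma DTheta_linear m (tau : 'M[C]_g) a mu z : 0 < m -> growth tau ->
  forall v, DTheta m tau a mu z v = \sum_i DTheta m tau a mu z (delta_mx i 0) * v i 0.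
Proof.
move=> m0 gt v; apply: tsumE.
have := @hsum_sum R _ _ (index_enum 'I_g) xpredT
  (fun i n => dot (nz R n + rz a) (delta_mx i 0) * tterm m tau a mu z n * v i 0)
  (fun i => DTheta m tau a mu z (delta_mx i 0) * v i 0).
have hi i : hsum (fun n => dot (nz R n + rz a) (delta_mx i 0) * tterm m tau a mu z n * v i 0)
   (DTheta m tau a mu z (delta_mx i 0) * v i 0).
  rewrite mulrC; apply: hsum_ext (hsumZ (v i 0) (DTheta_hsum a mu z (delta_mx i 0) m0 gt)) => n.
  by rewrite mulrC.
move=> /(_ hi); apply: hsum_ext => n.
rewrite [in RHS]dotE mulr_suml; apply: eq_bigr => i _.
rewrite mulrAC; congr (_ * _ * _).
by rewrite /dot -colE !mxE.
Qed.

Lemma DThetaZ m (tau : 'M[C]_g) a mu z c v : 0 < m -> growth tau ->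
  DTheta m tau a mu z (c *: v) = c * DTheta m tau a mu z v.
Proof.
move=> m0 gt; rewrite (DTheta_linear _ _ _ m0 gt) [in RHS](DTheta_linear _ _ _ m0 gt) mulr_sumr.
by apply: eq_bigr => i _; rewrite mxE mulrCA.
Qed.

(** [Theta_quad] along the linear map [A]. The bound [B] lies in [C] because the norm of a
    [numFieldType] takes its values in the field itself. *)
Lemma Theta_gradient m (tau : 'M[C]_g) a mu (A : 'M[C]_g) z : 0 < m -> growth tau ->
  exists2 G : 'cV[C]_g,
    forall v : 'cV[C]_g, \sum_i G i 0 * v i 0 = tpi R * RC m * DTheta m tau a mu (A *m z) (A *m v) &
  exists2 B : C, 0 <= B & forall h : 'cV[C]_g, (forall i, `|h i 0| <= 1) ->
    `|Theta m tau a mu (A *m (h + z)) - Theta m tau a mu (A *m z)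
       - \sum_i G i 0 * h i 0| <= B * (\sum_i `|h i 0|) ^+ 2.
Proof.
move=> m0 gt.
pose G : 'cV[C]_g := \col_i (tpi R * RC m * DTheta m tau a mu (A *m z) (A *m delta_mx i 0)).
have hG (v : 'cV[C]_g) : \sum_i G i 0 * v i 0 = tpi R * RC m * DTheta m tau a mu (A *m z) (A *m v).
  pose L w := DTheta m tau a mu (A *m z) w.
  have LS (r : seq 'I_g) (w : 'I_g -> 'cV[C]_g) : L (\sum_(i <- r) w i) = \sum_(i <- r) L (w i).
    elim: r => [|i r IH]; last first.
      rewrite !big_cons -IH /L; set s := \sum_(j <- r) _.
      rewrite !(DTheta_linear _ _ _ m0 gt) -big_split /=.
      by apply: eq_bigr => j _; rewrite mxE mulrDr.
    by rewrite !big_nil -(scale0r (0 : 'cV[C]_g)) /L (DThetaZ _ _ _ _ _ m0 gt) mul0r.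
  have -> : A *m v = \sum_i v i 0 *: (A *m delta_mx i 0).
    apply/colP => k; rewrite summxE mxE; apply: eq_bigr => i _.
    by rewrite [RHS]mxE -colE mxE mulrC.
  rewrite -/(L _) LS mulr_sumr; apply: eq_bigr => i _.
  by rewrite /L (DThetaZ _ _ _ _ _ m0 gt) mxE mulrCA mulrC mulrA.
exists G => //.
pose M := \sum_i \sum_j normc (A i j).
have M0 : 0 <= M.
  by apply: sumr_ge0 => i _; apply: sumr_ge0 => j _; exact: normc_ge0.
have [B B0 hB] := Theta_quad a mu (A *m z) m0 gt M0.
exists (RC (B * M ^+ 2)); first by rewrite lecR mulr_ge0 ?sqr_ge0.
move=> h hh; have hh' i : normc (h i 0) <= 1.
  by have := hh i; rewrite normcE lecR.
have hA i : normc ((A *m h) i 0) <= \sum_j normc (A i j) * normc (h j 0).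
  rewrite mxE; apply: (le_trans (normc_sum _ _ _)); apply: ler_sum => j _.
  by rewrite Normc.normcM.
have hM i : normc ((A *m h) i 0) <= M.
  apply: (@le_trans _ _ (\sum_j normc (A i j))).
    by apply: (le_trans (hA i)); apply: ler_sum => j _; rewrite ler_piMr ?normc_ge0.
  rewrite /M [leRHS](bigD1 i) //= lerDl.
  by apply: sumr_ge0 => k _; apply: sumr_ge0 => j _; exact: normc_ge0.
have hS : \sum_i normc ((A *m h) i 0) <= M * \sum_i normc (h i 0).
  rewrite /M mulr_suml; apply: ler_sum => i _; apply: (le_trans (hA i)).
  rewrite mulr_suml; apply: ler_sum => j _; rewrite ler_wpM2l ?normc_ge0 //.
  by rewrite (bigD1 j) //= lerDl; apply: sumr_ge0 => k _; exact: normc_ge0.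
have -> : \sum_i `|h i 0| = RC (\sum_i normc (h i 0)).
  by rewrite rmorph_sum /=; apply: eq_bigr => i _; rewrite normcE.
rewrite normcE -rmorphXn -rmorphM lecR hG mulmxDr.
apply: (le_trans (hB _ hM)); rewrite -mulrA ler_wpM2l // -exprMn.
rewrite ler_pXn2r // nnegrE ?mulr_ge0 //; by apply: sumr_ge0 => i _; exact: normc_ge0.
Qed.

End ThetaHolomorphic.

(** * Definable predicates *)

Section Definability.
Variable R : realType.
Local Notation C := R[i].

(* Quantifying over all ways [e] to name the variables makes weakening and renaming
   hold by construction. *)
Definition dterm (I : Type) (f : (I -> R) -> R) : Prop :=
  forall n (e : I -> 'I_n), exists t : term R n, forall x, Defs.eval x t = f (fun i => x 0 (e i)).

Definition dprd (I : Type) (P : (I -> R) -> Prop) : Prop :=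
  forall n (e : I -> 'I_n), exists phi : formula R n,
    forall x, Defs.holds phi x <-> P (fun i => x 0 (e i)).

Definition dfunC (I : Type) (f : (I -> R) -> C) : Prop :=
  dterm (fun v => complex.Re (f v)) /\ dterm (fun v => complex.Im (f v)).

Section Terms.
Variable I : Type.
Implicit Types f h : (I -> R) -> R.

Lemma dt_ext f h : (forall v, f v = h v) -> dterm f -> dterm h.
Proof. by move=> /funext ->. Qed.

Lemma dt_var i : dterm (fun v : I -> R => v i).
Proof. by move=> n e; exists (TVar R (e i)). Qed.

Lemma dt_cst c : dterm (fun _ : I -> R => c).
Proof. by move=> n e; exists (TConst n c). Qed.

Lemma dt_add f h : dterm f -> dterm h -> dterm (fun v => f v + h v).
Proof.
move=> hf hh n e; have [t ht] := hf n e; have [u hu] := hh n e.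
by exists (TAdd t u) => x /=; rewrite ht hu.
Qed.

Lemma dt_opp f : dterm f -> dterm (fun v => - f v).
Proof. by move=> hf n e; have [t ht] := hf n e; exists (TOpp t) => x /=; rewrite ht. Qed.

Lemma dt_mul f h : dterm f -> dterm h -> dterm (fun v => f v * h v).
Proof.
move=> hf hh n e; have [t ht] := hf n e; have [u hu] := hh n e.
by exists (TMul t u) => x /=; rewrite ht hu.
Qed.

Lemma dt_exp f : dterm f -> dterm (fun v => expR (f v)).
Proof. by move=> hf n e; have [t ht] := hf n e; exists (TExp t) => x /=; rewrite ht. Qed.

Lemma dt_sum (J : Type) (r : seq J) (f : J -> (I -> R) -> R) :
  (forall j, dterm (f j)) -> dterm (fun v => \sum_(j <- r) f j v).
Proof.
move=> hf; elim: r => [|j r IH].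
  by apply: dt_ext (dt_cst 0) => v; rewrite big_nil.
by apply: dt_ext (dt_add (hf j) IH) => v; rewrite big_cons.
Qed.

Lemma dt_an k (F : 'rV[R]_k -> R) (f : 'I_k -> (I -> R) -> R) :
  restricted_analytic F -> (forall j, dterm (f j)) -> dterm (fun v => F (\row_j f j v)).
Proof.
move=> hF hf n e.
have ht j : {t : term R n | forall x, Defs.eval x t = f j (fun i => x 0 (e i))}.
  by apply: cid; exact: hf.
exists (TAn hF (fun j => sval (ht j))) => x /=; congr F.
by apply/rowP => j; rewrite !mxE (svalP (ht j)).
Qed.

End Terms.

Section Complex.
Variable I : Type.
Implicit Types f h : (I -> R) -> C.

Lemma dC_real (f : (I -> R) -> R) : dterm f -> dfunC (fun v => real_complex R (f v)).
Proof. by move=> hf; split => //; exact: dt_cst. Qed.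

Lemma dC_cst c : dfunC (fun _ : I -> R => c).
Proof. by split; exact: dt_cst. Qed.

Lemma dC_add f h : dfunC f -> dfunC h -> dfunC (fun v => f v + h v).
Proof.
move=> [f1 f2] [h1 h2]; split.
  by apply: dt_ext (dt_add f1 h1) => v; rewrite raddfD.
by apply: dt_ext (dt_add f2 h2) => v; rewrite raddfD.
Qed.

Lemma dC_mul f h : dfunC f -> dfunC h -> dfunC (fun v => f v * h v).
Proof.
move=> [f1 f2] [h1 h2]; split.
  apply: dt_ext (dt_add (dt_mul f1 h1) (dt_opp (dt_mul f2 h2))) => v.
  by case: (f v) (h v) => a b [c d].
apply: dt_ext (dt_add (dt_mul f1 h2) (dt_mul f2 h1)) => v.
by case: (f v) (h v) => a b [c d].
Qed.

Lemma dC_sum (J : Type) (r : seq J) (f : J -> (I -> R) -> C) :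
  (forall j, dfunC (f j)) -> dfunC (fun v => \sum_(j <- r) f j v).
Proof.
move=> hf; split.
  by apply: dt_ext (dt_sum r (fun j => (hf j).1)) => v; rewrite raddf_sum.
by apply: dt_ext (dt_sum r (fun j => (hf j).2)) => v; rewrite raddf_sum.
Qed.

End Complex.

Section Predicates.
Variable I : Type.
Implicit Types P Q : (I -> R) -> Prop.

Lemma dp_iff P Q : (forall v, P v <-> Q v) -> dprd P -> dprd Q.
Proof. by move=> h hP n e; have [p hp] := hP n e; exists p => x; rewrite hp h. Qed.

Lemma dp_eq (f h : (I -> R) -> R) : dterm f -> dterm h -> dprd (fun v => f v = h v).
Proof.
move=> hf hh n e; have [t ht] := hf n e; have [u hu] := hh n e.
by exists (FEq t u) => x /=; rewrite ht hu.
Qed.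

Lemma dp_lt (f h : (I -> R) -> R) : dterm f -> dterm h -> dprd (fun v => f v < h v).
Proof.
move=> hf hh n e; have [t ht] := hf n e; have [u hu] := hh n e.
by exists (FLt t u) => x /=; rewrite ht hu.
Qed.

Lemma dp_not P : dprd P -> dprd (fun v => ~ P v).
Proof. by move=> hP n e; have [p hp] := hP n e; exists (FNot p) => x /=; rewrite hp. Qed.

Lemma dp_and P Q : dprd P -> dprd Q -> dprd (fun v => P v /\ Q v).
Proof.
move=> hP hQ n e; have [p hp] := hP n e; have [q hq] := hQ n e.
by exists (FAnd p q) => x /=; rewrite hp hq.
Qed.

Lemma dp_or P Q : dprd P -> dprd Q -> dprd (fun v => P v \/ Q v).
Proof.
move=> hP hQ; apply: dp_iff (dp_not (dp_and (dp_not hP) (dp_not hQ))) => v.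
by rewrite not_andE !notK.
Qed.

Lemma dp_imp P Q : dprd P -> dprd Q -> dprd (fun v => P v -> Q v).
Proof.
move=> hP hQ; apply: dp_iff (dp_or (dp_not hP) hQ) => v; split=> [[]//|h].
by have [p|p] := pselect (P v); [right; exact: h|left].
Qed.

Lemma dp_le (f h : (I -> R) -> R) : dterm f -> dterm h -> dprd (fun v => f v <= h v).
Proof.
move=> hf hh; apply: dp_iff (dp_not (dp_lt hh hf)) => v.
by rewrite leNgt; split=> /negP.
Qed.

Lemma dp_norm_le (f h : (I -> R) -> R) : dterm f -> dterm h -> dprd (fun v => `|f v| <= h v).
Proof.
move=> hf hh; apply: dp_iff (dp_and (dp_le (dt_opp hh) hf) (dp_le hf hh)) => v.
by rewrite ler_norml; split=> [[-> ->]|/andP].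
Qed.

Lemma dp_true : dprd (fun _ : I -> R => True).
Proof.
apply: (@dp_iff (fun=> 0 = 0 :> R)) => [v|]; first by split.
by apply: dp_eq; exact: dt_cst.
Qed.

Lemma dp_cst (A : Prop) : dprd (fun _ : I -> R => A).
Proof.
have [a|a] := pselect A; first by apply: dp_iff dp_true.
by apply: dp_iff (dp_not dp_true) => v; split=> // /(_ Logic.I).
Qed.

Lemma dp_eqC (f h : (I -> R) -> C) : dfunC f -> dfunC h -> dprd (fun v => f v = h v).
Proof.
move=> [f1 f2] [h1 h2]; apply: dp_iff (dp_and (dp_eq f1 h1) (dp_eq f2 h2)) => v.
by case: (f v) (h v) => a b [c d] /=; split=> [[-> ->]|[-> ->]].
Qed.

Lemma dp_all_seq (J : eqType) (r : seq J) (P : J -> (I -> R) -> Prop) :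
  (forall j, dprd (P j)) -> dprd (fun v => forall j, j \in r -> P j v).
Proof.
move=> hP; elim: r => [|j r IH]; first by apply: dp_iff dp_true.
apply: dp_iff (dp_and (hP j) IH) => v; split=> [[h1 h2] k|h].
  by rewrite inE => /orP[/eqP ->|/h2].
by split=> [|k kr]; apply: h; rewrite inE ?eqxx ?kr ?orbT.
Qed.

Lemma dp_all (J : finType) (P : J -> (I -> R) -> Prop) :
  (forall j, dprd (P j)) -> dprd (fun v => forall j, P j v).
Proof.
move=> hP; apply: dp_iff (dp_all_seq (enum J) hP) => v; split=> h j //.
by apply: h; rewrite mem_enum.
Qed.

Lemma dp_ex_fin (J : finType) (P : J -> (I -> R) -> Prop) :
  (forall j, dprd (P j)) -> dprd (fun v => exists j, P j v).
Proof.
move=> hP; apply: dp_iff (dp_not (dp_all (fun j => dp_not (hP j)))) => v.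
split=> [/existsNP[j /contrapT]|[j hj] h]; [by exists j|exact: h j hj].
Qed.

End Predicates.

(** [None] names the bound variable, which becomes number 0 under [FEx]. *)
Lemma dp_ex1 (I : Type) (P : (I -> R) -> R -> Prop) :
  dprd (fun s : option I -> R => P (fun i => s (Some i)) (s None)) ->
  dprd (fun v => exists r, P v r).
Proof.
move=> h n e; pose e' o : 'I_(1 + n) := if o is Some i then rshift 1 (e i) else lshift n ord0.
have [p hp] := h _ e'; exists (FEx p) => x /=.
have E r : (fun i : I => row_mx r%:M x 0 (e' (Some i))) = (fun i => x 0 (e i)).
  by apply/funext => i; rewrite /= row_mxEr.
have E0 r : row_mx r%:M x 0 (e' None) = r by rewrite /= row_mxEl mxE eqxx mulr1n.
by split=> -[r hr]; exists r; move: hr; rewrite hp E E0.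
Qed.

Lemma dp_ren (I J : Type) (h : I -> J) (P : (I -> R) -> Prop) :
  dprd P -> dprd (fun v : J -> R => P (fun i => v (h i))).
Proof. by move=> hP n e; exact: (hP n (e \o h)). Qed.

Lemma dp_exn (I : Type) k (P : (I -> R) -> ('I_k -> R) -> Prop) :
  dprd (fun s : I + 'I_k -> R => P (fun i => s (inl i)) (fun j => s (inr j))) ->
  dprd (fun v => exists w, P v w).
Proof.
elim: k I P => [|k IH] I P h.
  have k : 'I_0 -> I by case.
  have := dp_ren (fun s : I + 'I_0 => match s with inl i => i | inr j => k j end) h.
  apply: dp_iff => v; split=> [hv|[w]]; first by exists (fun j => v (k j)).
  by have -> : w = (fun j => v (k j)) by apply/funext => -[].
pose cons (r : R) (w : 'I_k -> R) (j : 'I_k.+1) := if unlift ord0 j is Some j' then w j' else r.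
apply: (@dp_iff _ (fun v => exists w r, P v (cons r w))) => [v|].
  split=> [[w [r hr]]|[w hw]]; first by exists (cons r w).
  exists (fun j => w (lift ord0 j)), (w ord0).
  suff -> : cons (w ord0) (fun j => w (lift ord0 j)) = w by [].
  by apply/funext => j; rewrite /cons; case: unliftP => [j' ->|->].
apply: IH; apply: dp_ex1.
pose m (s : I + 'I_k.+1) : option (I + 'I_k) := match s with inl i => Some (inl i)
  | inr j => if unlift ord0 j is Some j' then Some (inr j') else None end.
have := dp_ren m h; congr dprd; apply/funext => s; congr (P _ _).
by apply/funext => j; rewrite /m /cons; case: unlift.
Qed.

Lemma dp_ex (I : Type) (J : finType) (P : (I -> R) -> (J -> R) -> Prop) :
  dprd (fun s : I + J -> R => P (fun i => s (inl i)) (fun j => s (inr j))) ->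
  dprd (fun v => exists w, P v w).
Proof.
move=> h; apply: (@dp_iff _ (fun v => exists w : 'I_#|J| -> R, P v (fun j => w (enum_rank j)))).
  move=> v; split=> [[w hw]|[w hw]]; first by exists (fun j => w (enum_rank j)).
  exists (fun i => w (enum_val i)); suff -> : (fun j => w (enum_val (enum_rank j))) = w by [].
  by apply/funext => j; rewrite enum_rankK.
apply: dp_exn; pose m (s : I + J) : I + 'I_#|J| := match s with inl i => inl i
  | inr j => inr (enum_rank j) end.
exact: (dp_ren m h).
Qed.

Lemma dprd_definable n (P : ('I_n -> R) -> Prop) :
  dprd P -> definable [set x : 'rV[R]_n | P (fun i => x 0 i)].
Proof.
move=> h; have [phi hphi] := h n id; exists phi.
by apply/seteqP; split=> x /=; rewrite hphi.
Qed.

End Definability.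

(** * Series of products of analytic functions *)

Section AnalyticSeries.
Variable R : realType.
Local Notation C := R[i].
Local Notation normc := (@Normc.normc R).
Local Notation RC := (real_complex R).

Lemma hsum_Re (I : choiceType) (f : I -> C) s :
  hsum f s -> hsum (fun i => RC (complex.Re (f i))) (RC (complex.Re s)).
Proof.
move=> h e e0; have [A hA] := h e e0; exists A => B /hA.
apply: le_lt_trans; rewrite -rmorph_sum -rmorphB normc_real /=.
have -> : \sum_(i <- B) complex.Re (f i) - complex.Re s = complex.Re (\sum_(i <- B) f i - s).
  by rewrite raddfB raddf_sum.
by have [] := normc_ReIm_le (\sum_(i <- B) f i - s).
Qed.

Lemma hsum_Im (I : choiceType) (f : I -> C) s :
  hsum f s -> hsum (fun i => RC (complex.Im (f i))) (RC (complex.Im s)).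
Proof.
move=> h e e0; have [A hA] := h e e0; exists A => B /hA.
apply: le_lt_trans; rewrite -rmorph_sum -rmorphB normc_real /=.
have -> : \sum_(i <- B) complex.Im (f i) - complex.Im s = complex.Im (\sum_(i <- B) f i - s).
  by rewrite raddfB raddf_sum.
by have [] := normc_ReIm_le (\sum_(i <- B) f i - s).
Qed.

Section Expansion.
Variables (d : nat) (I : choiceType) (u : I -> 'I_d -> R -> C).

Definition prodsum (y : 'rV[R]_d) : C := tsum (fun n => \prod_i u n i (y 0 i)).

(** Normal convergence with a common radius: each factor has a power series with majorant [U], and
    the products of the majorants are summable. This permits multiplying out and reordering into one
    multivariate power series. *)
Definition expandable (x : 'rV[R]_d) : Prop :=
  exists (delta : R) (cf : I -> 'I_d -> nat -> C) (U : I -> 'I_d -> R) (B : R),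
  [/\ 0 < delta, forall n i, abs_bounded (fun k => cf n i k * RC (delta ^+ k)) (U n i),
      forall n i t, `|t - x 0 i| < delta ->
        hsum (fun k => cf n i k * RC ((t - x 0 i) ^+ k)) (u n i t)
    & abs_bounded (fun n => RC (\prod_i U n i)) B].

Lemma expandable_hsum x : expandable x -> exists c : {ffun 'I_d -> nat} -> C,
  nbhs x [set y : 'rV[R]_d |
    hsum (fun a => c a * RC (\prod_i (y 0 i - x 0 i) ^+ a i)) (prodsum y)].
Proof.
move=> [dl [cf [U [B [dl0 hU hu hB]]]]].
have U0 n i : 0 <= U n i := abs_bounded_ge0 (hU n i).
have bnd (t : 'I_d -> R) : (forall i, `|t i| <= dl) ->
    abs_bounded (fun p : I * {ffun 'I_d -> nat} => \prod_i (cf p.1 i (p.2 i) * RC (t i ^+ p.2 i))) B.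
  move=> ht; apply: (abs_bounded_pair (b := fun n => \prod_i U n i)) hB => n.
  apply: (abs_bounded_ffun (f := fun i k => cf n i k * RC (t i ^+ k))) => i A.
  apply: le_trans (hU n i A).
  apply: ler_sum => k _; rewrite !Normc.normcM ler_wpM2l ?normc_ge0 // !normc_real !normrX.
  by rewrite (ger0_norm (ltW dl0)); apply: lerXn2r; rewrite ?nnegrE ?normr_ge0 ?(ltW dl0) ?ht.
have cb (a : {ffun 'I_d -> nat}) : exists B', abs_bounded (fun n => \prod_i cf n i (a i)) B'.
  have h := bnd (fun=> dl) (fun i => eq_ind_r (fun z => z <= dl) (lexx dl) (gtr0_norm dl0)).
  pose P := \prod_i dl ^+ a i; have P0 : 0 < P by apply: prodr_gt0 => i _; exact: exprn_gt0.
  exists (P^-1 * B).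
  have h' : abs_bounded (fun n => \prod_i (cf n i (a i) * RC (dl ^+ a i))) B.
    have inj : injective (fun n : I => (n, a)) by move=> n n' [].
    exact: (abs_bounded_comp inj h).
  move=> A; have hA := h' A.
  have -> : \sum_(n <- A) normc (\prod_i cf n i (a i)) =
     P^-1 * \sum_(n <- A) normc (\prod_i (cf n i (a i) * RC (dl ^+ a i))).
    rewrite mulr_sumr; apply: eq_bigr => n _; rewrite big_split /= Normc.normcM.
    rewrite -rmorph_prod normc_real -/P (gtr0_norm P0) mulrC mulfK //; exact: lt0r_neq0.
  by apply: ler_wpM2l hA; rewrite invr_ge0 ltW.
exists (fun a => tsum (fun n => \prod_i cf n i (a i))).
apply/nbhs_ballP; exists dl => //= y [_ hy].
have hy' i : `|y 0 i - x 0 i| < dl by rewrite distrC; exact: hy.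
have hG := bnd (fun i => y 0 i - x 0 i) (fun i => ltW (hy' i)).
pose G (p : I * {ffun 'I_d -> nat}) := \prod_i (cf p.1 i (p.2 i) * RC ((y 0 i - x 0 i) ^+ p.2 i)).
have [s hs] := hsum_exists hG.
have h1 : hsum (fun n => \prod_i u n i (y 0 i)) s.
  apply: (hsum_sigma (F := G) hs) => n; rewrite /G /=.
  apply: (hsum_ffun (f := fun i k => cf n i k * RC ((y 0 i - x 0 i) ^+ k)) (B := U n)) => i.
    move=> A; apply: le_trans (hU n i A).
    apply: ler_sum => k _; rewrite !Normc.normcM ler_wpM2l ?normc_ge0 // !normc_real !normrX.
    by rewrite (ger0_norm (ltW dl0)); apply: lerXn2r; rewrite ?nnegrE ?normr_ge0 ?ltW.
  exact: hu.
rewrite /prodsum /= (tsumE h1).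
pose sw (p : {ffun 'I_d -> nat} * I) := (p.2, p.1).
pose sw' (p : I * {ffun 'I_d -> nat}) := (p.2, p.1).
have hs' : hsum (G \o sw) s by apply: (hsum_reindex (h' := sw')) hs => -[].
apply: (hsum_sigma hs') => a; rewrite /G /=.
have [B' hB'] := cb a; have := hsumZ (RC (\prod_i (y 0 i - x 0 i) ^+ a i)) (tsumP hB').
rewrite mulrC; apply: hsum_ext => n /=; rewrite big_split /= mulrC; congr (_ * _).
by rewrite rmorph_prod.
Qed.

Lemma expandable_analytic x : expandable x ->
  analytic_at (fun y => complex.Re (prodsum y)) x /\ analytic_at (fun y => complex.Im (prodsum y)) x.
Proof.
move=> /expandable_hsum[c hc].
have ReM (w : C) (r : R) : complex.Re (w * RC r) = complex.Re w * r.
  by case: w => a b /=; rewrite mulr0 subr0.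
have ImM (w : C) (r : R) : complex.Im (w * RC r) = complex.Im w * r.
  by case: w => a b /=; rewrite mulr0 add0r.
split.
- exists (fun a => complex.Re (c a)); apply: filterS hc => y /= /hsum_Re h.
  by apply: hsum_totally; apply: hsum_ext h => a; rewrite ReM.
- exists (fun a => complex.Im (c a)); apply: filterS hc => y /= /hsum_Im h.
  by apply: hsum_totally; apply: hsum_ext h => a; rewrite ImM.
Qed.

Definition restr (lo hi : 'rV[R]_d) (f : 'rV[R]_d -> R) (y : 'rV[R]_d) : R :=
  if `[< Defs.box lo hi y >] then f y else 0.

Lemma restr_analytic lo hi (W : set 'rV[R]_d) : open W -> Defs.box lo hi `<=` W ->
  (forall x, W x -> expandable x) ->
  restricted_analytic (restr lo hi (fun y => complex.Re (prodsum y))) /\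
  restricted_analytic (restr lo hi (fun y => complex.Im (prodsum y))).
Proof.
move=> oW sW hW; split.
- exists (fun y => complex.Re (prodsum y)), lo, hi, W; split=> //.
  + by move=> x /hW /expandable_analytic[].
  + by move=> x bx; rewrite /restr; case: asboolP.
  + by move=> x bx; rewrite /restr; case: asboolP.
- exists (fun y => complex.Im (prodsum y)), lo, hi, W; split=> //.
  + by move=> x /hW /expandable_analytic[].
  + by move=> x bx; rewrite /restr; case: asboolP.
  + by move=> x bx; rewrite /restr; case: asboolP.
Qed.

End Expansion.

Lemma hsum_nat_finite (f : nat -> C) N : (forall k, (N <= k)%N -> f k = 0) ->
  hsum f (\sum_(0 <= k < N) f k).
Proof.
move=> h e e0; exists [fset i in iota 0 N]%fset => A AN.
rewrite (big_fsetID _ (mem [fset i in iota 0 N]%fset) A) /=.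
rewrite [X in _ + X - _]big1_seq => [|k /=]; last first.
  rewrite !inE /= mem_iota leq0n add0n => /andP[_]; rewrite -leqNgt; exact: h.
rewrite addr0.
have -> : [fset x in A | mem [fset i in iota 0 N]%fset x]%fset = [fset i in iota 0 N]%fset.
  by apply/fsetP => k; rewrite !inE /=; apply: andb_idl => kN; apply: (fsubsetP AN); rewrite inE.
by rewrite sum_fset_iota subrr Normc.normc0.
Qed.

Lemma sum_nat_support (F : nat -> R) N (A : {fset nat}) : (forall k, 0 <= F k) ->
  (forall k, (N <= k)%N -> F k = 0) -> \sum_(k <- A) F k <= \sum_(0 <= k < N) F k.
Proof.
move=> F0 FN; pose B := [fset i in iota 0 N]%fset.
apply: (le_trans (sum_fset_le F0 (fsubsetUl A B))).
rewrite (big_fsetID _ (mem B)) /= [X in _ + X <= _]big1_seq => [|k /=]; last first.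
  rewrite !inE /= mem_iota leq0n add0n => /andP[_]; rewrite -leqNgt; exact: FN.
have -> : [fset x in (A `|` B)%fset | mem B x]%fset = B.
  by apply/fsetP => k; rewrite !inE /=; apply: andb_idl => ->; rewrite orbT.
by rewrite sum_fset_iota addr0.
Qed.

Lemma monomial_expand (x delta : R) (e : nat) : 0 <= delta ->
  let cf k := RC (x ^+ (e - k) *+ 'C(e, k)) in
  abs_bounded (fun k => cf k * RC (delta ^+ k)) ((`|x| + delta) ^+ e) /\
  forall t, hsum (fun k => cf k * RC ((t - x) ^+ k)) (RC (t ^+ e)).
Proof.
move=> d0 cf; have cf0 k : (e < k)%N -> cf k = 0.
  by move=> h; rewrite /cf bin_small // mulr0n rmorph0.
split=> [A|t].
  rewrite exprDn.
  apply: (le_trans (sum_nat_support (N := e.+1) A _ _)) => [k|k ke|].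
  - exact: normc_ge0.
  - by rewrite cf0 // mul0r Normc.normc0.
  rewrite big_mkord; apply: ler_sum => k _.
  by rewrite Normc.normcM !normc_real normrMn !normrX (ger0_norm d0) mulrnAl.
have := hsum_nat_finite (f := fun k => cf k * RC ((t - x) ^+ k)) (N := e.+1).
move=> /(_ _) h; have := h _; have -> : RC (t ^+ e) = \sum_(0 <= k < e.+1) cf k * RC ((t - x) ^+ k).
  rewrite big_mkord -{1}(subrK x t) addrC exprDn rmorph_sum /=; apply: eq_bigr => k _.
  by rewrite -rmorphM mulrnAl.
by apply => k ke; rewrite cf0 // mul0r.
Qed.

Lemma phase_expand (x delta phi : R) : 0 <= delta ->
  let cf k := cexp ('i%C * RC (phi * x)) * ('i%C * RC phi) ^+ k / k`!%:R in
  abs_bounded (fun k => cf k * RC (delta ^+ k)) (expR (`|phi| * delta)) /\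
  forall t, hsum (fun k => cf k * RC ((t - x) ^+ k)) (cexp ('i%C * RC (phi * t))).
Proof.
move=> d0 cf; split=> [A|t].
  have := abs_bounded_exp (`|phi| * delta) A; rewrite (@ger0_norm _ (_ * _)) ?mulr_ge0 //.
  apply: le_trans; apply: ler_sum => k _; rewrite /cf !Normc.normcM normc_cexp.
  rewrite normcX Normc.normcM Normc.normcV -(rmorph_nat RC) !normc_real.
  have -> : normc 'i%C = 1 :> R by rewrite /= expr0n expr1n add0r sqrtr1.
  have -> : complex.Re ('i%C * RC (phi * x)) = 0 by rewrite /= !mul0r mul1r subrr.
  rewrite expR0 !mul1r !(normrM, normrX, normfV) normr_id (ger0_norm d0).
  by rewrite exprMn mulrAC.
have -> : cexp ('i%C * RC (phi * t)) = cexp ('i%C * RC (phi * x)) * cexp ('i%C * RC (phi * (t - x))).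
  by rewrite -cexpD -mulrDr -rmorphD /= -mulrDr addrC subrK.
apply: hsum_ext (hsumZ _ (hsum_cexp_imag (phi * (t - x)))) => k.
rewrite /cf; move: (cexp ('i%C * RC (phi * x))) => a.
have -> : RC (phi * (t - x)) = RC phi * RC (t - x) by rewrite rmorphM.
have -> : RC ((t - x) ^+ k) = RC (t - x) ^+ k by rewrite rmorphXn.
move: (RC phi) (RC (t - x)) 'i%C (k`!%:R)^-1 => b c i f.
by rewrite !exprMn; ring.
Qed.

End AnalyticSeries.

(** * Theta functions as restricted analytic functions *)

Section ThetaDefinable.
Variables (R : realType) (g : nat).
Local Notation C := R[i].
Local Notation normc := (@Normc.normc R).
Local Notation RC := (real_complex R).
Local Notation ZV := 'cV[int]_g.
Local Notation Pr := ('I_g * 'I_g)%type.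

(* The linear forms [w_i], [w_i + w_j] for [i < j], and [w_j - w_i] for [i < j], whose squares
   span the quadratic forms. *)
Definition lform (T : zmodType) (al : Pr) (w : 'cV[T]_g) : T :=
  if al.1 == al.2 then w al.1 0
  else if (al.1 < al.2)%N then w al.1 0 + w al.2 0 else w al.1 0 - w al.2 0.

Lemma lformD (T : zmodType) al (u w : 'cV[T]_g) : lform al (u + w) = lform al u + lform al w.
Proof.
rewrite /lform !mxE; case: ifP => // _; case: ifP => _; first by rewrite addrACA.
by rewrite opprD addrACA.
Qed.

Lemma lform_iv al (n : ZV) : lform al (iv R n) = (lform al n)%:~R.
Proof.
rewrite /lform; case: ifP => _; first by rewrite mxE.
by case: ifP => _; rewrite !mxE ?intrB ?intrD.
Qed.

Lemma lform_norm al (w : 'cV[R]_g) M : (forall i, `|w i 0| <= M) -> `|lform al w| <= 2 * M.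
Proof.
move=> h; have M0 := le_trans (normr_ge0 _) (h al.1).
have h1 := h al.1; have h2 := h al.2.
rewrite /lform; case: ifP => _; first lra.
case: ifP => _; first by apply: (le_trans (ler_normD _ _)); lra.
by apply: (le_trans (ler_normB _ _)); lra.
Qed.

(** [lam] serves as coordinates on symmetric matrices: the form of [ymx lam] is the sum of the
    squares of the [lform al] with coefficients [lam]. Tame imaginary parts admit coordinates that
    are all at least one ([tame_taum]). *)
Definition ymx (lam : Pr -> R) : 'M[R]_g :=
  \matrix_(i, j) \sum_al lam al * lform al (delta_mx i 0) * lform al (delta_mx j 0).

Lemma lform_sum al (w : 'cV[R]_g) : lform al w = \sum_i lform al (delta_mx i 0) * w i 0.
Proof.
have d i j : (delta_mx i 0 : 'cV[R]_g) j 0 = (j == i)%:R by rewrite mxE andbT.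
have s j : \sum_i ((delta_mx i 0 : 'cV[R]_g) j 0 * w i 0) = w j 0.
  rewrite (bigD1 j) //= d eqxx mul1r big1 ?addr0 // => i ij.
  by rewrite d eq_sym (negPf ij) mul0r.
rewrite /lform; case: ifP => _; first by rewrite s.
case: ifP => _; under [RHS]eq_bigr do rewrite ?mulrDl ?mulNr; rewrite big_split /= s.
  by rewrite s.
by rewrite sumrN s.
Qed.

Lemma ymx_bilin lam (u w : 'cV[R]_g) :
  (u^T *m ymx lam *m w) 0 0 = \sum_al lam al * lform al u * lform al w.
Proof.
rewrite mxE; under eq_bigr => j _.
  rewrite mxE mulr_suml; under eq_bigr => i _ do rewrite !mxE mulr_sumr mulr_suml.
  rewrite exchange_big /=; over.
rewrite exchange_big /=; apply: eq_bigr => al _.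
rewrite [lform al u]lform_sum [lform al w]lform_sum mulr_sumr.
apply: eq_bigr => j _; rewrite mulr_sumr !mulr_suml; apply: eq_bigr => i _; ring.
Qed.

Definition taum (lam xx : Pr -> R) : 'M[C]_g := \matrix_(i, j) Complex (xx (i, j)) (ymx lam i j).

Lemma imx_taum lam xx : imx (taum lam xx) = ymx lam.
Proof. by apply/matrixP => i j; rewrite mxE [taum _ _ _ _]mxE. Qed.

Lemma taum_growth lam xx : (forall al, 1 <= lam al) -> growth (taum lam xx).
Proof.
move=> hl; exists 1 => // w; rewrite mul1r imx_taum /qf ymx_bilin.
have l0 al : 0 <= lam al by rewrite (le_trans ler01).
apply: (@le_trans _ _ (\sum_al (if al.1 == al.2 then w al.1 0 ^+ 2 else 0))).
  rewrite -(pair_bigA _ (fun i j => if i == j then w i 0 ^+ 2 else 0)) /=.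
  rewrite /sumsq; apply: ler_sum => i _; rewrite (bigD1 i) //= eqxx lerDl.
  by apply: sumr_ge0 => j ij; rewrite eq_sym (negPf ij).
apply: ler_sum => al _; rewrite -mulrA -expr2; case: ifP => h.
  by rewrite /lform h ler_peMl ?sqr_ge0.
by rewrite mulr_ge0 ?sqr_ge0.
Qed.

(** The two kinds of factors in a theta term: powers of bounded exponentials, and phases, which are
    entire. *)
Definition ufun (k : nat + R) (y : R) : C :=
  match k with inl e => RC (y ^+ e) | inr phi => cexp ('i%C * RC (phi * y)) end.

Definition ubd (k : nat + R) (x d : R) : R :=
  match k with inl e => (`|x| + d) ^+ e | inr phi => expR (`|phi| * d) end.

Lemma ufun_expand k x d : 0 <= d -> exists cf : nat -> C,
  abs_bounded (fun j => cf j * RC (d ^+ j)) (ubd k x d) /\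
  forall t, hsum (fun j => cf j * RC ((t - x) ^+ j)) (ufun k t).
Proof.
move=> d0; case: k => [e|phi] /=.
  by eexists; exact: (monomial_expand x e d0).
by eexists; exact: (phase_expand x phi d0).
Qed.

Variable P : nat.

(* Bounded coordinates for the theta series: for each linear form the three exponentials
   [s], [t], [t'], then the entries of the real part and the phases. *)
Local Notation V := ((Pr + (Pr + Pr)) + (Pr + ('I_g + unit)))%type.

Definition dP (k : nat) : nat := ((k - P) + (P - k))%N.

Definition lz (al : Pr) (n : ZV) : int := lform al n.

(** For [l = lform al n >= 0] one has [(l + rho)^2 = (l - P)^2 + 2 l (P + rho) + rho^2 - P^2]; for
    [l < 0] the same holds with [|l|] and [P - rho]. When [P >= |rho|] the exponents are natural
    numbers and the bases [s], [t], [t'] are at most one, whatever the sign of [rho]. *)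
Definition kind (n : ZV) (v : V) : nat + R :=
  match v with
  | inl (inl al) => inl (dP (absz (lz al n)) ^ 2)%N
  | inl (inr (inl al)) => inl (if (0 <= lz al n)%R then 2 * absz (lz al n) else 0)%N
  | inl (inr (inr al)) => inl (if (0 <= lz al n)%R then 0 else 2 * absz (lz al n))%N
  | inr (inl al) => inr (3 * pi * (n al.1 0)%:~R * (n al.2 0)%:~R)
  | inr (inr (inl i)) => inr (2 * pi * (n i 0)%:~R)
  | inr (inr (inr _)) => inr (2 * pi)
  end.

(** On the closed box the exponentials are at most [exp (-1)] and 1; these bounds leave room for an
    open neighbourhood. Growth of [t] and [t'] beyond 1 is paid for by the power [(|l| - P)^2] of
    [s]. *)
Definition vbd (v : V) : option R :=
  match v with
  | inl (inl _) => Some (expR (- 2^-1))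
  | inl (inr _) => Some (expR 1)
  | inr _ => None
  end.

Lemma dPE k : (dP k ^ 2)%:R = (k%:R - P%:R) ^+ 2 :> R.
Proof.
rewrite natrX /dP; case: (leqP k P) => h.
  by rewrite (eqP h) add0n natrB // -sqrrN opprB.
by rewrite (eqP (ltnW h)) addn0 natrB // ltnW.
Qed.

Lemma kind_bound : exists (d0 M : R), 0 < d0 /\
  forall (x : V -> R) d n, 0 <= d <= d0 ->
   (forall v b, vbd v = Some b -> `|x v| + d <= b) ->
   \prod_v ubd (kind n v) (x v) d <= expR M * expR (- l1 R n).
Proof.
have p0 := pi_gt0 R.
(* The value of [quad_bound] for [- l^2 / 4 + (P + 4) l]. The coefficient collects [P] from the
   square, 2 from the powers of [t] and [t'], and 2 for the linear phases together with the final
   [expR (- l1 n)]. *)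
pose M1 : R := 4 * (P%:R + 4) ^+ 2.
have G0 : 0 < 12 * pi * g.+1%:R :> R by rewrite mulr_gt0 ?ltr0n // mulr_gt0.
(* At radius [d] the quadratic phases cost at most [3 pi d g] times the sum of the squares of the
   entries of [n]; this has to stay below a quarter. The added 1 is for the constant phase. *)
exists (12 * pi * g.+1%:R)^-1, (M1 *+ #|{: Pr}| + 1); split; first by rewrite invr_gt0.
move=> x d n /andP[d0 dd] hx.
have dg : 12 * (pi * d * g.+1%:R) <= 1.
  have := ler_wpM2r (ltW G0) dd; rewrite mulVf ?gt_eqF // => h; lra.
have pd0 : 0 <= pi * d by rewrite mulr_ge0 // ltW.
have g1 : 1 <= g.+1%:R :> R by rewrite ler1n.
have pd1 : 2 * (pi * d) <= 1.
  have : pi * d * 1 <= pi * d * g.+1%:R by rewrite ler_wpM2l. lra.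
pose l al : R := (absz (lz al n))%:R.
pose N i : R := `|n i 0|%:~R.
have N0 i : 0 <= N i by rewrite ler0z.
have NE i : `|(n i 0)%:~R| = N i by rewrite -intr_norm.
pose q := pi * d * g%:R.
have q4 : 3 * q <= 4^-1.
  have : q <= pi * d * g.+1%:R by rewrite /q ler_wpM2l // ler_nat. lra.
have q0 : 0 <= q by rewrite mulr_ge0 // ler0n.
pose ex (v : V) : R := match v with
  | inl (inl al) => - (2^-1 * (l al - P%:R) ^+ 2)
  | inl (inr (inl al)) => if 0 <= lz al n then 2 * l al else 0
  | inl (inr (inr al)) => if 0 <= lz al n then 0 else 2 * l al
  | inr (inl al) => 3 * (pi * d) * (N al.1 * N al.2)
  | inr (inr (inl i)) => 2 * (pi * d) * N i
  | inr (inr (inr _)) => 2 * (pi * d)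
  end.
have h1 v : 0 <= ubd (kind n v) (x v) d <= expR (ex v).
  apply/andP; split.
    by case: (kind n v) => [e|phi] /=; [rewrite exprn_ge0 // addr_ge0|exact: expR_ge0].
  have mono b e (bE : `|x v| + d <= b) : (`|x v| + d) ^+ e <= b ^+ e.
    by apply: lerXn2r => //; rewrite nnegrE ?addr_ge0 // (le_trans _ bE) // addr_ge0.
  case: v mono (hx v) => [[al|[al|al]]|[al|[i|[]]]] /= mono hv.
  - apply: (le_trans (mono _ _ (hv _ erefl))); rewrite -expRM_natl ler_expR dPE -/(l al).
    by move: (_ ^+ 2) => z; lra.
  - apply: (le_trans (mono _ _ (hv _ erefl))); rewrite -expRM_natl ler_expR.
    by case: ifP => _; rewrite ?natrM mulr1.
  - apply: (le_trans (mono _ _ (hv _ erefl))); rewrite -expRM_natl ler_expR.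
    by case: ifP => _; rewrite ?natrM mulr1.
  - rewrite ler_expR !normrM !NE (ger0_norm (ltW p0)) (@ger0_norm _ 3) //.
    by rewrite le_eqVlt; apply/orP; left; apply/eqP; ring.
  - rewrite ler_expR !normrM !NE (ger0_norm (ltW p0)) (@ger0_norm _ 2) //.
    by rewrite le_eqVlt; apply/orP; left; apply/eqP; ring.
  - by rewrite ler_expR !normrM (ger0_norm (ltW p0)) (@ger0_norm _ 2) // mulrA.
apply: (@le_trans _ _ (\prod_v expR (ex v))); first by apply: ler_prod => v _; exact: h1.
rewrite -expR_sum -expRD ler_expR !big_sumType /= [X in _ + (_ + (_ + X))]big_const.
rewrite card_unit /= addr0.
have -> : \sum_al - (2^-1 * (l al - P%:R) ^+ 2) + (\sum_al (if 0 <= lz al n then 2 * l al else 0)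
    + \sum_al (if 0 <= lz al n then 0 else 2 * l al)) =
   \sum_al (- (2^-1 * (l al - P%:R) ^+ 2) + 2 * l al).
  rewrite -!big_split /=; apply: eq_bigr => al _; congr (_ + _).
  by case: ifP; rewrite ?addr0 ?add0r.
have sq : \sum_al 3 * (pi * d) * (N al.1 * N al.2) <= \sum_i 3 * q * N i ^+ 2.
  rewrite -(pair_bigA _ (fun i j => 3 * (pi * d) * (N i * N j))) /=.
  apply: (@le_trans _ _ (\sum_i \sum_j 3 * (pi * d) * (2^-1 * (N i ^+ 2) + 2^-1 * (N j ^+ 2)))).
    apply: ler_sum => i _; apply: ler_sum => j _; apply: ler_wpM2l; first by rewrite mulr_ge0.
    by have := sqr_ge0 (N i - N j); rewrite sqrrB; lra.
  under [leLHS]eq_bigr => i _ do rewrite -mulr_sumr big_split /= sumr_const card_ord -mulr_sumr.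
  rewrite -mulr_sumr big_split /= sumr_const card_ord sumrMnl -mulr_sumr -mulr_sumr.
  move: (\sum_(i < g) N i ^+ 2) => S.
  have -> : 2^-1 * S *+ g = g%:R * (2^-1 * S) by rewrite mulr_natl.
  by rewrite /q le_eqVlt; apply/orP; left; apply/eqP; field.
have diag : \sum_i (3 * q * N i ^+ 2 + (2 * (pi * d) + 1) * N i) =
    \sum_al (if al.1 == al.2 then 3 * q * N al.1 ^+ 2 + (2 * (pi * d) + 1) * N al.1 else 0).
  rewrite -(pair_bigA _ (fun i j => if i == j then 3 * q * N i ^+ 2 + (2 * (pi * d) + 1) * N i else 0)) /=.
  apply: eq_bigr => i _; rewrite (bigD1 i) //= eqxx big1 ?addr0 // => j ij.
  by rewrite eq_sym (negPf ij).
have l1E : l1 R n = \sum_i N i by [].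
have key al : - (2^-1 * (l al - P%:R) ^+ 2) + 2 * l al +
   (if al.1 == al.2 then 3 * q * N al.1 ^+ 2 + (2 * (pi * d) + 1) * N al.1 else 0) <= M1.
  have l0 : 0 <= l al by rewrite ler0n.
  have P0 : 0 <= P%:R :> R by rewrite ler0n.
  have i4 : 0 < 4^-1 :> R by rewrite invr_gt0.
  have := quad_bound (P%:R + 4) (l al) i4; rewrite invrK [_ * 4]mulrC -/M1 => qb.
  have l2 := sqr_ge0 (l al); have P2 := sqr_ge0 (P%:R : R).
  case: ifP => h; last first.
    have Pl : 0 <= P%:R * l al by rewrite mulr_ge0.
    by rewrite sqrrB; lra.
  have -> : N al.1 = l al.
    by rewrite /N /l /lz /lform h -abszE.
  have e1 : 3 * q * l al ^+ 2 <= 4^-1 * l al ^+ 2 by rewrite ler_wpM2r.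
  have e2 : (2 * (pi * d) + 1) * l al <= 2 * l al by rewrite ler_wpM2r //; lra.
  by rewrite sqrrB; lra.
have tot : \sum_al (- (2^-1 * (l al - P%:R) ^+ 2) + 2 * l al) +
    \sum_i (3 * q * N i ^+ 2 + (2 * (pi * d) + 1) * N i) <= M1 *+ #|{: Pr}|.
  rewrite diag -big_split /=; apply: (le_trans (ler_sum _ (fun al _ => key al))).
  by rewrite sumr_const.
have t2 : \sum_i (3 * q * N i ^+ 2 + (2 * (pi * d) + 1) * N i) =
    \sum_i 3 * q * N i ^+ 2 + (2 * (pi * d) + 1) * l1 R n.
  by rewrite l1E mulr_sumr -big_split.
have t3 : \sum_(i < g) 2 * (pi * d) * N i = 2 * (pi * d) * l1 R n.
  by rewrite l1E mulr_sumr.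
rewrite t2 in tot; rewrite t3; lra.
Qed.

Local Notation d := #|{: V}|.

Definition series (y : 'rV[R]_d) : C :=
  prodsum (fun (n : ZV) (i : 'I_d) => ufun (kind n (enum_val i))) y.

Definition open_box : set 'rV[R]_d :=
  [set y | forall i b, vbd (enum_val i) = Some b -> `|y 0 i| < b].

Lemma open_box_room (y : 'rV[R]_d) : open_box y ->
  exists2 e : R, 0 < e & forall i b, vbd (enum_val i) = Some b -> `|y 0 i| + e <= b.
Proof.
move=> hy.
have hi (i : 'I_d) : {e : R | 0 < e & forall b, vbd (enum_val i) = Some b -> `|y 0 i| + e <= b}.
  apply: cid2; case E : (vbd (enum_val i)) => [b|]; last by exists 1.
  exists (b - `|y 0 i|); first by rewrite subr_gt0; exact: hy E.
  by move=> b' [<-]; rewrite addrC subrK.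
exists (\big[Num.min/1]_i s2val (hi i)).
  by apply: lt_bigmin => // i _; exact: s2valP (hi i).
move=> i b E; apply: le_trans (s2valP' (hi i) b E).
by rewrite lerD2l; apply: bigmin_le_cond.
Qed.

Lemma open_boxP : open open_box.
Proof.
rewrite openE => y hy; rewrite /interior.
have [e e0 he] := open_box_room hy.
apply/nbhs_ballP; exists e => //= w [_ hw] i b E.
have := hw 0 i; rewrite /ball /= => hwi.
apply: lt_le_trans (he i b E); have -> : w 0 i = y 0 i - (y 0 i - w 0 i) by rewrite opprB addrC subrK.
by apply: (le_lt_trans (ler_normB _ _)); rewrite ltrD2l.
Qed.

Lemma series_expandable y : open_box y ->
  expandable (fun (n : ZV) (i : 'I_d) => ufun (kind n (enum_val i))) y.
Proof.
move=> hy; have [e0 [M [e00 hM]]] := kind_bound.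
have [e1 e10 he] := open_box_room hy.
pose e := Num.min e0 e1; have epos : 0 < e by rewrite lt_min e00.
have hcf (n : ZV) (i : 'I_d) := cid (ufun_expand (kind n (enum_val i)) (y 0 i) (ltW epos)).
have [B hB] := l1_bounded R g.
exists e, (fun n i => sval (hcf n i)), (fun n i => ubd (kind n (enum_val i)) (y 0 i) e), (expR M * B).
split=> // [n i|n i t _|].
- exact: (svalP (hcf n i)).1.
- exact: (svalP (hcf n i)).2.
apply: (abs_bounded_le hB (expR_ge0 M)) => n.
have ub0 v x : 0 <= ubd (kind n v) x e.
  by case: (kind n v) => [k|phi] /=; [rewrite exprn_ge0 // addr_ge0 // ltW|exact: expR_ge0].
rewrite normc_real ger0_norm; last by apply: prodr_ge0.
have := hM (fun v => y 0 (enum_rank v)) e n; rewrite (ltW epos) ge_min lexx /= => /(_ isT).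
have -> : \prod_(i < d) ubd (kind n (enum_val i)) (y 0 i) e =
  \prod_v ubd (kind n v) (y 0 (enum_rank v)) e.
  rewrite (reindex (@enum_rank _)) /=; last first.
    by apply: onW_bij; exists enum_val => v; rewrite ?enum_rankK ?enum_valK.
  by apply: eq_bigr => v _; rewrite enum_rankK.
apply => v b; rewrite -{1}(enum_rankK v) => /he; apply: le_trans.
by rewrite lerD2l ge_min lexx orbT.
Qed.

Section Value.
Variables (a mu : 'cV[R]_g) (lam xx : Pr -> R) (A B : 'cV[R]_g).

Let xm : 'M[R]_g := \matrix_(i, j) xx (i, j).
Let rho al := lform al (a + A).

(** The phase of a term is [3 pi] times the form [xx] at [n], plus [2 pi] times the linear form
    [wvec] at [n], plus the constant [2 pi wcst] ([phase_sum]). *)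
Definition wvec : 'cV[R]_g := 3 *: (xm *m (a + A) + B) - mu.
Definition wcst : R := (a^T *m (xm *m ((3 / 2) *: a + 3 *: A) + 3 *: B)) 0 0.

Definition coordv (v : V) : R :=
  match v with
  | inl (inl al) => expR (- (3 * pi * lam al))
  | inl (inr (inl al)) => expR (- (3 * pi * lam al * (P%:R + rho al)))
  | inl (inr (inr al)) => expR (- (3 * pi * lam al * (P%:R - rho al)))
  | inr (inl al) => xx al
  | inr (inr (inl i)) => wvec i 0
  | inr (inr (inr _)) => wcst
  end.

(** The factor without a uniform bound. It is left to the global exponential, so that only the
    remaining series has to be restricted analytic. *)
Definition pref : R :=
  expR (\sum_al 3 * pi * lam al * (P%:R ^+ 2 - rho al ^+ 2 + lform al A ^+ 2)).

Hypothesis xs : xm^T = xm.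

Lemma bl_real (u w : 'cV[R]_g) :
  bl (taum lam xx) (rz u) (rz w) =
  RC ((u^T *m xm *m w) 0 0) + 'i%C * RC ((u^T *m ymx lam *m w) 0 0).
Proof.
have EZ (c : C) m p (M : 'M[C]_(m, p)) i j : (c *: M) i j = c * M i j by rewrite mxE.
have -> : taum lam xx = map_mx RC xm + 'i%C *: map_mx RC (ymx lam).
  apply/matrixP => i j; rewrite [LHS]mxE [RHS]mxE [map_mx RC xm i j]mxE [xm i j]mxE.
  rewrite EZ [map_mx RC (ymx lam) i j]mxE; move: (ymx lam i j) (xx (i, j)) => p q.
  by rewrite [LHS]complexE.
rewrite /bl /rz map_trmx mulmxDr mulmxDl -scalemxAr -scalemxAl -!map_mxM mxE.
by rewrite EZ; congr (_ + _ * _); rewrite mxE.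
Qed.

Lemma ee_split (X Y : R) : ee (RC X + 'i%C * RC Y) = RC (expR (- (2 * pi * Y))) * cexp ('i%C * RC (2 * pi * X)).
Proof.
rewrite -cexp_real -cexpD /ee; congr cexp; apply/eqP; rewrite eq_complex /=.
by apply/andP; split; apply/eqP; ring.
Qed.

Lemma phase_sum (n : ZV) :
  \sum_al 3 * pi * (n al.1 0)%:~R * (n al.2 0)%:~R * xx al
  + (\sum_i 2 * pi * (n i 0)%:~R * wvec i 0 + 2 * pi * wcst) =
  2 * pi * (3 / 2 * ((iv R n + a)^T *m xm *m (iv R n + a)) 0 0
    + 3 * (((iv R n + a)^T *m xm *m A) 0 0 + ((iv R n + a)^T *m B) 0 0) - ((iv R n)^T *m mu) 0 0).
Proof.
set N := iv R n.
have -> : \sum_al 3 * pi * (n al.1 0)%:~R * (n al.2 0)%:~R * xx al = 3 * pi * (N^T *m xm *m N) 0 0.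
  rewrite -/(qf xm N) qfE mulr_sumr; under [RHS]eq_bigr do rewrite mulr_sumr.
  by rewrite pair_bigA /=; apply: eq_bigr => -[i j] _ /=; rewrite !mxE; ring.
have -> : \sum_i 2 * pi * (n i 0)%:~R * wvec i 0 = 2 * pi * (N^T *m wvec) 0 0.
  rewrite mxE mulr_sumr; apply: eq_bigr => i _; rewrite [N^T _ _]mxE [N _ _]mxE.
  by rewrite mulrA.
have sy : (a^T *m xm *m N) 0 0 = (N^T *m xm *m a) 0 0.
  by rewrite -[in LHS](trmxK (_ *m N)) mxE !trmx_mul trmxK xs mulmxA.
rewrite /wvec /wcst [(N + a)^T]linearD /=.
rewrite !(mulmxDl, mulmxDr, mulmxN) -?scalemxAr !(mulmxDl, mulmxDr) -?scalemxAr !mulmxA.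
have E (M1 M2 : 'M[R]_1) : (M1 + M2) 0 0 = M1 0 0 + M2 0 0 by rewrite mxE.
have EN (M1 : 'M[R]_1) : (- M1) 0 0 = - M1 0 0 by rewrite mxE.
have EZ c (M1 : 'M[R]_1) : (c *: M1) 0 0 = c * M1 0 0 by rewrite mxE.
rewrite !(E, EN, EZ) sy.
move: ((N^T *m xm *m N) 0 0) ((N^T *m xm *m a) 0 0) ((N^T *m xm *m A) 0 0) ((N^T *m B) 0 0) => x1 x2 x3 x4.
move: ((N^T *m mu) 0 0) ((a^T *m xm *m a) 0 0) ((a^T *m xm *m A) 0 0) ((a^T *m B) 0 0) => x5 x6 x7 x8.
by field.
Qed.

Lemma modulus_prod (n : ZV) :
  RC pref * (\prod_al ufun (kind n (inl (inl al))) (coordv (inl (inl al)))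
    * (\prod_al ufun (kind n (inl (inr (inl al)))) (coordv (inl (inr (inl al))))
     * \prod_al ufun (kind n (inl (inr (inr al)))) (coordv (inl (inr (inr al))))))
  = RC (expR (- (2 * pi * (3 / 2 * ((iv R n + a)^T *m ymx lam *m (iv R n + a)) 0 0
     + 3 * ((iv R n + a)^T *m ymx lam *m A) 0 0)))).
Proof.
rewrite /= -!rmorph_prod -!rmorphM /pref; congr RC.
under eq_bigr do rewrite -expRM_natl.
under [X in _ * (_ * (X * _))]eq_bigr do rewrite -expRM_natl.
under [X in _ * (_ * (_ * X))]eq_bigr do rewrite -expRM_natl.
rewrite -!expR_sum -!expRD; congr expR.
rewrite !ymx_bilin !mulr_sumr -!big_split /= mulr_sumr -sumrN; apply: eq_bigr => al _.
rewrite dPE /rho !lformD lform_iv -/(lz al n).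
have aE : (absz (lz al n))%:R = `|(lz al n)%:~R| :> R by rewrite -intr_norm -abszE.
move: (lform al a) (lform al A) (lam al) => r1 r2 la.
case: ifP => h; rewrite ?natrM aE.
  by rewrite ger0_norm ?ler0z //; field.
have h' : (lz al n)%:~R <= 0 :> R by rewrite lerz0 ltW // ltNge h.
by rewrite ler0_norm //; field.
Qed.

Lemma tterm_series n :
  tterm 3 (taum lam xx) a mu (taum lam xx *m rz A + rz B) n =
  RC pref * \prod_v ufun (kind n v) (coordv v).
Proof.
rewrite !big_sumType /= mulrA; have := modulus_prod n; rewrite /= => ->.
rewrite [X in _ * (_ * (_ * X))]big_const card_unit /= mulr1.
have -> : \prod_al cexp ('i%C * RC (3 * pi * (n al.1 0)%:~R * (n al.2 0)%:~R * xx al)) *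
   (\prod_i cexp ('i%C * RC (2 * pi * (n i 0)%:~R * wvec i 0)) *
    cexp ('i%C * RC (2 * pi * wcst))) =
  cexp ('i%C * RC (\sum_al 3 * pi * (n al.1 0)%:~R * (n al.2 0)%:~R * xx al
  + (\sum_i 2 * pi * (n i 0)%:~R * wvec i 0 + 2 * pi * wcst))).
  rewrite -!cexp_sum -!cexpD; congr cexp.
  by rewrite -!mulr_sumr -!mulrDr -!rmorph_sum -!rmorphD.
rewrite phase_sum -ee_split /tterm; congr ee.
rewrite nzE -rzD dotDr dot_mul !bl_real !dot_rz.
have h3 : RC 3 = 3 by rewrite rmorph_nat.
have h32 : RC (3 / 2) = 3 / 2 by rewrite rmorphM fmorphV !rmorph_nat.
move: (((iv R n + a)^T *m xm *m (iv R n + a)) 0 0) (((iv R n + a)^T *m xm *m A) 0 0) => x1 x2.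
move: (((iv R n + a)^T *m ymx lam *m (iv R n + a)) 0 0) (((iv R n + a)^T *m ymx lam *m A) 0 0) => x3 x4.
move: (((iv R n + a)^T *m B) 0 0) (((iv R n)^T *m mu) 0 0) => x5 x6.
have -> : RC (3 / 2 * x1 + 3 * (x2 + x5) - x6) = 3 / 2 * RC x1 + 3 * (RC x2 + RC x5) - RC x6.
  by rewrite -h32 -h3 -rmorphD -!rmorphM -rmorphD -rmorphB.
have -> : RC (3 / 2 * x3 + 3 * x4) = 3 / 2 * RC x3 + 3 * RC x4.
  by rewrite -h32 -h3 -!rmorphM -rmorphD.
rewrite h32 h3; move: (RC x1) (RC x2) (RC x3) (RC x4) (RC x5) (RC x6) 'i%C => y1 y2 y3 y4 y5 y6 i.
by field.
Qed.

End Value.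

Definition lo_box (Wm : R) (v : V) : R :=
  match v with inl _ => 0 | inr _ => - Wm end.
Definition hi_box (Wm : R) (v : V) : R :=
  match v with inl (inl _) => expR (- 1) | inl (inr _) => 1 | inr _ => Wm end.

Definition boxed (Wm : R) (f : 'rV[R]_d -> R) : 'rV[R]_d -> R :=
  restr (\row_i lo_box Wm (enum_val i)) (\row_i hi_box Wm (enum_val i)) f.

(** The closed box lies in [open_box] because [exp (-1) < exp (-1/2)] and [1 < exp 1]. *)
Lemma boxed_analytic Wm :
  restricted_analytic (boxed Wm (fun y => complex.Re (series y))) /\
  restricted_analytic (boxed Wm (fun y => complex.Im (series y))).
Proof.
apply: (restr_analytic open_boxP _ series_expandable) => y hy i b.
have := hy i; rewrite !mxE; case: (enum_val i) => [[al|al]|v] //= /andP[y0 y1] [<-].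
  by rewrite ger0_norm //; apply: (le_lt_trans y1); rewrite ltr_expR; lra.
by rewrite ger0_norm //; apply: (le_lt_trans y1); rewrite -[1 in X in X < _]expR0 ltr_expR.
Qed.

End ThetaDefinable.

(** * Theta functions as definable terms *)

Section ThetaValue.
Variables (R : realType) (g : nat).
Local Notation C := R[i].
Local Notation normc := (@Normc.normc R).
Local Notation RC := (real_complex R).
Local Notation Pr := ('I_g * 'I_g)%type.
Variables (a mu : 'cV[R]_g) (P : nat) (Wm : R).

Definition Theta_tm (lam xx : Pr -> R) (A B : 'I_g -> R) : C :=
  let y := \row_i coordv P a mu lam xx (\col_i A i) (\col_i B i) (enum_val i) in
  RC (pref P a lam (\col_i A i)) *
  Complex (boxed Wm (fun y => complex.Re (series P y)) y)
          (boxed Wm (fun y => complex.Im (series P y)) y).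

Lemma Theta_tm_definable (I : Type) (lam xx : Pr -> (I -> R) -> R) (A B : 'I_g -> (I -> R) -> R) :
  (forall al, dterm (lam al)) -> (forall al, dterm (xx al)) ->
  (forall i, dterm (A i)) -> (forall i, dterm (B i)) ->
  dfunC (fun v => Theta_tm (lam^~ v) (xx^~ v) (A^~ v) (B^~ v)).
Proof.
move=> hl hx hA hB.
have dl al : dterm (fun v => lform al (\col_i A i v)).
  have [e1|e1] := boolP (al.1 == al.2).
    by apply: dt_ext (hA al.1) => v; rewrite /lform e1 mxE.
  have [e2|e2] := boolP (al.1 < al.2)%N.
    apply: dt_ext (dt_add (hA al.1) (hA al.2)) => v.
    by rewrite /lform (negPf e1) e2 !mxE.
  apply: dt_ext (dt_add (hA al.1) (dt_opp (hA al.2))) => v.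
  by rewrite /lform (negPf e1) (negPf e2) !mxE.
have dr al : dterm (fun v => lform al (a + \col_i A i v)).
  by apply: dt_ext (dt_add (dt_cst (lform al a)) (dl al)) => v; rewrite lformD.
have c3 al : dterm (fun v => 3 * pi * lam al v) by apply: dt_mul (hl al); exact: dt_cst.
have dxm (u : 'cV[R]_g) (k : R) i :
   dterm (fun v => ((\matrix_(i, j) xx (i, j) v : 'M[R]_g) *m (u + k *: \col_i A i v)) i 0).
  apply: dt_ext (dt_sum (index_enum 'I_g) (fun j => dt_mul (hx (i, j))
     (dt_add (dt_cst (u j 0)) (dt_mul (dt_cst k) (hA j))))) => v.
  by rewrite mxE; apply: eq_bigr => j _; rewrite !mxE.
apply: dC_mul.
  apply: dC_real; apply: dt_exp; apply: dt_sum => al; apply: dt_mul; first exact: c3.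
  apply: dt_add; last by rewrite /=; apply: dt_ext (dt_mul (dl al) (dl al)) => v; rewrite expr2.
  apply: dt_add; first exact: dt_cst.
  by apply: dt_opp; apply: dt_ext (dt_mul (dr al) (dr al)) => v; rewrite expr2.
have dco i : dterm (fun v => coordv P a mu (lam^~ v) (xx^~ v) (\col_i A i v) (\col_i B i v)
    (enum_val (A := {: ((Pr + (Pr + Pr)) + (Pr + ('I_g + unit)))%type}) i)).
  case: (enum_val i) => [[al|[al|al]]|[al|[j|[]]]] /=.
  - exact: dt_exp (dt_opp (c3 al)).
  - by apply: dt_exp; apply: dt_opp; apply: dt_mul (c3 al) _; apply: dt_add (dt_cst _) (dr al).
  - by apply: dt_exp; apply: dt_opp; apply: dt_mul (c3 al) _; apply: dt_add (dt_cst _) (dt_opp (dr al)).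
  - exact: hx.
  - have := dt_add (dt_mul (dt_cst 3) (dt_add (dxm a 1 j) (hB j))) (dt_cst (- mu j 0)).
    by apply: dt_ext => v; rewrite /wvec !mxE scale1r.
  - have := dt_sum (index_enum 'I_g) (fun j => dt_mul (dt_cst (a j 0))
       (dt_add (dxm ((3 / 2) *: a) 3 j) (dt_mul (dt_cst 3) (hB j)))).
    by apply: dt_ext => v; rewrite /wcst mxE; apply: eq_bigr => j _; rewrite !mxE.
have [an1 an2] := @boxed_analytic R g P Wm.
by split; apply: (dt_an _ dco).
Qed.

(** The hypotheses place the coordinates in the box: [P] bounds the forms [rho al], and [Wm] bounds
    [wvec], [wcst] and [xx]. *)
Lemma Theta_tmE (X P0 : R) lam xx (A B : 'I_g -> R) : 0 <= X -> 0 <= P0 ->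
  (forall i, 2 * (`|a i 0| + P0) <= P%:R) ->
  (forall i, 3 * (g%:R * (X * P%:R) + P0) + `|mu i 0| <= Wm) ->
  \sum_i `|a i 0| * (g%:R * (X * (2 * P%:R)) + 3 * P0) <= Wm -> X <= Wm ->
  (forall al, 1 <= lam al) -> (forall al, `|xx al| <= X) -> (forall i j, xx (i, j) = xx (j, i)) ->
  (forall i, `|A i| <= P0) -> (forall i, `|B i| <= P0) ->
  Theta_tm lam xx A B =
  Theta 3 (taum lam xx) a mu (taum lam xx *m rz (\col_i A i) + rz (\col_i B i)).
Proof.
move=> X0 P00 hP hW1 hW2 hW3 hl hx xs hA hB.
set Ac := \col_i A i; set Bc := \col_i B i.
have three : 0 < 3 :> R by rewrite ltr0n.
have aA i : `|(a + Ac) i 0| <= P%:R / 2.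
  rewrite !mxE; apply: (le_trans (ler_normD _ _)); have := hP i; have := hA i; lra.
have rhoP al : `|lform al (a + Ac)| <= P%:R.
  by have := lform_norm al aA; lra.
have xmE (u : 'cV[R]_g) M i : (forall j, `|u j 0| <= M) ->
    `|((\matrix_(i, j) xx (i, j) : 'M[R]_g) *m u) i 0| <= g%:R * (X * M).
  move=> hu; rewrite mxE; apply: (le_trans (ler_norm_sum _ _ _)).
  apply: (@le_trans _ _ (\sum_(j < g) (X * M))); last by rewrite sumr_const card_ord mulr_natl.
  by apply: ler_sum => j _; rewrite normrM mxE ler_pM.
pose y : 'rV[R]_#|{: ((Pr + (Pr + Pr)) + (Pr + ('I_g + unit)))%type}| :=
  \row_i coordv P a mu lam xx Ac Bc (enum_val i).
have p3 := pi_ge2 R.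
have yb : Defs.box (\row_i lo_box Wm (enum_val i)) (\row_i hi_box Wm (enum_val i)) y.
  move=> i; rewrite !mxE; case: (enum_val i) => [[al|[al|al]]|[al|[j|[]]]] /=.
  - rewrite expR_ge0 ler_expR lerN2; have := ler_pM _ _ p3 (hl al); rewrite mulr1 => h.
    by have := h (ler0n _ 2) ler01; lra.
  - rewrite expR_ge0 expR_le1 oppr_le0 mulr_ge0 //.
      by rewrite !mulr_ge0 ?pi_ge0 // (le_trans ler01).
    by have := rhoP al; rewrite ler_norml => /andP[h _]; lra.
  - rewrite expR_ge0 expR_le1 oppr_le0 mulr_ge0 //.
      by rewrite !mulr_ge0 ?pi_ge0 // (le_trans ler01).
    by have := rhoP al; rewrite ler_norml => /andP[_ h]; lra.
  - by rewrite -ler_norml; apply: le_trans (hx al) hW3.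
  - rewrite -ler_norml /wvec; apply: le_trans (hW1 j).
    set U := _ *m _; have -> : (3 *: (U + Bc) - mu) j 0 = 3 * (U j 0 + B j) - mu j 0 by rewrite !mxE.
    apply: (le_trans (ler_normB _ _)); rewrite lerD2r normrM (@ger0_norm _ 3) // ler_wpM2l //.
    apply: (le_trans (ler_normD _ _)); apply: lerD (hB j).
    by apply: xmE => k; have := aA k; have : 0 <= P%:R :> R by []; lra.
  - rewrite -ler_norml /wcst; apply: le_trans hW2; rewrite mxE.
    apply: (le_trans (ler_norm_sum _ _ _)); apply: ler_sum => k _.
    rewrite normrM [a^T _ _]mxE ler_wpM2l // mxE; apply: (le_trans (ler_normD _ _)); apply: lerD.
      apply: xmE => j; rewrite !mxE; apply: (le_trans (ler_normD _ _)).
      rewrite !normrM (@ger0_norm _ 3) // (@ger0_norm _ 2^-1) ?invr_ge0 //.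
      have := hP j; have := hA j; have := normr_ge0 (a j 0); lra.
    by rewrite !mxE normrM (@ger0_norm _ 3) // ler_wpM2l.
have xs' : (\matrix_(i, j) xx (i, j) : 'M[R]_g)^T = \matrix_(i, j) xx (i, j).
  by apply/matrixP => i j; rewrite !mxE xs.
have pr0 : RC (pref P a lam Ac) != 0 by rewrite -normc_gt0 normc_real normr_gt0 gt_eqF ?expR_gt0.
have hT := Theta_hsum a mu (taum lam xx *m rz Ac + rz Bc) three (taum_growth xx hl).
have sE : series P y = (RC (pref P a lam Ac))^-1 * Theta 3 (taum lam xx) a mu (taum lam xx *m rz Ac + rz Bc).
  apply: tsumE; apply: hsum_ext (hsumZ (RC (pref P a lam Ac))^-1 hT) => n.
  rewrite (tterm_series P a mu lam Ac Bc xs') mulKf //.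
  rewrite (reindex (@enum_val _ (mem {: ((Pr + (Pr + Pr)) + (Pr + ('I_g + unit)))%type}))) /=.
    by apply: eq_bigr => i _; rewrite mxE.
  by apply: onW_bij; exists (@enum_rank _) => v; rewrite ?enum_rankK ?enum_valK.
rewrite /Theta_tm -/Ac -/Bc -/y /boxed /restr; case: asboolP => // _.
have -> : Complex (complex.Re (series P y)) (complex.Im (series P y)) = series P y by case: series.
by rewrite sE mulVKf.
Qed.

End ThetaValue.

(** * Coordinates of tame matrices *)

Section TameParameters.
Variables (R : realType) (g : nat).
Local Notation C := R[i].
Local Notation Pr := ('I_g * 'I_g)%type.

Lemma lform_delta (al : Pr) i :
  lform al (delta_mx i 0 : 'cV[R]_g) =
  if al.1 == al.2 then (al.1 == i)%:R
  else if (al.1 < al.2)%N then (al.1 == i)%:R + (al.2 == i)%:R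
  else (al.1 == i)%:R - (al.2 == i)%:R.
Proof. by rewrite /lform !mxE !andbT. Qed.

Lemma ymx_diag (lam : Pr -> R) i :
  ymx lam i i = lam (i, i) + \sum_(j | j != i) (lam (i, j) + lam (j, i)).
Proof.
rewrite mxE (eq_bigr (fun al : Pr => lam (al.1, al.2) * ((al.1 == i) || (al.2 == i))%:R)); last first.
  move=> [p q] _; rewrite -mulrA lform_delta /=; congr (_ * _).
  have [->|pq] := eqVneq p q; first by case: (q == i); rewrite ?mulr1 ?mulr0.
  have [p_i|p_i] := eqVneq p i; have [qi|qi] := eqVneq q i => /=.
  - by rewrite p_i qi eqxx in pq.
  - by case: ifP => _; rewrite ?addr0 ?subr0 mulr1.
  - by case: ifP => _; rewrite ?add0r ?sub0r ?mulrNN mulr1.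
  - by case: ifP => _; rewrite ?addr0 ?subr0 mulr0.
rewrite -(pair_bigA _ (fun p q => lam (p, q) * ((p == i) || (q == i))%:R)) /= (bigD1 i) //=.
under eq_bigr do rewrite eqxx /= mulr1.
rewrite (bigD1 i) //= -addrA big_split /=; congr (_ + (_ + _)).
apply: eq_bigr => p pi; rewrite (bigD1 i) //= eqxx orbT mulr1 big1 ?addr0 // => q qi.
by rewrite (negPf pi) (negPf qi) mulr0.
Qed.

Lemma ymx_off (lam : Pr -> R) (i j : 'I_g) : (i < j)%N -> ymx lam i j = lam (i, j) - lam (j, i).
Proof.
move=> ij; have nij : i != j by rewrite -val_eqE /= ltn_eqF.
rewrite mxE (bigD1 (i, j)) //= (bigD1 (j, i)) /=; last by rewrite xpair_eqE eq_sym (negPf nij).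
rewrite big1 ?addr0 => [|[p q] /andP[h1 h2]].
  rewrite !lform_delta /= [j == i]eq_sym (negPf nij) ij !eqxx [(j < i)%N]ltnNge (ltnW ij) /=.
  by rewrite addr0 add0r subr0 sub0r !mulr1 mulrN1.
rewrite -mulrA !lform_delta /=; apply/eqP; rewrite mulf_eq0; apply/orP; right.
move: h1 h2; rewrite !xpair_eqE.
have [->|pq] := eqVneq p q.
  by have [->|qi] := eqVneq q i; rewrite ?mul0r // (negPf nij) mulr0.
have [->|pi] := eqVneq p i; rewrite ?(negPf nij) /=.
  have [//|qj] := eqVneq q j; move=> _ _.
  by case: ifP => _; rewrite ?addr0 ?subr0 mulr0.
have [->|pj] := eqVneq p j; rewrite /=.
  move=> _ qi; rewrite (negPf qi).
  by case: ifP => _; rewrite ?addr0 ?subr0 mul0r.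
move=> _ _; have [->|qi] := eqVneq q i; rewrite ?(negPf nij).
  by case: ifP => _; rewrite ?addr0 ?subr0 mulr0.
by case: ifP => _; rewrite ?addr0 ?subr0 mul0r.
Qed.

Lemma ymx_sym (lam : Pr -> R) i j : ymx lam i j = ymx lam j i.
Proof. by rewrite !mxE; apply: eq_bigr => al _; rewrite mulrAC. Qed.

(** The coefficients [1 + (|y| + y) / 2] and [1 + (|y| - y) / 2] are at least one and differ by
    [y = y_ij]. Their sum [2 + |y_ij|] is charged to the diagonal, which affords it because the
    off-diagonal entries are small and [c >= 4 g + 2]. *)
Lemma tame_taum X c (tau : 'M[C]_g) : tame X c (eps_g R g) tau -> 4 * g%:R + 2 <= c ->
  exists lam xx : Pr -> R, [/\ forall al, 1 <= lam al, forall al, `|xx al| <= X,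
    forall i j, xx (i, j) = xx (j, i) & tau = taum lam xx].
Proof.
move=> [ts hX hc ho] c2.
pose y i j := complex.Im (tau i j).
have ys i j : y i j = y j i by rewrite /y -[in LHS]ts mxE.
pose lam (al : Pr) : R := if al.1 == al.2 then y al.1 al.1 - \sum_(j | j != al.1) (2 + `|y al.1 j|)
  else if (al.1 < al.2)%N then 1 + (`|y al.1 al.2| + y al.1 al.2) / 2
  else 1 + (`|y al.1 al.2| - y al.1 al.2) / 2.
have off i j : i != j -> lam (i, j) + lam (j, i) = 2 + `|y i j|.
  move=> ij; rewrite /lam /= [j == i]eq_sym (negPf ij) [y j i]ys.
  case: (ltngtP i j) => [_|_|/val_inj E]; [lra|lra|].
  by rewrite E eqxx in ij.
exists lam, (fun al => complex.Re (tau al.1 al.2)); split.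
- move=> [p q]; rewrite /lam /=; case: eqVneq => [_|pq].
    have cp : c <= y p p := hc p.
    have S : \sum_(j | j != p) (2 + `|y p j|) <= g%:R * (2 + eps_g R g * y p p).
      apply: (@le_trans _ _ (\sum_(j < g) (2 + eps_g R g * y p p))); last first.
        by rewrite sumr_const card_ord mulr_natl.
      rewrite [leRHS](bigID (fun j => j != p)) /= -[leLHS]addr0; apply: lerD.
        by apply: ler_sum => j jp; rewrite lerD2l; apply: ho; rewrite eq_sym.
      apply: sumr_ge0 => j _; rewrite addr_ge0 // mulr_ge0 ?(ltW (eps_g_gt0 R g)) //.
      by apply: le_trans cp; apply: le_trans c2; rewrite addr_ge0 ?mulr_ge0 ?ler0n.
    have g0 : 0 <= g%:R :> R by rewrite ler0n.
    have y0 : 0 <= y p p by lra.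
    have e := ler_wpM2r y0 (eps_g_le R g); move: S e; rewrite mulrDr; lra.
  have := ler_norm (y p q); have := ler_norm (- y p q); rewrite normrN.
  by case: ifP => _; lra.
- by move=> al; exact: hX.
- by move=> i j /=; rewrite -[in LHS]ts mxE.
apply/matrixP => i j; rewrite [RHS]mxE /=.
suff -> : ymx lam i j = y i j by rewrite /y; case: (tau i j).
have [<-|ij] := eqVneq i j.
  rewrite ymx_diag (eq_bigr (fun j => 2 + `|y i j|)) => [|k ki]; last by rewrite off // eq_sym.
  by rewrite /lam /= eqxx subrK.
wlog lt : i j ij / (i < j)%N.
  move=> H; case: (ltngtP i j) => [h|h|/val_inj E]; first exact: H.
    by rewrite ymx_sym ys; apply: H => //; rewrite eq_sym.
  by rewrite E eqxx in ij.
rewrite ymx_off // /lam /= (negPf ij) [j == i]eq_sym (negPf ij) lt ltnNge (ltnW lt) /= [y j i]ys; lra.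
Qed.

End TameParameters.

(** * The embedding of a single torus *)

Section ProjectivePoints.
Variables (K : numFieldType) (N : nat).

Lemma basepoint_dim : (\dim <[(const_mx 1%R : 'rV[K]_N.+1)]>%VS == 1)%N.
Proof.
rewrite dim_vline; suff -> : (const_mx 1%R : 'rV[K]_N.+1) != 0%R by [].
by apply/eqP => /matrixP /(_ ord0 ord0); rewrite !mxE => /eqP; rewrite oner_eq0.
Qed.

(** At [v = 0] the default is the point with all coordinates 1; elsewhere it is the line of [v]. *)
Definition mkpt (v : 'rV[K]_N.+1) : projspace K N :=
  insubd (exist (fun L : {vspace 'rV[K]_N.+1} => (\dim L == 1)%N) _ basepoint_dim) <[v]>%VS.

Lemma mkptE v : v != 0 -> homog_coords (mkpt v) v.
Proof. by move=> v0; rewrite /homog_coords /mkpt; apply: insubdK; rewrite unfold_in /= dim_vline v0. Qed.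

Lemma vline_eqP (v w : 'rV[K]_N.+1) : v != 0 -> w != 0 ->
  <[v]>%VS = <[w]>%VS <-> exists2 rho, rho != 0 & v = rho *: w.
Proof.
move=> v0 w0; split=> [E|[k k0 ->]].
  have /vlineP[k vk] : v \in <[w]>%VS by rewrite -E memv_line.
  by exists k => //; apply: contra_eq_neq vk => ->; rewrite scale0r.
apply/vspaceP => u; apply/vlineP/vlineP => -[l ->].
  by exists (l * k); rewrite scalerA.
by exists (l / k); rewrite scalerA divfK.
Qed.

Lemma mkpt_eq v w : v != 0 -> w != 0 ->
  mkpt v = mkpt w <-> exists2 rho, rho != 0 & v = rho *: w.
Proof.
move=> v0 w0; rewrite -(vline_eqP v0 w0) -(mkptE v0) -(mkptE w0).
by split=> [->//|h]; exact: val_inj.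
Qed.

Lemma homog_chart v i (u : 'rV[K]_N) : v != 0 ->
  homog_coords (mkpt v) (chart i u) <->
  v 0 i != 0 /\ forall k, v 0 (lift i k) = u 0 k * v 0 i.
Proof.
move=> v0; rewrite /homog_coords (mkptE v0).
have ci : chart i u 0 i = 1 by rewrite mxE unlift_none.
have cl k : chart i u 0 (lift i k) = u 0 k by rewrite mxE liftK.
have c0 : chart i u != 0.
  by apply/eqP => /rowP /(_ i); rewrite ci mxE => /eqP; rewrite oner_eq0.
rewrite (vline_eqP v0 c0); split=> [[k k0 ->]|[vi h]].
  by rewrite !mxE unlift_none mulr1; split=> // l; rewrite !mxE liftK mulrC.
exists (v 0 i) => //; apply/rowP => j; rewrite [RHS]mxE.
by case: (unliftP i j) => [k ->|->]; rewrite ?cl ?ci ?mulr1 // h mulrC.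
Qed.

End ProjectivePoints.

Lemma common_denominator n (M : 'M[rat]_n) :
  exists2 K : nat, (0 < K)%N & exists W : 'M[int]_n, K%:R *: M = map_mx intr W.
Proof.
pose K := (\prod_i \prod_j `|denq (M i j)|)%N.
exists K.
  by apply: prodn_gt0 => i; apply: prodn_gt0 => j; rewrite absz_gt0 denq_eq0.
have h i j : exists w : int, K%:R * M i j = w%:~R.
  have : (`|denq (M i j)| %| K)%N.
    rewrite /K (bigD1 i) //= (bigD1 j) //=.
    by rewrite -mulnA dvdn_mulr.
  move=> /dvdnP[q ->]; exists (q%:Z * numq (M i j)).
  rewrite natrM -mulrA intrM; congr (_ * _).
  have -> : `|denq (M i j)|%:R = (denq (M i j))%:~R :> rat by rewrite pmulrn absz_denq.
  by rewrite numqE mulrC.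
exists (\matrix_(i, j) sval (cid (h i j))); apply/matrixP => i j; rewrite !mxE.
exact: svalP (cid (h i j)).
Qed.

(** * Theta coordinates on one torus *)

Section Torus.
Variables (R : realType) (g : nat).
Local Notation C := R[i].
Local Notation RC := (real_complex R).
Local Notation ZV := 'cV[int]_g.
Local Notation K3 := {ffun 'I_g -> 'I_3}.

Variables (D : 'M[int]_g) (r : 'M[rat]_(g + g)) (K : nat) (W : 'M[int]_(g + g)).
Hypothesis hr : Sp r.
Hypothesis hD : polarization_type D.
Hypothesis K0 : (0 < K)%N.
Hypothesis hW : K%:R *: (r^T *m block_mx 1%:M 0 0 (map_mx intr D)) = map_mx intr W.

Definition WR : 'M[R]_(g + g) := map_mx intr W.

Lemma W_unit : WR \in unitmx.
Proof.
suff : (map_mx intr W : 'M[rat]_(g + g)) \in unitmx.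
  by rewrite /WR !unitmxE !unitfE !det_map_mx !intr_eq0.
rewrite -hW -mul_scalar_mx; case: hr => ur _.
have [Dd Dp _] := hD.
rewrite !unitmx_mul unitmx_tr ur /= unitmxE det_scalar unitrX ?unitfE ?pnatr_eq0 -?lt0n //=.
rewrite unitmxE det_ublock det1 mul1r unitfE det_map_mx intr_eq0.
have /det_trig -> : is_trig_mx D by exact: is_diag_mx_is_trig.
by apply/prodf_neq0 => i _; rewrite gt_eqF.
Qed.

(** The rows of the inverse of [W], cut into the half paired with [p] and, in [charnu], the half
    paired with [q]; [None] is the trivial character. *)
Definition charmu (j : option 'I_(g + g)) : 'cV[R]_g :=
  if j is Some j then \col_i invmx WR j (lshift g i) else 0.
Definition charnu (j : option 'I_(g + g)) : 'cV[R]_g :=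
  if j is Some j then \col_i invmx WR j (rshift g i) else 0.

(** The factor [3^-1] compensates the order: translation by an integer vector [q] multiplies the
    term at [n] by [ee (3 (n + a) . q)]. *)
Definition chara (x : option 'I_(g + g) * K3) : 'cV[R]_g := ka R x.2 + 3^-1 *: charnu x.1.

Definition coordTheta (tau0 : 'M[C]_g) (x : option 'I_(g + g) * K3) (z0 : 'cV[C]_g) : C :=
  Theta 3 tau0 (chara x) (charmu x.1) z0.

Definition transfer (tau0 : 'M[C]_g) : 'M[C]_g := K%:R *: (jden r tau0)^T.

Lemma char_pairing (j : 'I_(g + g)) (p q : ZV) :
  dot (nz R p) (rz (charmu (Some j))) + dot (rz (charnu (Some j))) (nz R q) =
  RC ((invmx WR *m iv R (col_mx p q)) j 0).
Proof.
rewrite !nzE !dot_rz -rmorphD; congr RC; rewrite [RHS]mxE big_split_ord /=.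
have cE : iv R (col_mx p q) = col_mx (iv R p) (iv R q) by exact: map_col_mx.
rewrite cE [X in X + _]mxE [X in _ + X]mxE; congr (_ + _); apply: eq_bigr => i _.
  by rewrite col_mxEu !mxE mulrC.
by rewrite col_mxEd !mxE.
Qed.

Variable tau0 : 'M[C]_g.
Hypothesis gt : growth tau0.
Hypothesis ts : tau0^T = tau0.
Hypothesis dom : forall s n0 z (A : {fset ZV}),
  good s n0 -> imx z = imx tau0 *m s -> n0 \notin A ->
  \sum_(n <- A) Normc.normc (tterm 1 tau0 0 0 z n) <= Normc.normc (tterm 1 tau0 0 0 z n0) / 10.

Let sg : siegel tau0 := growth_siegel ts gt.
Let three : 0 < 3 :> R. Proof. by rewrite ltr0n. Qed.

Lemma transfer_unit : transfer tau0 \in unitmx.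
Proof.
rewrite /transfer -mul_scalar_mx unitmx_mul unitmx_tr (jden_unit hr sg) andbT.
by rewrite unitmxE det_scalar unitrX // unitfE pnatr_eq0 -lt0n.
Qed.

(** Symmetry of [sp_act r tau0] turns its product with the transpose of [jden r tau0] into the
    transpose of [nnum r tau0]; the columns of [(tau, D)] thus go to [(tau0, 1) r^T diag(1, D)], up
    to the scalar [K]. *)
Lemma transferE (a b : 'cV[C]_g) :
  transfer tau0 *m (sp_act r tau0 *m a + map_mx intr D *m b) =
  tau0 *m usubmx (map_mx intr W *m col_mx a b) + dsubmx (map_mx intr W *m col_mx a b).
Proof.
have WE : map_mx intr W = K%:R *: ((cmx R r)^T *m block_mx 1%:M 0 0 (map_mx intr D)) :> 'M[C]_(g + g).
  have := congr1 (map_mx (ratr : rat -> C)) hW.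
  rewrite map_mxZ rmorph_nat map_mxM -map_trmx -/(cmx R r) map_block_mx map_mx1 !map_mx0.
  have mi m n (M : 'M[int]_(m, n)) : map_mx (ratr : rat -> C) (map_mx intr M) = map_mx intr M.
    by apply/matrixP => i j; rewrite !mxE ratr_int.
  by rewrite !mi.
have aj := act_jden hr sg; have asy := act_sym hr sg.
have E1 : (jden r tau0)^T *m sp_act r tau0 = (nnum r tau0)^T by rewrite -[in LHS]asy -trmx_mul aj.
have -> : map_mx intr W *m col_mx a b = K%:R *: ((cmx R r)^T *m col_mx a (map_mx intr D *m b)).
  by rewrite WE -scalemxAl -mulmxA mul_block_col !mul1mx !mul0mx addr0 add0r.
move: (map_mx intr D *m b) => v.
rewrite /transfer -scalemxAl mulmxDr mulmxA E1.
have -> : (cmx R r)^T = block_mx (ulsubmx (cmx R r))^T (dlsubmx (cmx R r))^T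
    (ursubmx (cmx R r))^T (drsubmx (cmx R r))^T by rewrite -tr_block_mx submxK.
rewrite /nnum /jden mul_block_col.
rewrite ![usubmx (_ *: _)]linearZ ![dsubmx (_ *: _)]linearZ /= col_mxKu col_mxKd.
rewrite -scalemxAr -scalerDr; congr (_ *: _).
rewrite ![(_ + _)^T]linearD /= !trmx_mul ts !mulmxDl !mulmxDr !mulmxA.
by rewrite -!addrA; congr (_ + _); rewrite addrCA.
Qed.

(** The first factor is common to all coordinates [x], so projectively only the character
    survives. *)
Lemma coordTheta_shift x z (p q : ZV) :
  coordTheta tau0 x (z + tau0 *m nz R p + nz R q) =
  ee (- (RC (3 / 2) * bl tau0 (nz R p) (nz R p)) - RC 3 * dot (nz R p) z) *
  ee (dot (nz R p) (rz (charmu x.1)) + dot (rz (charnu x.1)) (nz R q)) * coordTheta tau0 x z.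
Proof.
rewrite /coordTheta (@Theta_shift_int _ _ 3 tau0 _ _ _ _ (ee (dot (rz (charnu x.1)) (nz R q)))) //.
  by rewrite Theta_shift_tau // mulrA -!eeD; congr (ee _ * _); rewrite addrC -!addrA.
move=> n; rewrite /chara rzD dotDl dotDl.
have -> : rz (3^-1 *: charnu x.1) = RC 3^-1 *: rz (charnu x.1) by rewrite /rz map_mxZ.
have -> : rz (ka R x.2) = RC 3^-1 *: nz R (kv x.2) by rewrite /ka nzE /rz map_mxZ.
rewrite !dotZl !mulrDr !mulrA -rmorphM mulfV ?pnatr_eq0 // rmorph1 !mul1r !dot_nz !eeD.
rewrite ee_int mul1r; have -> : RC 3 = 3%:~R by rewrite rmorph_nat.
by rewrite -intrM ee_int mul1r.
Qed.

Lemma coordTheta_neq0 j z : exists k, coordTheta tau0 (j, k) z != 0.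
Proof.
have [k hk] := fth_neq0 gt ts dom (z + RC 3^-1 *: (tau0 *m rz (charnu j) - rz (charmu j))).
exists k; rewrite /coordTheta /chara /=.
have [u ->] := Theta_char (ka R k) (charmu j) (charnu j) z three gt ts.
by rewrite mulf_neq0 ?ee_neq0.
Qed.

Lemma coordTheta_None k z : coordTheta tau0 (None, k) z = fth tau0 k z.
Proof. by rewrite /coordTheta /chara /= scaler0 addr0. Qed.

Lemma intW_col (m n : ZV) : map_mx intr W *m col_mx (nz R m) (nz R n) =
  col_mx (nz R (usubmx (W *m col_mx m n))) (nz R (dsubmx (W *m col_mx m n))).
Proof. by rewrite /nz -map_col_mx -map_mxM -map_col_mx vsubmxK. Qed.

Theorem coordTheta_lattice z w :
  (exists2 rho, rho != 0 & forall x,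
     coordTheta tau0 x (transfer tau0 *m z) = rho * coordTheta tau0 x (transfer tau0 *m w)) <->
  lattice D (sp_act r tau0) (z - w).
Proof.
split=> [[rho rho0 h]|[m [n E]]]; last first.
  pose p := usubmx (W *m col_mx m n); pose q := dsubmx (W *m col_mx m n).
  have Ez : transfer tau0 *m z = transfer tau0 *m w + tau0 *m nz R p + nz R q.
    have := transferE (nz R m) (nz R n); rewrite -E mulmxBr intW_col col_mxKu col_mxKd.
    by move=> /eqP; rewrite subr_eq addrC addrA => /eqP.
  exists (ee (- (RC (3 / 2) * bl tau0 (nz R p) (nz R p)) - RC 3 * dot (nz R p) (transfer tau0 *m w))).
    exact: ee_neq0.
  move=> x; rewrite Ez coordTheta_shift; suff -> :
    ee (dot (nz R p) (rz (charmu x.1)) + dot (rz (charnu x.1)) (nz R q)) = 1 by rewrite mulr1.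
  case: x.1 => [j|]; last by rewrite /= rz0 /dot mulmx0 trmx0 mul0mx !mxE addr0 ee0.
  rewrite char_pairing vsubmxK.
  have -> : iv R (W *m col_mx m n) = WR *m iv R (col_mx m n) by rewrite /iv map_mxM.
  by rewrite mulKmx ?W_unit // mxE rmorph_int ee_int.
have [p [q E]] : exists p q : ZV, transfer tau0 *m z - transfer tau0 *m w = tau0 *m nz R p + nz R q.
  by apply: (fth_inj gt ts dom rho0) => k; have := h (None, k); rewrite !coordTheta_None.
have Ez : transfer tau0 *m z = transfer tau0 *m w + tau0 *m nz R p + nz R q.
  by rewrite -addrA -E addrC subrK.
have sh x := coordTheta_shift x (transfer tau0 *m w) p q; rewrite -Ez in sh.
set e := ee (- _ - _) in sh.
(* The untwisted coordinates identify [rho] with the common factor; the twisted ones then force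
   every character to be 1 at [(p, q)]. *)
have rE : rho = e.
  have [k hk] := coordTheta_neq0 None (transfer tau0 *m w).
  apply: (mulIf hk); rewrite -h sh; congr (_ * _).
  by rewrite /= rz0 /dot mulmx0 trmx0 mul0mx !mxE addr0 ee0 mulr1.
have hv (j : 'I_(g + g)) : exists v : int, (invmx WR *m iv R (col_mx p q)) j 0 = v%:~R.
  have [k hk] := coordTheta_neq0 (Some j) (transfer tau0 *m w).
  have := h (Some j, k); rewrite sh rE -[e in RHS]mulr1 => /(mulIf hk) /(mulfI (ee_neq0 _)).
  rewrite char_pairing => /ee_eq1[v hv]; exists v; have := hv.
  by rewrite -(rmorph_int RC) => /(congr1 (@complex.Re R)).
pose v : 'cV[int]_(g + g) := \col_j sval (cid (hv j)).
have vE : invmx WR *m iv R (col_mx p q) = iv R v.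
  by apply/colP => j; rewrite [RHS]mxE [v j 0]mxE; exact: svalP (cid (hv j)).
have pq : col_mx p q = W *m v.
  have : iv R (col_mx p q) = iv R (W *m v).
    by rewrite /iv map_mxM -/WR -/(iv R v) -vE mulKVmx // W_unit.
  by move=> /matrixP H; apply/matrixP => i j; have := H i j; rewrite !mxE => /intr_inj.
exists (usubmx v), (dsubmx v).
apply: (can_inj (mulKmx transfer_unit)); rewrite mulmxBr E.
have := transferE (nz R (usubmx v)) (nz R (dsubmx v)); rewrite intW_col vsubmxK -pq.
by rewrite !col_mxKu !col_mxKd => ->.
Qed.

(** Brings the index type to the form [N.+1] expected by [projspace]. *)
Lemma coord_card : #|{: option 'I_(g + g) * K3}|.-1.+1 = #|{: option 'I_(g + g) * K3}|.
Proof. by rewrite prednK //; apply/card_gt0P; exists (None, [ffun=> ord0]). Qed.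

Definition coord_index (i : 'I_#|{: option 'I_(g + g) * K3}|.-1.+1) : option 'I_(g + g) * K3 :=
  enum_val (cast_ord coord_card i).

Lemma coord_index_surj x : exists i, coord_index i = x.
Proof.
exists (cast_ord (esym coord_card) (enum_rank x)).
by rewrite /coord_index cast_ordKV enum_rankK.
Qed.

Definition coord_row (z0 : 'cV[C]_g) : 'rV[C]_(#|{: option 'I_(g + g) * K3}|.-1.+1) :=
  \row_i coordTheta tau0 (coord_index i) z0.

Lemma coord_row_neq0 z0 : coord_row z0 != 0.
Proof.
have [k hk] := coordTheta_neq0 None z0; have [i hi] := coord_index_surj (None, k).
by apply: contra hk => /eqP /rowP /(_ i); rewrite !mxE hi => ->.
Qed.

Theorem torus_coord_embedding E :
  torus_embedding (lattice D (sp_act r tau0)) E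
    (fun z => mkpt (coord_row (transfer tau0 *m z))).
Proof.
exists (fun z => mkpt (coord_row (transfer tau0 *m z))).
split; [by move=> z _; exact: erefl | move=> z w | ].
  rewrite (mkpt_eq (coord_row_neq0 _) (coord_row_neq0 _)) -coordTheta_lattice.
  split=> -[rho rho0 h]; exists rho => //.
    move=> x; have [i <-] := coord_index_surj x.
    by move/rowP: h => /(_ i); rewrite !mxE.
  by apply/rowP => i; rewrite !mxE h.
pose F i z := coordTheta tau0 (coord_index i) (transfer tau0 *m z).
have hG i z := cid2 (Theta_gradient (chara (coord_index i)) (charmu (coord_index i).1)
  (transfer tau0) z three gt).
apply: (@coords_immersion _ _ _ F (fun i z => s2val (hG i z))).
- by move=> i z; exact: s2valP' (hG i z).
- move=> z; have [k hk] := coordTheta_neq0 None (transfer tau0 *m z).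
  by have [i hi] := coord_index_surj (None, k); exists i; rewrite /F hi.
- move=> z v lam h.
  have tp0 : tpi R * RC 3 != 0.
    rewrite mulf_neq0 //; last by rewrite rmorph_nat pnatr_eq0.
    by rewrite /tpi eq_complex /= eqxx /= mulf_neq0 ?pnatr_eq0 // gt_eqF ?pi_gt0.
  suff /(congr1 (mulmx (invmx (transfer tau0)))) : transfer tau0 *m v = 0.
    by rewrite mulKmx ?transfer_unit // mulmx0.
  (* The gradient carries the factor [2 pi i] times 3 that is left out of [dfth], so [lam] is
     divided by it. *)
  apply: (@dfth_inj _ _ tau0 gt ts dom (transfer tau0 *m z) _ (lam / (tpi R * RC 3))) => k.
  have [i hi] := coord_index_surj (None, k); have := h i.
  rewrite (s2valP (hG i z)) /F hi coordTheta_None /chara /= scaler0 addr0.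
  rewrite -/(dfth tau0 k (transfer tau0 *m z) (transfer tau0 *m v)).
  move: (dfth tau0 k _ _) (fth tau0 k _) (tpi R * RC 3) tp0 => d f t t0 E2.
  by apply: (mulfI t0); rewrite E2 mulrA [t * _]mulrC divfK.
- by move=> z; exact: mkptE (coord_row_neq0 _).
Qed.

End Torus.

(** * The definable family *)

Section DefinableMatrices.
Variable R : realType.
Local Notation C := R[i].

Lemma dt_ren (I J : Type) (h : I -> J) (f : (I -> R) -> R) :
  dterm f -> dterm (fun v : J -> R => f (fun i => v (h i))).
Proof. by move=> hf n e; exact: (hf n (e \o h)). Qed.

Lemma dC_ren (I J : Type) (h : I -> J) (f : (I -> R) -> C) :
  dfunC f -> dfunC (fun v : J -> R => f (fun i => v (h i))).
Proof. by move=> [f1 f2]; split; [exact: (dt_ren h f1)|exact: (dt_ren h f2)]. Qed.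

Definition dmx (I : Type) m n (M : (I -> R) -> 'M[C]_(m, n)) : Prop :=
  forall i j, dfunC (fun v => M v i j).

Lemma dC_ext (I : Type) (f h : (I -> R) -> C) : (forall v, f v = h v) -> dfunC f -> dfunC h.
Proof. by move=> /funext ->. Qed.

Section Ops.
Variable I : Type.

Lemma dmx_cst m n (A : 'M[C]_(m, n)) : dmx (fun _ : I -> R => A).
Proof. by move=> i j; exact: dC_cst. Qed.

Lemma dmx_add m n (M N : (I -> R) -> 'M[C]_(m, n)) : dmx M -> dmx N -> dmx (fun v => M v + N v).
Proof. by move=> hM hN i j; apply: dC_ext (dC_add (hM i j) (hN i j)) => v; rewrite mxE. Qed.

Lemma dmx_mul m n p (M : (I -> R) -> 'M[C]_(m, n)) (N : (I -> R) -> 'M[C]_(n, p)) :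
  dmx M -> dmx N -> dmx (fun v => M v *m N v).
Proof.
move=> hM hN i j.
apply: dC_ext (dC_sum (index_enum 'I_n) (fun k => dC_mul (hM i k) (hN k j))) => v.
by rewrite mxE.
Qed.

Lemma dp_eqmx m n (M N : (I -> R) -> 'M[C]_(m, n)) : dmx M -> dmx N -> dprd (fun v => M v = N v).
Proof.
move=> hM hN; apply: dp_iff (dp_all (fun ij : 'I_m * 'I_n => dp_eqC (hM ij.1 ij.2) (hN ij.1 ij.2))).
move=> v; split=> [h|-> //]; apply/matrixP => i j; exact: (h (i, j)).
Qed.

Lemma dp_tame g X c eps (M : (I -> R) -> 'M[C]_g) : dmx M -> dprd (fun v => tame X c eps (M v)).
Proof.
move=> hM.
have h1 : dprd (fun v => (M v)^T = M v).
  by apply: dp_eqmx => // i j; apply: dC_ext (hM j i) => v; rewrite mxE.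
have h2 : dprd (fun v => forall ij : 'I_g * 'I_g, `|complex.Re (M v ij.1 ij.2)| <= X).
  by apply: dp_all => ij; apply: dp_norm_le; [exact: (hM _ _).1|exact: dt_cst].
have h3 : dprd (fun v => forall i, c <= complex.Im (M v i i)).
  by apply: dp_all => i; apply: dp_le; [exact: dt_cst|exact: (hM _ _).2].
have h4 : dprd (fun v => forall ij : 'I_g * 'I_g, ij.1 != ij.2 ->
    `|complex.Im (M v ij.1 ij.2)| <= eps * complex.Im (M v ij.1 ij.1)).
  apply: dp_all => ij; apply: dp_imp; first exact: dp_cst.
  apply: dp_norm_le; first exact: (hM _ _).2.
  by apply: dt_mul; [exact: dt_cst|exact: (hM _ _).2].
apply: dp_iff (dp_and h1 (dp_and h2 (dp_and h3 h4))) => v; split.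
  by move=> [k1 [k2 [k3 k4]]]; split=> // i j; [exact: (k2 (i, j))|exact: (k4 (i, j))].
by move=> [k1 k2 k3 k4]; split=> //; split=> [ij|]; [exact: k2|split=> // ij; exact: k4].
Qed.

End Ops.

(** Inverse to [realify]: real parts first, then imaginary parts. *)
Definition csub m (e : 'I_(m + m) -> R) (i : 'I_m) : C := Complex (e (lshift m i)) (e (rshift m i)).

Lemma dC_csub m (i : 'I_m) : dfunC (fun e => csub e i).
Proof. by split; exact: dt_var. Qed.

Lemma definableC_pred m (P : ('I_m -> C) -> Prop) :
  dprd (fun e => P (csub e)) -> definableC [set v : 'rV[C]_m | P (fun i => v 0 i)].
Proof.
move=> /dprd_definable; congr definable; apply/seteqP; split=> [x /= hx|_ [z /= hz <-]] /=.
  exists (\row_i csub (fun i => x 0 i) i) => /=.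
    by have -> : (fun i => (\row_i csub (fun i => x 0 i) i) 0 i) = csub (fun i => x 0 i)
      by apply/funext => i; rewrite mxE.
  apply/rowP => i; rewrite /realify; case: (split_ordP i) => j ->.
    by rewrite row_mxEl !mxE.
  by rewrite row_mxEr !mxE.
suff -> : csub (fun i => realify z 0 i) = (fun i => z 0 i) by [].
apply/funext => i; rewrite /csub /realify row_mxEl row_mxEr !mxE.
by case: (z 0 i).
Qed.

End DefinableMatrices.

(** * The family over the union of translates *)

Section Family.
Variables (R : realType) (g : nat) (D : 'M[int]_g).
Local Notation C := R[i].
Local Notation RC := (real_complex R).
Local Notation Pr := ('I_g * 'I_g)%type.
Local Notation K3 := {ffun 'I_g -> 'I_3}.
Hypothesis hD : polarization_type D.

Variables (X c : R) (L : seq 'M[rat]_(g + g)).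
Hypothesis c0 : 0 < c.
Hypothesis c2 : 4 * g%:R + 2 <= c.
Hypothesis hL : forall r, r \in L -> Sp r.
Hypothesis dom : forall tau : 'M[C]_g, tame X c (eps_g R g) tau ->
  forall r n0 z (A : {fset 'cV[int]_g}), good r n0 -> imx z = imx tau *m r -> n0 \notin A ->
  \sum_(n <- A) Normc.normc (tterm 1 tau 0 0 z n) <= Normc.normc (tterm 1 tau 0 0 z n0) / 10.

Local Notation tm := (@tame R g X c (eps_g R g)).

(** Written without the inverse of [jden], so that the equation is polynomial in the entries of
    [tau] and [tau0]; for symplectic [r] it says [tau = sp_act r tau0]. *)
Definition in_translate (r : 'M[rat]_(g + g)) (tau : 'M[C]_g) : Prop :=
  exists2 tau0, tm tau0 & tau *m jden r tau0 = nnum r tau0.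

(** The first suitable translate: it resolves overlaps, and as a first choice in a finite list it is
    definable. The default is reached only off [fund]. *)
Fixpoint select (s : seq 'M[rat]_(g + g)) (tau : 'M[C]_g) : 'M[rat]_(g + g) :=
  if s is r :: s' then if `[< in_translate r tau >] then r else select s' tau else 1%:M.

Definition fund : set 'M[C]_g := [set tau | exists2 r, r \in L & in_translate r tau].

Lemma selectP tau : fund tau -> select L tau \in L /\ in_translate (select L tau) tau.
Proof.
rewrite /fund /=; elim: (L) => [|r s IH] /= [r0]; first by rewrite in_nil.
case: asboolP => h; first by rewrite mem_head.
rewrite inE => /orP[/eqP ->|r0s] h0; first by [].
by have [|h1 h2] := IH; [exists r0|rewrite inE h1 orbT].
Qed.

Lemma in_translateP r tau : Sp r -> in_translate r tau ->
  let tau0 := sp_act (invmx r) tau in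
  [/\ tm tau0, tau = sp_act r tau0 & tau *m jden r tau0 = nnum r tau0].
Proof.
move=> hr [t0 ht E]; have sg := growth_siegel (tame_sym ht) (tame_growth c0 ht).
have tE : tau = sp_act r t0 by rewrite sp_actE -E mulmxK // jden_unit.
have [ur _] := hr.
have -> : sp_act (invmx r) tau = t0.
  by rewrite tE; have [_ <-] := act_comp (SpV hr) hr sg; rewrite mulVmx // act1.
by [].
Qed.

Lemma taum_eq r tau lam xx : Sp r -> tm (taum lam xx) ->
  tau *m jden r (taum lam xx) = nnum r (taum lam xx) -> sp_act (invmx r) tau = taum lam xx.
Proof.
move=> hr ht E; have sg := growth_siegel (tame_sym ht) (tame_growth c0 ht).
have tE : tau = sp_act r (taum lam xx) by rewrite sp_actE -E mulmxK // jden_unit.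
have [ur _] := hr.
by rewrite tE; have [_ <-] := act_comp (SpV hr) hr sg; rewrite mulVmx // act1.
Qed.

Let denom (r : 'M[rat]_(g + g)) :=
  cid2 (common_denominator (r^T *m block_mx 1%:M 0 0 (map_mx intr D))).
Definition scale_of r : nat := s2val (denom r).
Definition intmx_of r : 'M[int]_(g + g) := sval (cid (s2valP' (denom r))).

Lemma scale_of_gt0 r : (0 < scale_of r)%N.
Proof. exact: s2valP (denom r). Qed.

Lemma intmx_ofE r :
  (scale_of r)%:R *: (r^T *m block_mx 1%:M 0 0 (map_mx intr D)) = map_mx intr (intmx_of r).
Proof. exact: svalP (cid (s2valP' (denom r))). Qed.

Definition dimN : nat := #|{: option 'I_(g + g) * K3}|.-1.

Definition hmap (tau : 'M[C]_g) (z : 'cV[C]_g) : projspace C dimN :=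
  let r := select L tau in let tau0 := sp_act (invmx r) tau in
  mkpt (coord_row (intmx_of r) tau0 (transfer r (scale_of r) tau0 *m z)).

Lemma fund_siegel : fund `<=` @siegel R g.
Proof.
move=> tau /selectP[rL it]; have hr := hL rL.
have [ht -> _] := in_translateP hr it.
by apply: act_siegel => //; exact: growth_siegel (tame_sym ht) (tame_growth c0 ht).
Qed.

Lemma hmap_embedding tau : fund tau ->
  torus_embedding (lattice D tau) (parallelogram D tau) (hmap tau).
Proof.
move=> /selectP[rL it]; have hr := hL rL; rewrite /hmap.
have [ht tE _] := in_translateP hr it; rewrite [in lattice D tau]tE.
exact: (torus_coord_embedding hr hD (scale_of_gt0 _) (intmx_ofE _)
  (tame_growth c0 ht) (tame_sym ht) (dom ht)).
Qed.

Lemma dp_in_translate (I : Type) r (M : (I -> R) -> 'M[C]_g) : dmx M ->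
  dprd (fun v => in_translate r (M v)).
Proof.
move=> hM; pose mk (w : Pr + Pr -> R) : 'M[C]_g :=
  \matrix_(i, j) Complex (w (inl (i, j))) (w (inr (i, j))).
apply: (@dp_iff _ _ (fun v => exists w, tm (mk w) /\ M v *m jden r (mk w) = nnum r (mk w))).
  move=> v; split=> [[w [h1 h2]]|[t0 h1 h2]]; first by exists (mk w).
  pose w (s : Pr + Pr) := match s with inl ij => complex.Re (t0 ij.1 ij.2)
    | inr ij => complex.Im (t0 ij.1 ij.2) end.
  exists w; suff -> : mk w = t0 by [].
  by apply/matrixP => i j; rewrite mxE /=; case: (t0 i j).
apply: dp_ex.
have hmk : dmx (fun s : I + (Pr + Pr) -> R => mk (fun j => s (inr j))).
  move=> i j; apply: dC_ext (_ : dfunC (fun s : I + (Pr + Pr) -> R =>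
    Complex (s (inr (inl (i, j)))) (s (inr (inr (i, j)))))) => [v|]; first by rewrite mxE.
  by split; exact: dt_var.
have hM' : dmx (fun s : I + (Pr + Pr) -> R => M (fun i => s (inl i))).
  by move=> i j; exact: (dC_ren inl (hM i j)).
apply: dp_and; first exact: dp_tame.
apply: dp_eqmx.
  by apply: dmx_mul => //; apply: dmx_add; [apply: dmx_mul|]; rewrite //; exact: dmx_cst.
by apply: dmx_add; [apply: dmx_mul|]; rewrite //; exact: dmx_cst.
Qed.

Lemma dp_fund (I : Type) (M : (I -> R) -> 'M[C]_g) : dmx M -> dprd (fun v => fund (M v)).
Proof.
move=> hM; apply: (@dp_iff _ _ (fun v => exists s : 'I_(size L), in_translate (nth 0 L s) (M v))).
  move=> v; split=> [[s hs]|[r rL hr]]; first by exists (nth 0 L s) => //; exact: mem_nth.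
  have := rL; rewrite -index_mem => h; exists (Ordinal h); by rewrite /= nth_index.
by apply: dp_ex_fin => s; exact: dp_in_translate.
Qed.

Lemma dp_select (I : Type) r (M : (I -> R) -> 'M[C]_g) : dmx M -> dprd (fun v => select L (M v) = r).
Proof.
move=> hM; elim: (L) => [|r' s IH] /=; first exact: dp_cst.
have h := dp_in_translate r' hM.
apply: dp_iff (dp_or (dp_and h (dp_cst _ (r' = r))) (dp_and (dp_not h) IH)) => v.
by case: asboolP => hv; split=> [[[]|[]]//|e]; [left|right].
Qed.

(** [P] and [Wm] depend on the characteristic and on the bounds [Y] and [P0] alone, hence are
    uniform in [tau] and [z]. The sign conditions stand inside the existential so that the
    parameters can be fixed by a definition. *)
Lemma theta_params (a mu : 'cV[R]_g) (Y P0 : R) : exists pw : nat * R,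
  0 <= Y -> 0 <= P0 -> forall lam xx (A B : 'I_g -> R),
  (forall al, 1 <= lam al) -> (forall al, `|xx al| <= Y) -> (forall i j, xx (i, j) = xx (j, i)) ->
  (forall i, `|A i| <= P0) -> (forall i, `|B i| <= P0) ->
  Theta_tm a mu pw.1 pw.2 lam xx A B =
  Theta 3 (taum lam xx) a mu (taum lam xx *m rz (\col_i A i) + rz (\col_i B i)).
Proof.
pose P := (Num.Def.truncn (2 * ((\sum_i `|a i 0|) + P0))).+1.
pose S1 := \sum_i `|mu i 0|.
pose S2 := \sum_i `|a i 0| * (g%:R * (Y * (2 * P%:R)) + 3 * P0).
pose S3 := 3 * (g%:R * (Y * P%:R) + P0).
exists (P, S3 + S1 + S2 + Y) => Y0 P00 lam xx A B hl hx xs hA hB /=.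
have g0 : 0 <= g%:R :> R by [].
have P1 : 0 <= P%:R :> R by [].
have S10 : 0 <= S1 by apply: sumr_ge0.
have YP : 0 <= g%:R * (Y * P%:R) by do 2?apply: mulr_ge0.
have S20 : 0 <= S2.
  apply: sumr_ge0 => i _; apply: mulr_ge0 => //; apply: addr_ge0; last by rewrite mulr_ge0.
  by do 3?apply: mulr_ge0.
have S30 : 0 <= S3 by rewrite /S3; lra.
apply: (Theta_tmE Y0 P00) => //.
- move=> i; apply: ltW; apply: le_lt_trans (truncnS_gt _); rewrite ler_wpM2l // lerD2r.
  by rewrite (bigD1 i) //= lerDl sumr_ge0.
- move=> i; rewrite -/S3; have : `|mu i 0| <= S1 by rewrite /S1 (bigD1 i) //= lerDl sumr_ge0.
  lra.
- by rewrite -/S2; lra.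
- lra.
Qed.

(** Points of the parallelogram have real coordinates in [0, 1), so this bounds their images under
    [W]; it is what keeps the theta arguments in a fixed box. *)
Definition rho_bound r : R := \sum_i \sum_j `|WR R (intmx_of r) i j|.

Definition params r x : nat * R :=
  sval (cid (theta_params (chara R (intmx_of r) x) (charmu R (intmx_of r) x.1) `|X| (rho_bound r))).

Definition coord_tm r (lam xx : Pr -> R) (rho rho' : 'I_g -> R) i : C :=
  let x := coord_index i in
  let v := WR R (intmx_of r) *m col_mx (\col_i rho i) (\col_i rho' i) in
  Theta_tm (chara R (intmx_of r) x) (charmu R (intmx_of r) x.1) (params r x).1 (params r x).2
    lam xx (fun i => v (lshift g i) 0) (fun i => v (rshift g i) 0).

(** The graph in the i-th chart over the translate by [r], with every unknown explicit: [lam] and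
    [xx] are coordinates of [tau0], [rho] and [rho'] those of [z]. The chart equations are cleared
    of denominators. *)
Definition graph_body r i (z : 'cV[C]_g) (tau : 'M[C]_g) (u : 'I_dimN -> C)
    (lam xx : Pr -> R) (rho rho' : 'I_g -> R) : Prop :=
  ((forall i, (0 <= rho i /\ rho i < 1) /\ (0 <= rho' i /\ rho' i < 1)) /\
   z = tau *m rz (\col_i rho i) + map_mx intr D *m rz (\col_i rho' i)) /\
  (((forall al, 1 <= lam al) /\ (forall al, `|xx al| <= X) /\
    (forall al : Pr, xx (al.1, al.2) = xx (al.2, al.1))) /\
   (tm (taum lam xx) /\ tau *m jden r (taum lam xx) = nnum r (taum lam xx))) /\
  (~ coord_tm r lam xx rho rho' i = 0 /\
   forall k, coord_tm r lam xx rho rho' (lift i k) = u k * coord_tm r lam xx rho rho' i).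

Lemma coord_tmE r lam xx rho rho' i tau : Sp r -> (forall al, 1 <= lam al) ->
  (forall al, `|xx al| <= X) -> (forall al : Pr, xx (al.1, al.2) = xx (al.2, al.1)) ->
  tm (taum lam xx) -> tau *m jden r (taum lam xx) = nnum r (taum lam xx) ->
  (forall i, (0 <= rho i /\ rho i < 1) /\ (0 <= rho' i /\ rho' i < 1)) ->
  coord_tm r lam xx rho rho' i =
  coord_row (intmx_of r) (taum lam xx) (transfer r (scale_of r) (taum lam xx) *m
    (tau *m rz (\col_i rho i) + map_mx intr D *m rz (\col_i rho' i))) 0 i.
Proof.
move=> hr hl hx xs ht E hrho.
have sg := growth_siegel (tame_sym ht) (tame_growth c0 ht).
have tE : tau = sp_act r (taum lam xx) by rewrite sp_actE -E mulmxK // jden_unit.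
rewrite /coord_tm; set v := _ *m _; set x := coord_index i.
rewrite tE (transferE hr (intmx_ofE r) (tame_growth c0 ht) (tame_sym ht)).
have vE : map_mx intr (intmx_of r) *m col_mx (rz (\col_i rho i)) (rz (\col_i rho' i)) = map_mx RC v.
  rewrite /v map_mxM; congr (_ *m _); last by rewrite map_col_mx.
  by apply/matrixP => k l; rewrite !mxE rmorph_int.
have P00 : 0 <= rho_bound r by apply: sumr_ge0 => k _; apply: sumr_ge0.
have vb k : `|v k 0| <= rho_bound r.
  rewrite /v mxE /rho_bound [leRHS](bigD1 k) //=; apply: ler_wpDr.
    by apply: sumr_ge0 => l _; apply: sumr_ge0.
  apply: (le_trans (ler_norm_sum _ _ _)); apply: ler_sum => l _.
  rewrite normrM ler_piMr //; case: (split_ordP l) => m ->.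
    by rewrite col_mxEu mxE; have [[h1 h2] _] := hrho m; rewrite ger0_norm // ltW.
  by rewrite col_mxEd mxE; have [_ [h1 h2]] := hrho m; rewrite ger0_norm // ltW.
have hp := svalP (cid (theta_params (chara R (intmx_of r) x) (charmu R (intmx_of r) x.1) `|X| (rho_bound r))).
have hx' al : `|xx al| <= `|X| by apply: (le_trans (hx al)); exact: ler_norm.
have xs' k l : xx (k, l) = xx (l, k) by exact: (xs (k, l)).
have := hp (normr_ge0 _) P00 lam xx _ _ hl hx' xs' (fun k => vb (lshift g k)) (fun k => vb (rshift g k)).
move=> hE; etransitivity; first exact: hE.
have <- : usubmx (map_mx RC v) = rz (\col_i v (lshift g i) 0) by apply/colP => k; rewrite !mxE.
have <- : dsubmx (map_mx RC v) = rz (\col_i v (rshift g i) 0) by apply/colP => k; rewrite !mxE.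
rewrite -vE.
move: (taum lam xx *m _ + _) => Z.
symmetry; exact: mxE.
Qed.

(** From left to right [tame_taum] supplies the coordinates of [tau0]. Conversely the equation for
    [tau] determines [tau0] ([taum_eq]), so every witness describes the point that [hmap] takes. *)
Lemma graph_bodyP i z tau u : fund tau ->
  parallelogram D tau z /\ homog_coords (hmap tau z) (chart i (\row_k u k)) <->
  exists lam xx rho rho', graph_body (select L tau) i z tau u lam xx rho rho'.
Proof.
move=> ft; have [rL it] := selectP ft; have hr := hL rL.
set r := select L tau in rL it hr *.
have [ht tE jE] := in_translateP hr it.
have nz0 t : tm t -> forall w, coord_row (intmx_of r) t w != 0 :> 'rV[C]_dimN.+1.
  move=> h w.
  exact: (coord_row_neq0 (intmx_of r) (tame_growth c0 h) (tame_sym h) (dom h) w).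
split=> [[[rho [rho' [hrho zE]]] hc]|[lam [xx [rho [rho' [[hrho zE] [[[hl [hx xs]] [ht' E]] [n0 hu]]]]]]]].
  have [lam [xx [hl hx xs tq]]] := tame_taum ht c2.
  have xs' : forall al : Pr, xx (al.1, al.2) = xx (al.2, al.1) by move=> al; exact: xs.
  have hrho' i' : (0 <= rho i' 0 /\ rho i' 0 < 1) /\ (0 <= rho' i' 0 /\ rho' i' 0 < 1).
    by have [/andP[h1 h2] /andP[h3 h4]] := hrho i'.
  rewrite tq in ht jE.
  have rE : \col_i' rho i' 0 = rho by apply/colP => k; rewrite mxE.
  have rE' : \col_i' rho' i' 0 = rho' by apply/colP => k; rewrite mxE.
  have cE j : coord_tm r lam xx (fun i' => rho i' 0) (fun i' => rho' i' 0) j =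
     coord_row (intmx_of r) (taum lam xx) (transfer r (scale_of r) (taum lam xx) *m z) 0 j.
    by rewrite (coord_tmE j hr hl hx xs' ht jE hrho') rE rE' zE.
  exists lam, xx, (fun i' => rho i' 0), (fun i' => rho' i' 0); split; first by rewrite rE rE'.
  split; first by [].
  move: hc; rewrite /hmap -/r tq (homog_chart _ _ (nz0 _ ht _)) => -[h1 h2].
  split; first by rewrite cE; apply/eqP.
  by move=> k; rewrite !cE h2 mxE.
have tq := taum_eq hr ht' E.
split.
  exists (\col_i rho i), (\col_i rho' i); split=> // i'; rewrite !mxE.
  by have [[-> ->] [-> ->]] := hrho i'.
have cE j : coord_tm r lam xx rho rho' j =
     coord_row (intmx_of r) (taum lam xx) (transfer r (scale_of r) (taum lam xx) *m z) 0 j.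
  by rewrite (coord_tmE j hr hl hx xs ht' E hrho) zE.
rewrite /hmap -/r tq (homog_chart _ _ (nz0 _ ht' _)) -!cE; split; first exact/eqP.
by move=> k; rewrite -cE hu mxE.
Qed.

Lemma dp_graph_body (I : Type) r i (z : (I -> R) -> 'cV[C]_g) (tau : (I -> R) -> 'M[C]_g)
    (u : 'I_dimN -> (I -> R) -> C) : dmx z -> dmx tau -> (forall k, dfunC (u k)) ->
  dprd (fun v => exists lam xx rho rho', graph_body r i (z v) (tau v) (u^~ v) lam xx rho rho').
Proof.
move=> hz ht hu.
apply: (@dp_iff _ _ (fun v => exists w : (Pr + Pr) + ('I_g + 'I_g) -> R,
   graph_body r i (z v) (tau v) (u^~ v) (fun al => w (inl (inl al))) (fun al => w (inl (inr al)))
     (fun j => w (inr (inl j))) (fun j => w (inr (inr j))))).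
  move=> v; split=> [[w hw]|[lam [xx [rho [rho' h]]]]]; first by do 4!eexists; exact: hw.
  by exists (fun s => match s with inl (inl al) => lam al | inl (inr al) => xx al
    | inr (inl j) => rho j | inr (inr j) => rho' j end).
apply: dp_ex; set J := ((Pr + Pr) + ('I_g + 'I_g))%type.
pose hzI := fun a b => dC_ren (inl : I -> I + J) (hz a b).
pose htI := fun a b => dC_ren (inl : I -> I + J) (ht a b).
pose huI := fun k => dC_ren (inl : I -> I + J) (hu k).
have rzv (f : 'I_g -> (I + J -> R) -> R) : (forall j, dterm (f j)) ->
    dmx (fun s => rz (\col_j f j s)).
  move=> hf a b; apply: dC_ext (dC_real (hf a)) => s; by rewrite !mxE.
have tq : dmx (fun s : I + J -> R => taum (fun al => s (inr (inl (inl al))))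
    (fun al => s (inr (inl (inr al))))).
  move=> a b; split.
    apply: (@dt_ext _ _ (fun s : I + J -> R => s (inr (inl (inr (a, b)))))) => [s|].
      by rewrite mxE.
    exact: dt_var.
  apply: (@dt_ext _ _ (fun s : I + J -> R => \sum_al
      s (inr (inl (inl al))) * lform al (delta_mx a 0) * lform al (delta_mx b 0))) => [s|].
    by rewrite [in RHS]mxE /= [in RHS]mxE.
  by apply: dt_sum => al; apply: dt_mul; [apply: dt_mul; [exact: dt_var|]|]; exact: dt_cst.
have cm j : dfunC (fun s : I + J -> R => coord_tm r (fun al => s (inr (inl (inl al))))
    (fun al => s (inr (inl (inr al)))) (fun k => s (inr (inr (inl k)))) (fun k => s (inr (inr (inr k)))) j).
  have hw k : dterm (fun s : I + J -> R => (WR R (intmx_of r) *m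
      col_mx (\col_k s (inr (inr (inl k)))) (\col_k s (inr (inr (inr k))))) k 0).
    apply: (@dt_ext _ _ (fun s : I + J -> R =>
      \sum_l WR R (intmx_of r) k (lshift g l) * s (inr (inr (inl l))) +
      \sum_l WR R (intmx_of r) k (rshift g l) * s (inr (inr (inr l))))) => [s|].
      rewrite [RHS]mxE big_split_ord /=; congr (_ + _); apply: eq_bigr => l _.
        by rewrite col_mxEu mxE.
      by rewrite col_mxEd mxE.
    by apply: dt_add; apply: dt_sum => l; apply: dt_mul; [exact: dt_cst|exact: dt_var|exact: dt_cst|exact: dt_var].
  by apply: Theta_tm_definable => // *; exact: dt_var.
apply: dp_and; [apply: dp_and|apply: dp_and; [apply: dp_and|apply: dp_and]].
- apply: dp_all => j; apply: dp_and; apply: dp_and; [apply: dp_le|apply: dp_lt|apply: dp_le|apply: dp_lt];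
    by [exact: dt_var|exact: dt_cst].
- apply: dp_eqmx; first exact: hzI.
  apply: dmx_add; apply: dmx_mul; [exact: htI| |exact: dmx_cst|].
    by apply: rzv => k; exact: dt_var.
  by apply: rzv => k; exact: dt_var.
- apply: dp_and; last apply: dp_and.
  + by apply: dp_all => al; apply: dp_le; [exact: dt_cst|exact: dt_var].
  + by apply: dp_all => al; apply: dp_norm_le; [exact: dt_var|exact: dt_cst].
  + by apply: dp_all => al; apply: dp_eq; exact: dt_var.
- apply: dp_and; first exact: dp_tame.
  apply: dp_eqmx.
    by apply: dmx_mul => //; apply: dmx_add; [apply: dmx_mul|]; rewrite //; exact: dmx_cst.
  by apply: dmx_add; [apply: dmx_mul|]; rewrite //; exact: dmx_cst.
- by apply: dp_not; apply: dp_eqC => //; exact: dC_cst.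
- by apply: dp_all => k; apply: dp_eqC => //; apply: dC_mul.
Qed.

Lemma fund_definable : definableM fund.
Proof.
rewrite /definableM.
have -> : mxvec @` fund = [set v : 'rV[C]_(g * g) |
    fund (\matrix_(i, j) (fun k => v 0 k) (mxvec_index i j))].
  apply/seteqP; split=> [_ [tau ft <-]|v /= fv] /=.
    suff -> : \matrix_(i, j) mxvec tau 0 (mxvec_index i j) = tau by [].
    by apply/matrixP => i j; rewrite mxE mxvecE.
  exists (\matrix_(i, j) v 0 (mxvec_index i j)) => //.
  apply/rowP => k; case/mxvec_indexP: k => i j; by rewrite mxvecE mxE.
apply: (@definableC_pred R _ (fun c => fund (\matrix_(i, j) c (mxvec_index i j)))).
apply: dp_fund => i j.
apply: (@dC_ext _ _ (fun e => csub e (mxvec_index i j))) => [e|]; first by rewrite mxE.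
exact: dC_csub.
Qed.

Lemma graph_definable :
  definableCP [set q | exists (z : 'cV[C]_g) (tau : 'M[C]_g),
    [/\ fund tau, parallelogram D tau z & q = (row_mx z^T (mxvec tau), hmap tau z)]].
Proof.
move=> i.
pose zc (c : 'I_((g + g * g) + dimN) -> C) : 'cV[C]_g := \col_k c (lshift dimN (lshift (g * g) k)).
pose tc (c : 'I_((g + g * g) + dimN) -> C) : 'M[C]_g :=
  \matrix_(k, l) c (lshift dimN (rshift g (mxvec_index k l))).
pose uc (c : 'I_((g + g * g) + dimN) -> C) (k : 'I_dimN) : C := c (rshift (g + g * g) k).
pose Q c := fund (tc c) /\ (parallelogram D (tc c) (zc c) /\
  homog_coords (hmap (tc c) (zc c)) (chart i (\row_k uc c k))).
set S := [set v | _]; have -> : S = [set v : 'rV[C]_((g + g * g) + dimN) | Q (fun k => v 0 k)].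
  apply/seteqP; split=> [_ [x [u [p [[z [tau [ft pz [-> ->]]]] hp ->]]]]|v [ft [pz hp]]] /=.
    rewrite /Q; have -> : tc (fun k => row_mx (row_mx z^T (mxvec tau)) u 0 k) = tau.
      by apply/matrixP => k l; rewrite mxE row_mxEl row_mxEr mxvecE.
    have -> : zc (fun k => row_mx (row_mx z^T (mxvec tau)) u 0 k) = z.
      by apply/colP => k; rewrite mxE !row_mxEl mxE.
    have -> : \row_k uc (fun k => row_mx (row_mx z^T (mxvec tau)) u 0 k) k = u.
      by apply/rowP => k; rewrite mxE /uc row_mxEr.
    by [].
  set cc := fun k => v 0 k in ft pz hp.
  exists (row_mx (zc cc)^T (mxvec (tc cc))), (\row_k uc cc k), (hmap (tc cc) (zc cc)); split=> //.
    by exists (zc cc), (tc cc).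
  apply/rowP => k; case: (split_ordP k) => k' ->; last by rewrite row_mxEr mxE.
  rewrite row_mxEl; case: (split_ordP k') => l ->; first by rewrite row_mxEl !mxE.
  by rewrite row_mxEr; case/mxvec_indexP: l => a b; rewrite mxvecE mxE.
apply: definableC_pred.
have dz : dmx (fun e : 'I_(_ + _) -> R => zc (csub e)).
  move=> a b; apply: (@dC_ext _ _ (fun e => csub e (lshift dimN (lshift (g * g) a)))) => [e|].
    by rewrite mxE.
  exact: dC_csub.
have dt : dmx (fun e : 'I_(_ + _) -> R => tc (csub e)).
  move=> a b; apply: (@dC_ext _ _ (fun e => csub e (lshift dimN (rshift g (mxvec_index a b))))) => [e|].
    by rewrite mxE.
  exact: dC_csub.
have du k : dfunC (fun e : 'I_(_ + _) -> R => uc (csub e) k) by exact: dC_csub.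
(* Case distinction on the finitely many values of [select]; within a case [r] is a constant of the
   formula. *)
apply: (@dp_iff _ _ (fun e => fund (tc (csub e)) /\ exists s : 'I_(size L),
   select L (tc (csub e)) = nth 0 L s /\ exists lam xx rho rho',
   graph_body (nth 0 L s) i (zc (csub e)) (tc (csub e)) (uc (csub e)) lam xx rho rho')).
  move=> e; rewrite /Q; split=> [[ft [s [<- hs]]]|[ft hq]]; split=> //.
    exact/graph_bodyP.
  have [rL _] := selectP ft; have := rL; rewrite -index_mem => h; exists (Ordinal h).
  by rewrite /= nth_index //; split=> //; apply/graph_bodyP.
apply: dp_and; first exact: dp_fund.
apply: dp_ex_fin => s; apply: dp_and; first exact: dp_select.
exact: (dp_graph_body (nth 0 L s) i dz dt du).
Qed.

End Family.

(** * Existence of the definable family of embeddings *)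

Theorem theorem8p5 (R : realType) (g : nat) (hg : (0 < g)%N)
    (D : 'M[int]_g) (hD : polarization_type D) :
  exists (F : set 'M[R[i]]_g) (N : nat)
         (h : 'M[R[i]]_g -> 'cV[R[i]]_g -> projspace R[i] N),
    [/\ F `<=` @siegel R g,
        definableM F,
        forall tau, @siegel R g tau ->
          exists2 M : 'M[rat]_(g + g), GD D M & F (sp_act M tau),
        definableCP
          [set q | exists (z : 'cV[R[i]]_g) (tau : 'M[R[i]]_g),
             [/\ F tau, parallelogram D tau z
               & q = (row_mx z^T (mxvec tau), h tau z)]]
      & forall tau, F tau ->
          torus_embedding (lattice D tau) (parallelogram D tau) (h tau)].
Proof.
have [c1 c1_gt0 dom1] := dominance R g.
(* [c1] serves the dominance of theta terms, and [4 g + 2] the coordinates of [tame_taum]. *)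
pose c := Num.max c1 (4 * g%:R + 2).
have c0 : 0 < c by rewrite lt_max c1_gt0.
have c2 : 4 * g%:R + 2 <= c by rewrite le_max lexx orbT.
have [X [L [hL red]]] := GD_reduction hD c0 (eps_g_gt0 R g).
have dom tau : tame X c (eps_g R g) tau -> forall r n0 z (A : {fset 'cV[int]_g}),
    good r n0 -> imx z = imx tau *m r -> n0 \notin A ->
    \sum_(n <- A) Normc.normc (tterm 1 tau 0 0 z n) <= Normc.normc (tterm 1 tau 0 0 z n0) / 10.
  move=> [h1 h2 h3 h4]; apply: (dom1 X); split=> // i.
  by apply: le_trans (h3 i); rewrite le_max lexx.
exists (fund X c L), (dimN g), (hmap D X c L); split.
- exact: fund_siegel.
- exact: fund_definable.
- move=> tau htau; have [M [r [tau0 [hM rL ht sg E]]]] := red tau htau.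
  exists M => //; exists r => //; exists tau0 => //; rewrite E; exact: act_jden (hL _ rL) sg.
- exact: graph_definable.
- exact: hmap_embedding.
Qed.
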